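(* Let $N\ge 1$, $p\in[0,1)$, $q=1-p\neq 0$, $\tau=p/q$, and consider the $N$-particle ASEP on $\mathbb{Z}$ started from $Y=\{y_1<\cdots<y_N\}$, with particle positions $x_1(t)<\cdots<x_N(t)$ at time $t\ge0$. Let $1\le m\le N$ and let $x_1<\cdots<x_m$ be integers. Then for all sufficiently large $R>0$, \[ \mathbb{P}_Y\big(x_i(t)=x_i,\ i=1,\dots,m\big)=\sum_{\Lambda,\,S}(-1)^{\sigma(S,\Lambda)-(m-1)k}\,\mathrm{sgn}\,\Lambda\ \tau^{\sum_{i<m}(\ell_i-i)+\sigma(S)-mk}\,q^{k(k-1)/2} \int_{\mathcal{C}_R}\!\!\cdots\!\int_{\mathcal{C}_R} \frac{\prod_{i\in\Lambda,\,j\in S}f(\xi_i,\xi_j)\ \prod_{1\le i<j\le m-1}f(\xi_{\ell_i},\xi_{\ell_j})}{\prod_{i<j,\ i,j\in S\cup\Lambda}f(\xi_i,\xi_j)} \] \[ \times\Big(1-\prod_{j\in S}\xi_j\Big)\frac{\prod_{i<j,\ i,j\in S}(\xi_j-\xi_i)}{\prod_{j\in S}(1-\xi_j)}\ \prod_{i<m}\xi_{\ell_i}^{x_i}\ \prod_{j\in S}\xi_j^{x_m}\prod_{i\in S\cup\Lambda}\xi_i^{-y_i-1}\,e^{\sum_{i\in S\cup\Lambda}\varepsilon(\xi_i)t}\prod_{i\in S\cup\Lambda}d\xi_i , \] where the sum runs over all subsets $S\subset\{1,\dots,N\}$ and all ordered $(m-1)$-tuples $\Lambda=(\ell_1,\dots,\ell_{m-1})$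 of distinct elements of $\{1,\dots,N\}$ disjoint from $S$, $k=|S|$, and each variable is integrated over the circle $\mathcal{C}_R$ centered at $0$ of radius $R$.
   Context: ASEP: each particle independently waits an exponential time (rate 1); then with probability $p$ it attempts to jump one step right and with probability $q=1-p$ one step left, the jump being executed only if the target site is unoccupied. $\mathbb{P}_Y$ denotes probability for the process started from $Y$. Notation: $f(\xi,\xi')=p+q\xi\xi'-\xi$, $\varepsilon(\xi)=p\xi^{-1}+q\xi-1$. Every contour integral carries a factor $1/(2\pi i)$. $\Lambda$ is also regarded as the set $\{\ell_1,\dots,\ell_{m-1}\}$ where appropriate. $\mathrm{sgn}\,\Lambda=(-1)^{\#\{(i,j):\,i<j,\ \ell_i>\ell_j\}}$. For sets $U,V$ of indices, $\sigma(U,V)=\#\{(i,j): i\in U,\ j\in V,\ i\ge j\}$, and $\sigma(U)=\sigma(U,\{1,\dots,N\})$. When $p=0$, $\tau^0$ is interpreted as $1$. In a product $\prod$ the product symbol applies only to the factor immediately following it. *)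

(* Defs.v *)
From Stdlib Require Import Reals List ZArith Arith.
From Coquelicot Require Import Coquelicot.
Import ListNotations.
Open Scope R_scope.

Definition iota1 (n : nat) : list nat := seq 1 n.

Definition memb (a : nat) (l : list nat) : bool := existsb (Nat.eqb a) l.

Fixpoint nodupb (l : list nat) : bool :=
  match l with
  | [] => true
  | a :: l' => andb (negb (memb a l')) (nodupb l')
  end.

Fixpoint subsets (l : list nat) : list (list nat) :=
  match l with
  | [] => [[]]
  | a :: l' => map (cons a) (subsets l') ++ subsets l'
  end.

Fixpoint words {A : Type} (pool : list A) (r : nat) : list (list A) :=
  match r with
  | O => [[]]
  | S r' => flat_map (fun a => map (cons a) (words pool r')) pool
  end.

Fixpoint pairs {A : Type} (l : list A) : list (A * A) :=
  match l with
  | [] => []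
  | a :: l' => map (fun b => (a, b)) l' ++ pairs l'
  end.

Definition countb {A : Type} (P : A -> bool) (l : list A) : nat :=
  length (filter P l).

Definition sumn (l : list nat) : nat := fold_right Nat.add 0%nat l.
Definition sumZ (l : list Z) : Z := fold_right Z.add 0%Z l.

Definition sigmaUV (U V : list nat) : nat :=
  sumn (map (fun i => countb (fun j => Nat.leb j i) V) U).

Definition sigmaU (N : nat) (U : list nat) : nat := sigmaUV U (iota1 N).

Definition inversions (l : list nat) : nat :=
  countb (fun ab => Nat.ltb (snd ab) (fst ab)) (pairs l).

Definition sgnL (l : list nat) : R := (-1) ^ inversions l.

Definition ell (L : list nat) (i : nat) : nat := nth (i - 1) L 0%nat.

Open Scope C_scope.

Definition Cprod (l : list C) : C := fold_right Cmult 1 l.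
Definition Csum (l : list C) : C := fold_right Cplus 0 l.

Definition Cpowz (z : C) (n : Z) : C :=
  match n with
  | Z0 => 1
  | Zpos k => Cpow z (Pos.to_nat k)
  | Zneg k => Cinv (Cpow z (Pos.to_nat k))
  end.

Definition Cexp (z : C) : C :=
  RtoC (exp (fst z)) * (cos (snd z), sin (snd z)).

(* (1/(2 pi i)) \oint_{|xi| = R} g(xi) d xi, circle positively oriented *)
Definition contour (R0 : R) (g : C -> C) : C :=
  RtoC (/ (2 * PI)) *
  RInt (V := C_R_CompleteNormedModule)
       (fun th : R => g (RtoC R0 * Cexp (0, th)) * (RtoC R0 * Cexp (0, th)))
       0 (2 * PI).

Definition upd (env : nat -> C) (v : nat) (z : C) : nat -> C :=
  fun j => if Nat.eqb j v then z else env j.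

Fixpoint mcint (R0 : R) (vars : list nat) (F : (nat -> C) -> C) (env : nat -> C) : C :=
  match vars with
  | [] => F env
  | v :: vs => contour R0 (fun z => mcint R0 vs F (upd env v z))
  end.

Definition fA (p : R) (a b : C) : C := RtoC p + RtoC (1 - p) * a * b - a.
Definition epsA (p : R) (a : C) : C := RtoC p * Cinv a + RtoC (1 - p) * a - 1.

Definition integrand (N m : nat) (p t : R) (Y x : nat -> Z)
    (S L : list nat) (xi : nat -> C) : C :=
  let U := S ++ L in
  let num1 := Cprod (flat_map (fun i => map (fun j => fA p (xi i) (xi j)) S) L) in
  let num2 := Cprod (map (fun ab => fA p (xi (fst ab)) (xi (snd ab))) (pairs L)) in
  let den := Cprod (flat_map (fun i =>
                 map (fun j => fA p (xi i) (xi j)) (filter (fun j => Nat.ltb i j) U)) U) in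
  let fac1 := 1 - Cprod (map xi S) in
  let van := Cprod (flat_map (fun i =>
                 map (fun j => xi j - xi i) (filter (fun j => Nat.ltb i j) S)) S) in
  let den2 := Cprod (map (fun j => 1 - xi j) S) in
  let pw1 := Cprod (map (fun a => Cpowz (xi (ell L a)) (x a)) (iota1 (m - 1))) in
  let pw2 := Cprod (map (fun j => Cpowz (xi j) (x m)) S) in
  let pw3 := Cprod (map (fun i => Cpowz (xi i) (- Y i - 1)%Z) U) in
  let ex := Cexp (Csum (map (fun i => epsA p (xi i) * RtoC t) U)) in
  num1 * num2 / den * fac1 * (van / den2) * pw1 * pw2 * pw3 * ex.

Definition Lambdas (N m : nat) (S : list nat) : list (list nat) :=
  filter (fun L => andb (nodupb L) (forallb (fun l => negb (memb l S)) L))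
         (words (iota1 N) (m - 1)).

Definition coeff (N m : nat) (p : R) (S L : list nat) : R :=
  let q := (1 - p)%R in
  let tau := (p / q)%R in
  let k := length S in
  let sgnexp := (Z.of_nat (sigmaUV S L) - Z.of_nat ((m - 1) * k))%Z in
  let tauexp := (sumZ (map (fun i => Z.of_nat (ell L i) - Z.of_nat i)%Z (iota1 (m - 1)))
                 + Z.of_nat (sigmaU N S) - Z.of_nat (m * k))%Z in
  (powerRZ (-1) sgnexp * sgnL L * powerRZ tau tauexp * q ^ (k * (k - 1) / 2))%R.

Definition asep_rhs (N m : nat) (p t : R) (Y x : nat -> Z) (R0 : R) : C :=
  Csum (flat_map (fun S =>
          map (fun L => RtoC (coeff N m p S L) *
                        mcint R0 (S ++ L) (integrand N m p t Y x S L) (fun _ => 0))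
              (Lambdas N m S))
        (subsets (iota1 N))).

Close Scope C_scope.

(** * The N-particle ASEP (left-hand side)

   Positions are a function s : nat -> Z, s i = position of particle i (1<=i<=N).
   Construction: the N independent rate-1 exponential clocks superpose to a
   rate-N Poisson process whose rings are attributed to a uniformly chosen
   particle; at each ring the chosen particle attempts a right jump w.p. p and
   a left jump w.p. q = 1-p, executed only if the target is empty. Hence the
   law at time t is  sum_n e^{-Nt} (Nt)^n/n! K^n  with K the one-ring kernel. *)

Definition occupiedb (N : nat) (s : nat -> Z) (z : Z) : bool :=
  existsb (fun i => Z.eqb (s i) z) (iota1 N).

Definition step (N : nat) (s : nat -> Z) (c : nat * bool) : nat -> Z :=
  let i := fst c in
  let z := (s i + (if snd c then 1 else -1))%Z in
  if occupiedb N s z then s else (fun j => if Nat.eqb j i then z else s j).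

Definition choices (N : nat) : list (nat * bool) :=
  flat_map (fun i => [(i, true); (i, false)]) (iota1 N).

Definition weight (N : nat) (p : R) (c : nat * bool) : R :=
  (if snd c then p else 1 - p) / INR N.

Definition event (m : nat) (x : nat -> Z) (s : nat -> Z) : bool :=
  forallb (fun i => Z.eqb (s i) (x i)) (iota1 m).

Definition Kn (N : nat) (p : R) (Y : nat -> Z) (m : nat) (x : nat -> Z) (n : nat) : R :=
  fold_right Rplus 0
    (map (fun w => fold_right Rmult 1 (map (weight N p) w) *
                   (if event m x (fold_left (step N) w Y) then 1 else 0))
         (words (choices N) n)).

Definition asep_prob (N : nat) (p t : R) (Y : nat -> Z) (m : nat) (x : nat -> Z) : R :=
  Series (fun n => exp (- (INR N * t)) * (INR N * t) ^ n / INR (fact n) * Kn N p Y m x n).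

(* Main.v *)
(* Every integral is an average over the torus |xi_i| = R of a uniform limit of Laurent polynomials,
   so only the exponents that occur matter: the average of a monomial vanishes unless its exponent is 0.
   Grouping the terms by U = S ∪ Λ turns the right-hand side into a sum over U ⊂ {1, ..., N} of averages
   of e^{t E_U} times an explicit density, with E_U the sum of the ε(xi_i).  Expanding the exponential,
   as the process is e^{-Nt} times the exponential of N t K for the one-ring kernel K, it suffices that
   the sums with (1 + E_U / N)^n in place of e^{t E_U} equal K^n.  This is an induction on n.  The step
   is the free evolution of the particles together with the boundary condition
   p H(y_i + 1) + q H(y_{i+1} - 1) = H(y) when y_{i+1} = y_i + 1.  The case n = 0 is an induction on m:
   if the first particle is to the right of x_1 all averages vanish for reasons of degree, if it is at
   x_1 only the term ℓ_1 = 1 survives, and if it is to the left of x_1 the index sets U and U ∪ {1} cancel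
   pairwise, because U gives the residue of U ∪ {1} at xi_1 = 1. *)

Require Import Defs.
From Stdlib Require Import Reals List ZArith Arith Lia Lra Permutation FunctionalExtensionality.
From Coquelicot Require Import Coquelicot.
Import ListNotations.
Open Scope C_scope.

(** * Finite sums and products *)

(** No residue calculus is used. For a radius above [4 / (1 - p)] every 1/f and 1/(1 - xi) is a
    geometric series in negative powers, so an average vanishes once some integer weight of all
    exponents that occur is negative. The obstacle is the cancellation of U against U with index 1
    added: in xi_1 the integrand has, besides the pole at 1, poles where f(xi_1, xi_j) = 0, which
    move with xi_j, and no single weight controls several of them. They are removed one at a time.
    Keeping only the denominators with j in a subset K gives an array indexed by K and y, and the
    identity f = p - xi_1 + q xi_1 xi_j becomes a recursion between K and K without j. With
    antisymmetry this leaves one pole, for which two weights suffice. Solving the recursion divides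
    by p, so p = 0 is a separate case, in which the coefficient or the integrand vanishes for every
    index set whose size is not m. *)

Definition bsum {A : Type} (f : A -> C) (l : list A) : C := Csum (map f l).
Definition bprod {A : Type} (f : A -> C) (l : list A) : C := Cprod (map f l).

Section BigOperators.
Context {A : Type}.
Implicit Types (f g : A -> C) (l : list A).

Lemma bsum_nil f : bsum f [] = 0.
Proof. reflexivity. Qed.

Lemma bsum_cons f a l : bsum f (a :: l) = f a + bsum f l.
Proof. reflexivity. Qed.

Lemma bprod_nil f : bprod f [] = 1.
Proof. reflexivity. Qed.

Lemma bprod_cons f a l : bprod f (a :: l) = f a * bprod f l.
Proof. reflexivity. Qed.

Lemma bsum_app f l1 l2 : bsum f (l1 ++ l2) = bsum f l1 + bsum f l2.
Proof.
  induction l1 as [|a l1 IH]; simpl app; [rewrite bsum_nil | rewrite !bsum_cons, IH]; ring.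
Qed.

Lemma bprod_app f l1 l2 : bprod f (l1 ++ l2) = bprod f l1 * bprod f l2.
Proof.
  induction l1 as [|a l1 IH]; simpl app; [rewrite bprod_nil | rewrite !bprod_cons, IH]; ring.
Qed.

Lemma bsum_ext f g l : (forall a, In a l -> f a = g a) -> bsum f l = bsum g l.
Proof. intros H; unfold bsum; f_equal; apply map_ext_in, H. Qed.

Lemma bprod_ext f g l : (forall a, In a l -> f a = g a) -> bprod f l = bprod g l.
Proof. intros H; unfold bprod; f_equal; apply map_ext_in, H. Qed.

Lemma bsum_perm f l l' : Permutation l l' -> bsum f l = bsum f l'.
Proof. induction 1; rewrite ?bsum_cons; try ring; congruence. Qed.

Lemma bprod_perm f l l' : Permutation l l' -> bprod f l = bprod f l'.
Proof. induction 1; rewrite ?bprod_cons; try ring; congruence. Qed.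

Lemma bsum_plus f g l : bsum (fun a => f a + g a) l = bsum f l + bsum g l.
Proof. induction l as [|a l IH]; rewrite ?bsum_nil, ?bsum_cons, ?IH; ring. Qed.

Lemma bsum_scal c f l : bsum (fun a => c * f a) l = c * bsum f l.
Proof. induction l as [|a l IH]; rewrite ?bsum_nil, ?bsum_cons, ?IH; ring. Qed.

Lemma bsum_0 f l : (forall a, In a l -> f a = 0) -> bsum f l = 0.
Proof.
  induction l as [|a l IH]; intros H; [reflexivity|].
  rewrite bsum_cons, H, IH by (simpl; auto; intros; apply H; simpl; auto). ring.
Qed.

Lemma bprod_mult f g l : bprod (fun a => f a * g a) l = bprod f l * bprod g l.
Proof. induction l as [|a l IH]; rewrite ?bprod_nil, ?bprod_cons, ?IH; ring. Qed.

Lemma bprod_1 f l : (forall a, In a l -> f a = 1) -> bprod f l = 1.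
Proof.
  induction l as [|a l IH]; intros H; [reflexivity|].
  rewrite bprod_cons, H, IH by (simpl; auto; intros; apply H; simpl; auto). ring.
Qed.

Lemma bprod_const c l : bprod (fun _ => c) l = c ^ length l.
Proof. induction l as [|a l IH]; [reflexivity|]. rewrite bprod_cons, IH; simpl; ring. Qed.

Lemma bprod_neq_0 f l : (forall a, In a l -> f a <> 0) -> bprod f l <> 0.
Proof.
  induction l as [|a l IH]; intros H; [apply C1_nz|].
  rewrite bprod_cons. apply Cmult_neq_0; [apply H; simpl; auto|].
  apply IH; intros; apply H; simpl; auto.
Qed.

Lemma bprod_inv f l : (forall a, In a l -> f a <> 0) ->
  bprod (fun a => / f a) l = / bprod f l.
Proof.
  induction l as [|a l IH]; intros H; [rewrite !bprod_nil; field|].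
  rewrite !bprod_cons, IH by (intros; apply H; simpl; auto).
  field. split; [apply bprod_neq_0; intros; apply H; simpl; auto | apply H; simpl; auto].
Qed.

End BigOperators.

Lemma bsum_map {A B : Type} (h : A -> B) (f : B -> C) l :
  bsum f (map h l) = bsum (fun a => f (h a)) l.
Proof. unfold bsum; now rewrite map_map. Qed.

Lemma bprod_map {A B : Type} (h : A -> B) (f : B -> C) l :
  bprod f (map h l) = bprod (fun a => f (h a)) l.
Proof. unfold bprod; now rewrite map_map. Qed.

Lemma bsum_flat_map {A B : Type} (h : A -> list B) (f : B -> C) l :
  bsum f (flat_map h l) = bsum (fun a => bsum f (h a)) l.
Proof.
  induction l as [|a l IH]; [reflexivity|].
  simpl flat_map. now rewrite bsum_app, bsum_cons, IH.
Qed.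

Lemma bprod_flat_map {A B : Type} (h : A -> list B) (f : B -> C) l :
  bprod f (flat_map h l) = bprod (fun a => bprod f (h a)) l.
Proof.
  induction l as [|a l IH]; [reflexivity|].
  simpl flat_map. now rewrite bprod_app, bprod_cons, IH.
Qed.

Lemma bsum_exchange {T T' : Type} (g : T -> T' -> C) l l' :
  bsum (fun a => bsum (g a) l') l = bsum (fun b => bsum (fun a => g a b) l) l'.
Proof.
  induction l as [|a l IH].
  - symmetry. now apply bsum_0.
  - rewrite bsum_cons, IH, <- bsum_plus. reflexivity.
Qed.

Lemma bprod_exchange {T T' : Type} (g : T -> T' -> C) l l' :
  bprod (fun a => bprod (g a) l') l = bprod (fun b => bprod (fun a => g a b) l) l'.
Proof.
  induction l as [|a l IH].
  - symmetry. now apply bprod_1.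
  - rewrite bprod_cons, IH, <- bprod_mult. reflexivity.
Qed.

(** * Products over the pairs of entries of a list *)

Definition pprod {A : Type} (g : A -> A -> C) (l : list A) : C :=
  bprod (fun ab => g (fst ab) (snd ab)) (pairs l).

Section PairProducts.
Context {A : Type}.
Implicit Types (g h : A -> A -> C) (l : list A).

Lemma pprod_cons g a l : pprod g (a :: l) = bprod (g a) l * pprod g l.
Proof. unfold pprod; simpl pairs. rewrite bprod_app, bprod_map. reflexivity. Qed.

Lemma pprod_nil g : pprod g [] = 1.
Proof. reflexivity. Qed.

(** [pairs] lists each unordered pair once, in word order, so only a symmetric factor gives a
    product that depends on the underlying set. Later products are arranged to meet this:
    differences are multiplied by a sign [sg], and f is taken in index order by [fo]. *)
Lemma pprod_perm g l l' :
  (forall a b, g a b = g b a) -> Permutation l l' -> pprod g l = pprod g l'.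
Proof.
  intros Hs; induction 1 as [|a l l' H IH|a b l|l1 l2 l3 H1 IH1 H2 IH2];
    rewrite ?pprod_cons, ?bprod_cons.
  - reflexivity.
  - now rewrite IH, (bprod_perm _ _ _ H).
  - rewrite (Hs b a); ring.
  - congruence.
Qed.

Lemma pprod_mult g h l :
  pprod (fun a b => g a b * h a b) l = pprod g l * pprod h l.
Proof. unfold pprod; apply bprod_mult. Qed.

Lemma pprod_ext g h l :
  (forall a b, In a l -> In b l -> g a b = h a b) -> pprod g l = pprod h l.
Proof.
  induction l as [|a l IH]; intros H; [reflexivity|].
  rewrite !pprod_cons, IH by (intros; apply H; simpl; auto).
  f_equal. apply bprod_ext; intros; apply H; simpl; auto.
Qed.

Lemma pprod_ext_NoDup g h l : NoDup l ->
  (forall a b, In a l -> In b l -> a <> b -> g a b = h a b) -> pprod g l = pprod h l.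
Proof.
  induction l as [|a l IH]; intros Hnd H; [reflexivity|].
  inversion Hnd as [|? ? Ha Hl]; subst.
  rewrite !pprod_cons, IH by (auto; intros; apply H; simpl; auto).
  f_equal. apply bprod_ext; intros b Hb; apply H; simpl; auto. intros ->; auto.
Qed.

Lemma pprod_1 l : pprod (fun _ _ => 1) l = 1.
Proof. unfold pprod. now apply bprod_1. Qed.

Lemma pprod_neq_0 g l : (forall a b, In a l -> In b l -> g a b <> 0) -> pprod g l <> 0.
Proof.
  induction l as [|a l IH]; intros H; [apply C1_nz|].
  rewrite pprod_cons. apply Cmult_neq_0.
  - apply bprod_neq_0; intros; apply H; simpl; auto.
  - apply IH; intros; apply H; simpl; auto.
Qed.

Lemma pprod_inv g l : (forall a b, In a l -> In b l -> g a b <> 0) ->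
  pprod (fun a b => / g a b) l = / pprod g l.
Proof.
  induction l as [|a l IH]; intros H; [rewrite !pprod_nil; field|].
  rewrite !pprod_cons, IH, bprod_inv by (intros; apply H; simpl; auto).
  field. split; [apply pprod_neq_0 | apply bprod_neq_0]; intros; apply H; simpl; auto.
Qed.

(** Each entry occurs in [length l - 1] pairs. This is the count that the exponent in [nrm]
    undoes. *)
Lemma pprod_separate (f : A -> C) l :
  pprod (fun a b => f a * f b) l = bprod (fun a => f a ^ (length l - 1)) l.
Proof.
  induction l as [|a l IH]; [reflexivity|].
  rewrite pprod_cons, bprod_mult, bprod_const, IH, bprod_cons.
  replace (length (a :: l) - 1)%nat with (length l) by (simpl; lia).
  rewrite <- Cmult_assoc. f_equal.
  rewrite <- bprod_mult. apply bprod_ext. intros b Hb.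
  destruct l as [|c l]; [destruct Hb|].
  simpl length. replace (S (length l) - 1)%nat with (length l) by lia. reflexivity.
Qed.

End PairProducts.

Lemma pprod_map {A B : Type} (h : A -> B) (g : B -> B -> C) l :
  pprod g (map h l) = pprod (fun a b => g (h a) (h b)) l.
Proof.
  induction l as [|a l IH]; [reflexivity|].
  simpl map. now rewrite !pprod_cons, IH, bprod_map.
Qed.

(** * Integer powers of complex numbers *)

Lemma Cpowz_0_r (z : C) : Cpowz z 0 = 1.
Proof. reflexivity. Qed.

Lemma Cpowz_nat (z : C) (n : nat) : Cpowz z (Z.of_nat n) = z ^ n.
Proof.
  destruct n as [|n]; [reflexivity|]. simpl Z.of_nat. unfold Cpowz.
  now rewrite SuccNat2Pos.id_succ.
Qed.

Lemma Cpowz_opp_nat (z : C) (n : nat) : Cpowz z (- Z.of_nat n) = / z ^ n.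
Proof.
  destruct n as [|n].
  - simpl. field.
  - simpl Z.of_nat. unfold Cpowz, Z.opp. now rewrite SuccNat2Pos.id_succ.
Qed.

Lemma Cpowz_1_r (z : C) : Cpowz z 1 = z.
Proof. change 1%Z with (Z.of_nat 1). rewrite Cpowz_nat. apply Cpow_1_r. Qed.

Lemma Cpowz_m1_r (z : C) : Cpowz z (-1) = / z.
Proof. change (-1)%Z with (- Z.of_nat 1)%Z. now rewrite Cpowz_opp_nat, Cpow_1_r. Qed.

Lemma Cpowz_succ (z : C) n : z <> 0 -> Cpowz z (n + 1) = Cpowz z n * z.
Proof.
  intros Hz.
  destruct (Z_le_gt_dec 0 n) as [Hn|Hn].
  - rewrite <- (Z2Nat.id n) by lia. set (k := Z.to_nat n).
    replace (Z.of_nat k + 1)%Z with (Z.of_nat (S k)) by lia.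
    rewrite !Cpowz_nat, Cpow_S. ring.
  - set (k := Z.to_nat (- n - 1)).
    replace (n + 1)%Z with (- Z.of_nat k)%Z by lia.
    replace n with (- Z.of_nat (S k))%Z by lia.
    rewrite !Cpowz_opp_nat, Cpow_S. field; auto using Cpow_nz.
Qed.

Lemma Cpowz_add (z : C) a b : z <> 0 -> Cpowz z (a + b) = Cpowz z a * Cpowz z b.
Proof.
  intros Hz. revert b. apply Z.bi_induction.
  - intros b c ->; tauto.
  - rewrite Z.add_0_r, Cpowz_0_r; ring.
  - intros b. rewrite <- Z.add_1_r, Z.add_assoc, !Cpowz_succ by assumption.
    split; [intros ->; ring|].
    intros H. apply (f_equal (fun u => u * / z)) in H.
    replace (Cpowz z a * (Cpowz z b * z) * / z) with (Cpowz z a * Cpowz z b) in H by (field; auto).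
    rewrite <- H. field; auto.
Qed.

Lemma Cmod_Cpowz_eq (z w : C) n : Cmod z = Cmod w -> z <> 0 -> w <> 0 ->
  Cmod (Cpowz z n) = Cmod (Cpowz w n).
Proof.
  intros H Hz Hw. destruct (Z_le_gt_dec 0 n).
  - rewrite <- (Z2Nat.id n), !Cpowz_nat, !Cmod_pow, H by lia. reflexivity.
  - replace n with (- Z.of_nat (Z.to_nat (- n)))%Z by lia.
    rewrite !Cpowz_opp_nat, !Cmod_inv by now apply Cpow_nz.
    now rewrite !Cmod_pow, H.
Qed.

(** * Exponent vectors, transpositions and deletion of an index *)

Definition dl (i : nat) (z : Z) : nat -> Z := fun j => if Nat.eqb j i then z else 0%Z.
Definition eadd (a b : nat -> Z) : nat -> Z := fun j => (a j + b j)%Z.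
Definition sw (i j v : nat) : nat := if Nat.eqb v i then j else if Nat.eqb v j then i else v.

Lemma sw_l i j : sw i j i = j.
Proof. unfold sw. now rewrite Nat.eqb_refl. Qed.

Lemma sw_r i j : sw i j j = i.
Proof.
  unfold sw. destruct (Nat.eqb_spec j i) as [->|H]; [reflexivity|]. now rewrite Nat.eqb_refl.
Qed.

Lemma sw_other i j v : v <> i -> v <> j -> sw i j v = v.
Proof.
  intros Hi Hj; unfold sw.
  destruct (Nat.eqb_spec v i); [contradiction|]. destruct (Nat.eqb_spec v j); [contradiction|].
  reflexivity.
Qed.

Lemma sw_invol i j v : sw i j (sw i j v) = v.
Proof.
  destruct (Nat.eq_dec v i) as [->|Hi]; [rewrite sw_l; apply sw_r|].
  destruct (Nat.eq_dec v j) as [->|Hj]; [rewrite sw_r; apply sw_l|].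
  now rewrite !(sw_other i j v).
Qed.

Lemma sw_inj i j u v : sw i j u = sw i j v -> u = v.
Proof. intros H. rewrite <- (sw_invol i j u), H. apply sw_invol. Qed.

Lemma in_map_sw i j v U : In (sw i j v) (map (sw i j) U) <-> In v U.
Proof.
  rewrite in_map_iff. split.
  - intros (u & Hu & Hin). apply sw_inj in Hu. now subst.
  - intros H. now exists v.
Qed.

Lemma in_map_sw' i j v U : In v (map (sw i j) U) <-> In (sw i j v) U.
Proof. rewrite <- (sw_invol i j v) at 1. apply in_map_sw. Qed.

Lemma NoDup_map_sw i j U : NoDup U -> NoDup (map (sw i j) U).
Proof. intros H. apply FinFun.Injective_map_NoDup; [intros u v; apply sw_inj | exact H]. Qed.

Lemma sw_perm i j U : NoDup U -> (In i U <-> In j U) -> Permutation (map (sw i j) U) U.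
Proof.
  intros Hnd Hij. apply NoDup_Permutation; [now apply NoDup_map_sw | assumption |].
  intros v. rewrite in_map_sw'.
  destruct (Nat.eq_dec v i) as [->|Hi]; [rewrite sw_l; tauto|].
  destruct (Nat.eq_dec v j) as [->|Hj]; [rewrite sw_r; tauto|].
  now rewrite sw_other.
Qed.

Definition rem1 (a : nat) (U : list nat) : list nat := remove Nat.eq_dec a U.

Lemma in_rem1 a v U : In v (rem1 a U) <-> In v U /\ v <> a.
Proof.
  split; [apply in_remove | intros [H1 H2]; now apply in_in_remove].
Qed.

Lemma NoDup_rem1 a U : NoDup U -> NoDup (rem1 a U).
Proof.
  induction 1 as [|b U Hb H IH]; simpl; [constructor|].
  destruct (Nat.eq_dec a b); [assumption|]. constructor; [|assumption].
  intros Hin. apply in_rem1 in Hin. tauto.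
Qed.

Lemma rem1_cons_eq a U : ~ In a U -> rem1 a (a :: U) = U.
Proof.
  intros H. unfold rem1; simpl. destruct (Nat.eq_dec a a); [|contradiction].
  now apply notin_remove.
Qed.

Lemma rem1_perm a U : NoDup U -> In a U -> Permutation U (a :: rem1 a U).
Proof.
  intros Hnd Hin. apply NoDup_Permutation; [assumption| |].
  - constructor; [|now apply NoDup_rem1]. rewrite in_rem1; tauto.
  - intros v; simpl. rewrite in_rem1. destruct (Nat.eq_dec v a); [subst; tauto|]. split; [tauto|].
    intros [->|[H _]]; [contradiction|exact H].
Qed.

Lemma length_rem1 a U : NoDup U -> In a U -> length U = S (length (rem1 a U)).
Proof. intros. now rewrite (Permutation_length (rem1_perm a U H H0)) at 1. Qed.

Lemma rem1_Permutation a U V : Permutation U V -> NoDup U -> Permutation (rem1 a U) (rem1 a V).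
Proof.
  intros HP Hnd. apply NoDup_Permutation.
  - now apply NoDup_rem1.
  - apply NoDup_rem1. now apply (Permutation_NoDup HP).
  - intros v. rewrite !in_rem1. split; intros [H1 H2]; split; auto.
    + now apply (Permutation_in _ HP).
    + now apply (Permutation_in _ (Permutation_sym HP)).
Qed.

Lemma rem1_map_sw i j a U : rem1 (sw i j a) (map (sw i j) U) = map (sw i j) (rem1 a U).
Proof.
  induction U as [|b U IH]; [reflexivity|]. unfold rem1 in *; simpl.
  destruct (Nat.eq_dec (sw i j a) (sw i j b)) as [E|E];
    destruct (Nat.eq_dec a b) as [E'|E']; simpl; rewrite ?IH; auto.
  - apply sw_inj in E; contradiction.
  - subst; contradiction.
Qed.

Lemma in_pairs {T : Type} (l : list T) ab : In ab (pairs l) -> In (fst ab) l /\ In (snd ab) l.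
Proof.
  induction l as [|a l IH]; simpl; [tauto|]. rewrite in_app_iff, in_map_iff.
  intros [(b & <- & Hb)|H]; simpl; [tauto|]. specialize (IH H). tauto.
Qed.

(** * Averages over a circle *)

(** Continuity is expressed through [Cmod], the norm of the uniform approximations below;
    integrability is recovered from the two real components. *)
Definition ContC (h : R -> C) : Prop :=
  forall th eps, (0 < eps)%R ->
    exists d, (0 < d)%R /\ forall u, (Rabs (u - th) < d)%R -> (Cmod (h u - h th) < eps)%R.

Lemma Cmod_fst (z : C) : (Rabs (fst z) <= Cmod z)%R.
Proof. eapply Rle_trans; [|apply Rmax_Cmod]. apply Rmax_l. Qed.

Lemma Cmod_snd (z : C) : (Rabs (snd z) <= Cmod z)%R.
Proof. eapply Rle_trans; [|apply Rmax_Cmod]. apply Rmax_r. Qed.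

Lemma Cmod_le_sum (z : C) : (Cmod z <= Rabs (fst z) + Rabs (snd z))%R.
Proof.
  replace z with (RtoC (fst z) + Ci * RtoC (snd z)) at 1
    by (destruct z; apply injective_projections; simpl; ring).
  eapply Rle_trans; [apply Cmod_triangle|].
  rewrite Cmod_mult, Cmod_Ci, !Cmod_R. lra.
Qed.

Lemma ContC_real (g : R -> R) h : ContC h ->
  (forall a b, (Rabs (g a - g b) <= Cmod (h a - h b))%R) -> forall th, continuous g th.
Proof.
  intros H Hg th. apply continuity_pt_filterlim. intros eps Heps.
  destruct (H th eps Heps) as (d & Hd & Hu).
  exists d. split; [exact Hd|]. intros u [_ Hdu]. unfold dist in *; simpl in *.
  unfold Rdist in *. eapply Rle_lt_trans; [apply Hg|]. now apply Hu.
Qed.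

Lemma ContC_ex_RInt h a b : ContC h -> ex_RInt (V := C_R_CompleteNormedModule) h a b.
Proof.
  intros H. apply ex_RInt_fct_extend_pair; apply (@ex_RInt_continuous R_CompleteNormedModule);
    intros th _; apply (ContC_real _ h H); intros u v.
  - apply (Cmod_fst (h u - h v)).
  - apply (Cmod_snd (h u - h v)).
Qed.

Lemma ContC_const c : ContC (fun _ => c).
Proof.
  intros th eps He. exists 1%R. split; [lra|]. intros u _.
  replace (c - c) with (RtoC 0) by ring. now rewrite Cmod_0.
Qed.

Lemma ContC_plus g h : ContC g -> ContC h -> ContC (fun t => g t + h t).
Proof.
  intros Hg Hh th eps He.
  destruct (Hg th (eps / 2)%R ltac:(lra)) as (d1 & Hd1 & H1).
  destruct (Hh th (eps / 2)%R ltac:(lra)) as (d2 & Hd2 & H2).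
  exists (Rmin d1 d2). split; [now apply Rmin_glb_lt|]. intros u Hu.
  replace (g u + h u - (g th + h th)) with ((g u - g th) + (h u - h th)) by ring.
  eapply Rle_lt_trans; [apply Cmod_triangle|].
  specialize (H1 u (Rlt_le_trans _ _ _ Hu (Rmin_l _ _))).
  specialize (H2 u (Rlt_le_trans _ _ _ Hu (Rmin_r _ _))). lra.
Qed.

Lemma ContC_scal c h : ContC h -> ContC (fun t => c * h t).
Proof.
  intros H th eps He.
  assert (Hc : (0 < Cmod c + 1)%R) by (pose proof (Cmod_ge_0 c); lra).
  destruct (H th (eps / (Cmod c + 1))%R) as (d & Hd & Hu); [now apply Rdiv_lt_0_compat|].
  exists d. split; [exact Hd|]. intros u Hud.
  replace (c * h u - c * h th) with (c * (h u - h th)) by ring.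
  rewrite Cmod_mult. specialize (Hu u Hud).
  pose proof (Cmod_ge_0 (h u - h th)).
  apply Rle_lt_trans with ((Cmod c + 1) * Cmod (h u - h th))%R; [nra|].
  apply (Rmult_lt_compat_l (Cmod c + 1)) in Hu; [|lra].
  replace ((Cmod c + 1) * (eps / (Cmod c + 1)))%R with eps in Hu by (field; lra). exact Hu.
Qed.

Lemma ContC_lim h :
  (forall eps, (0 < eps)%R -> exists g, ContC g /\ forall t, (Cmod (h t - g t) <= eps)%R) -> ContC h.
Proof.
  intros H th eps He.
  destruct (H (eps / 4)%R ltac:(lra)) as (g & Hg & Hhg).
  destruct (Hg th (eps / 4)%R ltac:(lra)) as (d & Hd & Hu).
  exists d. split; [exact Hd|]. intros u Hud.
  replace (h u - h th) with ((h u - g u) + (g u - g th) + - (h th - g th)) by ring.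
  eapply Rle_lt_trans; [apply Cmod_triangle|]. rewrite Cmod_opp.
  pose proof (Cmod_triangle (h u - g u) (g u - g th)).
  specialize (Hu u Hud). pose proof (Hhg u). pose proof (Hhg th). lra.
Qed.

(** The Fourier mode e^(i n th). *)
Definition wave (n : Z) (th : R) : C := (cos (IZR n * th), sin (IZR n * th)).

Lemma wave_add m n th : wave (m + n) th = wave m th * wave n th.
Proof.
  unfold wave. rewrite plus_IZR, Rmult_plus_distr_r, cos_plus, sin_plus.
  apply injective_projections; simpl; ring.
Qed.

Lemma wave_0 th : wave 0 th = 1.
Proof. unfold wave. rewrite Rmult_0_l, cos_0, sin_0. reflexivity. Qed.

Lemma Cmod_wave n th : Cmod (wave n th) = 1%R.
Proof.
  unfold wave, Cmod; simpl fst; simpl snd.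
  pose proof (sin2_cos2 (IZR n * th)) as H. unfold Rsqr in H.
  replace (_ + _)%R with 1%R by (simpl; lra). apply sqrt_1.
Qed.

Lemma wave_continuous n : ContC (wave n).
Proof.
  intros th eps He.
  assert (Hc : continuity_pt (fun t => cos (IZR n * t)) th) by (apply derivable_continuous_pt;
    exists (- sin (IZR n * th) * IZR n)%R; apply is_derive_Reals; auto_derive; [trivial|ring]).
  assert (Hs : continuity_pt (fun t => sin (IZR n * t)) th) by (apply derivable_continuous_pt;
    exists (cos (IZR n * th) * IZR n)%R; apply is_derive_Reals; auto_derive; [trivial|ring]).
  destruct (Hc (eps / 2)%R ltac:(lra)) as (d1 & Hd1 & H1).
  destruct (Hs (eps / 2)%R ltac:(lra)) as (d2 & Hd2 & H2).
  exists (Rmin d1 d2). split; [now apply Rmin_glb_lt|]. intros u Hu.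
  destruct (Req_dec u th) as [->|Hne].
  { replace (wave n th - wave n th) with (RtoC 0) by ring. now rewrite Cmod_0. }
  eapply Rle_lt_trans; [apply Cmod_le_sum|].
  specialize (H1 u). specialize (H2 u). unfold dist, D_x, no_cond in *; simpl in *. unfold Rdist in *.
  assert (Hu1 := Rlt_le_trans _ _ _ Hu (Rmin_l _ _)).
  assert (Hu2 := Rlt_le_trans _ _ _ Hu (Rmin_r _ _)).
  specialize (H1 (conj (conj I (not_eq_sym Hne)) Hu1)).
  specialize (H2 (conj (conj I (not_eq_sym Hne)) Hu2)). unfold Rminus in *. lra.
Qed.

Definition JC (h : R -> C) : C := RInt (V := C_R_CompleteNormedModule) h 0 (2 * PI).

Lemma two_PI_pos : (0 < 2 * PI)%R.
Proof. pose proof PI_RGT_0; lra. Qed.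

Lemma JC_pair h : ContC h ->
  JC h = (RInt (fun t => fst (h t)) 0 (2 * PI), RInt (fun t => snd (h t)) 0 (2 * PI)).
Proof.
  intros H. symmetry. unfold JC.
  apply (RInt_fct_extend_pair (U := R_NormedModule) (V := R_NormedModule)
           (fun f a b => RInt (V := R_CompleteNormedModule) f a b)
           (fun f a b => RInt (V := R_CompleteNormedModule) f a b)).
  - intros f a b l Hl. now apply is_RInt_unique.
  - intros f a b l Hl. now apply is_RInt_unique.
  - apply (RInt_correct (V := C_R_CompleteNormedModule)). now apply ContC_ex_RInt.
Qed.

Lemma JC_plus g h : ContC g -> ContC h -> JC (fun t => g t + h t) = JC g + JC h.
Proof.
  intros Hg Hh. unfold JC.
  apply (RInt_plus (V := C_R_CompleteNormedModule)); now apply ContC_ex_RInt.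
Qed.

Lemma ContC_fst_ex h : ContC h -> ex_RInt (fun t => fst (h t)) 0 (2 * PI).
Proof.
  intros H. apply (@ex_RInt_continuous R_CompleteNormedModule).
  intros th _; apply (ContC_real _ h H); intros u v; apply (Cmod_fst (h u - h v)).
Qed.

Lemma ContC_snd_ex h : ContC h -> ex_RInt (fun t => snd (h t)) 0 (2 * PI).
Proof.
  intros H. apply (@ex_RInt_continuous R_CompleteNormedModule).
  intros th _; apply (ContC_real _ h H); intros u v; apply (Cmod_snd (h u - h v)).
Qed.

(** The integral is taken in a module over the reals, so linearity over complex scalars has to be
    read off from the real and imaginary parts. *)
Lemma JC_scal c h : ContC h -> JC (fun t => c * h t) = c * JC h.
Proof.
  intros H. rewrite (JC_pair _ (ContC_scal c h H)), (JC_pair h H).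
  pose proof (ContC_fst_ex h H) as E1. pose proof (ContC_snd_ex h H) as E2.
  assert (S : forall (k : R) (f : R -> R), ex_RInt f 0 (2 * PI) ->
     RInt (fun t => k * f t)%R 0 (2 * PI) = (k * RInt f 0 (2 * PI))%R)
    by (intros k f Hf; apply (RInt_scal (V := R_CompleteNormedModule) f 0 (2 * PI) k Hf)).
  assert (X : forall (k : R) (f : R -> R), ex_RInt f 0 (2 * PI) -> ex_RInt (fun t => k * f t)%R 0 (2 * PI))
    by (intros k f Hf; apply (ex_RInt_scal (V := R_NormedModule) f 0 (2 * PI) k Hf)).
  apply injective_projections; simpl.
  - rewrite <- !S by assumption.
    apply (RInt_minus (V := R_CompleteNormedModule)) ; apply X; assumption.
  - rewrite <- !S by assumption.
    rewrite (RInt_plus (V := R_CompleteNormedModule)); [reflexivity | apply X; assumption | apply X; assumption].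
Qed.

Lemma norm_C_R (z : C) : norm (V := C_R_NormedModule) z = Cmod z.
Proof.
  unfold Cmod. rewrite <- (pow2_abs (fst z)), <- (pow2_abs (snd z)). reflexivity.
Qed.

Lemma JC_bound h M : ContC h -> (forall t, (Cmod (h t) <= M)%R) -> (Cmod (JC h) <= M * (2 * PI))%R.
Proof.
  intros H HM. pose proof two_PI_pos as HP.
  replace (M * (2 * PI))%R with (RInt (fun _ => M) 0 (2 * PI))
    by (rewrite RInt_const; unfold scal; simpl; unfold mult; simpl; ring).
  rewrite <- norm_C_R.
  apply (norm_RInt_le (V := C_R_NormedModule) h (fun _ => M) 0 (2 * PI)); [lra| | |].
  - intros t _. rewrite norm_C_R. apply HM.
  - apply (RInt_correct (V := C_R_CompleteNormedModule)). now apply ContC_ex_RInt.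
  - apply (RInt_correct (V := R_CompleteNormedModule)). apply ex_RInt_const.
Qed.

Lemma JC_wave n : JC (wave n) = if Z.eqb n 0 then RtoC (2 * PI) else 0.
Proof.
  rewrite (JC_pair _ (wave_continuous n)). unfold wave; simpl fst; simpl snd.
  destruct (Z.eqb_spec n 0) as [->|Hn].
  - rewrite (RInt_ext _ (fun _ => 1%R)) by (intros; rewrite Rmult_0_l; apply cos_0).
    rewrite (RInt_ext (fun t => sin _) (fun _ => 0%R)) by (intros; rewrite Rmult_0_l; apply sin_0).
    rewrite !RInt_const. unfold scal; simpl; unfold mult; simpl.
    apply injective_projections; simpl; ring.
  - assert (Hz : IZR n <> 0%R) by now apply not_0_IZR.
    assert (E1 : is_RInt (fun t => cos (IZR n * t)) 0 (2 * PI)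
       (minus (sin (IZR n * (2 * PI)) / IZR n)%R (sin (IZR n * 0) / IZR n)%R)).
    { apply (is_RInt_derive (fun t => sin (IZR n * t) / IZR n)%R).
      - intros t _. auto_derive; [trivial | field; exact Hz].
      - intros t _. apply (ContC_real _ _ (wave_continuous n)). intros a b.
        apply (Cmod_fst (wave n a - wave n b)). }
    assert (E2 : is_RInt (fun t => sin (IZR n * t)) 0 (2 * PI)
       (minus (- cos (IZR n * (2 * PI)) / IZR n)%R (- cos (IZR n * 0) / IZR n)%R)).
    { apply (is_RInt_derive (fun t => - cos (IZR n * t) / IZR n)%R).
      - intros t _. auto_derive; [trivial | field; exact Hz].
      - intros t _. apply (ContC_real _ _ (wave_continuous n)). intros a b.
        apply (Cmod_snd (wave n a - wave n b)). }
    rewrite (is_RInt_unique _ _ _ _ E1), (is_RInt_unique _ _ _ _ E2).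
    (* [cos_period] and [sin_period] add natural multiples of the period, so a negative [k] is
       treated by shifting back to 0. *)
    assert (P : forall k : Z, cos (IZR k * (2 * PI)) = 1%R /\ sin (IZR k * (2 * PI)) = 0%R).
    { intros k. split.
      - rewrite <- (cos_0). rewrite <- (Rplus_0_l (IZR k * (2 * PI))).
        destruct (Z_le_gt_dec 0 k).
        + rewrite <- (Z2Nat.id k), <- INR_IZR_INZ by lia.
          replace (0 + INR (Z.to_nat k) * (2 * PI))%R with (0 + 2 * INR (Z.to_nat k) * PI)%R by ring.
          apply cos_period.
        + rewrite <- (cos_period _ (Z.to_nat (- k))). f_equal.
          rewrite INR_IZR_INZ, Z2Nat.id, opp_IZR by lia. ring.
      - rewrite <- (sin_0). rewrite <- (Rplus_0_l (IZR k * (2 * PI))).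
        destruct (Z_le_gt_dec 0 k).
        + rewrite <- (Z2Nat.id k), <- INR_IZR_INZ by lia.
          replace (0 + INR (Z.to_nat k) * (2 * PI))%R with (0 + 2 * INR (Z.to_nat k) * PI)%R by ring.
          apply sin_period.
        + rewrite <- (sin_period _ (Z.to_nat (- k))). f_equal.
          rewrite INR_IZR_INZ, Z2Nat.id, opp_IZR by lia. ring. }
    destruct (P n) as [Pc Ps]. rewrite Pc, Ps, Rmult_0_r, sin_0, cos_0.
    unfold minus, plus, opp; simpl.
    apply injective_projections; simpl; field; exact Hz.
Qed.

Lemma JC_0 : JC (fun _ => 0) = 0.
Proof.
  transitivity (JC (fun t => 0 * wave 0 t)).
  - f_equal. apply functional_extensionality; intros; ring.
  - rewrite JC_scal by apply wave_continuous. ring.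
Qed.

(** * Uniform limits of Laurent polynomials on the torus *)

(** The mean over a circle in one variable, without the factor xi that d xi contributes in
    [contour]; [mcint_avgs] collects these factors. *)
Definition avg1 (R0 : R) (v : nat) (F : (nat -> C) -> C) (xi : nat -> C) : C :=
  RtoC (/ (2 * PI)) * JC (fun th => F (upd xi v (RtoC R0 * Cexp (0%R, th)))).

Fixpoint avgs (R0 : R) (vars : list nat) (F : (nat -> C) -> C) : (nat -> C) -> C :=
  match vars with
  | [] => F
  | v :: vs => avg1 R0 v (avgs R0 vs F)
  end.

Definition pmeans (vars : list nat) (P : list (C * (nat -> Z))) :=
  filter (fun ce => forallb (fun v => Z.eqb (snd ce v) 0) vars) P.

Lemma upd_same xi v z : upd xi v z v = z.
Proof. unfold upd. now rewrite Nat.eqb_refl. Qed.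

Lemma upd_other xi v z u : u <> v -> upd xi v z u = xi u.
Proof. intros H. unfold upd. destruct (Nat.eqb_spec u v); [contradiction|reflexivity]. Qed.

Section Torus.
Variables (R0 : R) (Vs : list nat).
Hypothesis HR : (0 < R0)%R.
Hypothesis HVs : NoDup Vs.

(** All variables are constrained, also those outside [Vs], so that an environment on the torus
    stays there under any update on the circle. *)
Definition onT (xi : nat -> C) : Prop := forall i, Cmod (xi i) = R0.

Definition mono (e : nat -> Z) (xi : nat -> C) : C :=
  bprod (fun i => Cpowz (xi i) (e i)) Vs.

Definition leval (P : list (C * (nat -> Z))) (xi : nat -> C) : C :=
  bsum (fun ce => fst ce * mono (snd ce) xi) P.

(** [A] holds the exponent vectors allowed in the approximating Laurent polynomials, a bound on the
    Fourier support of [F]. Sums of exponents correspond to products of functions, and the criteria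
    for vanishing means look at [A] only. *)
Definition LC (A : (nat -> Z) -> Prop) (F : (nat -> C) -> C) : Prop :=
  forall eps, (0 < eps)%R ->
    exists P, (forall ce, In ce P -> A (snd ce)) /\
              forall xi, onT xi -> (Cmod (F xi - leval P xi) <= eps)%R.

(** The initial environment is immaterial for a function of the variables in [Vs] only, since all of
    them are averaged. *)
Definition EE (F : (nat -> C) -> C) : C :=
  avgs R0 Vs F (fun _ => RtoC R0).

Lemma onT_neq_0 xi i : onT xi -> xi i <> 0.
Proof. intros H E. specialize (H i). rewrite E, Cmod_0 in H. lra. Qed.

Lemma RtoC_R0_neq_0 : RtoC R0 <> 0.
Proof. intros H. apply RtoC_inj in H. lra. Qed.

Lemma circle_wave th : RtoC R0 * Cexp (0%R, th) = RtoC R0 * wave 1 th.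
Proof.
  unfold Cexp, wave; simpl. rewrite exp_0, Rmult_1_l. ring.
Qed.

Lemma Cmod_circle th : Cmod (RtoC R0 * Cexp (0%R, th)) = R0.
Proof. rewrite circle_wave, Cmod_mult, Cmod_wave, Cmod_R, Rabs_pos_eq; lra. Qed.

Lemma onT_const : onT (fun _ => RtoC R0).
Proof. intros i. rewrite Cmod_R. apply Rabs_pos_eq; lra. Qed.

Lemma onT_upd xi v th : onT xi -> onT (upd xi v (RtoC R0 * Cexp (0%R, th))).
Proof.
  intros H i. unfold upd. destruct (Nat.eqb i v); [apply Cmod_circle | apply H].
Qed.

Lemma Cpowz_circle th n :
  Cpowz (RtoC R0 * Cexp (0%R, th)) n = Cpowz (RtoC R0) n * wave n th.
Proof.
  assert (Hz : RtoC R0 * Cexp (0%R, th) <> 0).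
  { intros E. pose proof (Cmod_circle th) as H. rewrite E, Cmod_0 in H. lra. }
  pose proof RtoC_R0_neq_0 as HR0.
  revert n. apply Z.bi_induction.
  - intros b c ->; tauto.
  - rewrite !Cpowz_0_r, wave_0. ring.
  - intros n. rewrite <- Z.add_1_r, !Cpowz_succ, wave_add by assumption.
    rewrite circle_wave. rewrite circle_wave in Hz. split; [intros ->; ring|].
    intros H. apply (f_equal (fun u => u * / (RtoC R0 * wave 1 th))) in H.
    replace (Cpowz (RtoC R0 * wave 1 th) n * (RtoC R0 * wave 1 th) * / (RtoC R0 * wave 1 th))
      with (Cpowz (RtoC R0 * wave 1 th) n) in H
      by (field; split; intros E; apply Hz; rewrite E; ring).
    rewrite H. field. split; intros E; apply Hz; rewrite E; ring.
Qed.

Lemma mono_add a b xi : onT xi -> mono (eadd a b) xi = mono a xi * mono b xi.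
Proof.
  intros H. unfold mono. rewrite <- bprod_mult. apply bprod_ext.
  intros i _. apply Cpowz_add. now apply onT_neq_0.
Qed.

Lemma mono_ext a b xi : (forall i, In i Vs -> a i = b i) -> mono a xi = mono b xi.
Proof. intros H. apply bprod_ext. intros i Hi. now rewrite H. Qed.

Lemma mono_0 e xi : (forall i, In i Vs -> e i = 0%Z) -> mono e xi = 1.
Proof. intros H. apply bprod_1. intros i Hi. now rewrite H. Qed.

Lemma mono_supp e xi U : NoDup U -> incl U Vs -> (forall i, In i Vs -> ~ In i U -> e i = 0%Z) ->
  mono e xi = bprod (fun i => Cpowz (xi i) (e i)) U.
Proof.
  intros HU Hincl H. unfold mono.
  assert (HP : Permutation Vs (U ++ filter (fun i => negb (existsb (Nat.eqb i) U)) Vs)).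
  { apply NoDup_Permutation; [assumption| |].
    - apply NoDup_app; [assumption | now apply NoDup_filter |].
      intros i Hi Hf. apply filter_In in Hf as [_ Hf].
      apply Bool.negb_true_iff in Hf. apply Bool.not_true_iff_false in Hf. apply Hf.
      apply existsb_exists. exists i. split; [assumption|apply Nat.eqb_refl].
    - intros i. rewrite in_app_iff, filter_In. split.
      + intros Hi. destruct (existsb (Nat.eqb i) U) eqn:E; [|now right].
        apply existsb_exists in E as (j & Hj & E). apply Nat.eqb_eq in E. subst. now left.
      + intros [Hi|[Hi _]]; auto. }
  rewrite (bprod_perm _ _ _ HP), bprod_app.
  rewrite (bprod_1 _ (filter _ _)); [ring|].
  intros i Hi. apply filter_In in Hi as [Hi Hf]. rewrite H; [reflexivity|assumption|].
  intros Hin. apply Bool.negb_true_iff in Hf. apply Bool.not_true_iff_false in Hf. apply Hf.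
  apply existsb_exists. exists i. split; [assumption|apply Nat.eqb_refl].
Qed.

Lemma mono_dl i z xi : In i Vs -> mono (dl i z) xi = Cpowz (xi i) z.
Proof.
  intros Hi. rewrite (mono_supp _ _ [i]).
  - rewrite bprod_cons, bprod_nil. unfold dl. rewrite Nat.eqb_refl. ring.
  - repeat constructor. intros [].
  - intros j [<-|[]]; assumption.
  - intros j _ Hj. unfold dl. destruct (Nat.eqb_spec j i); [|reflexivity].
    subst; exfalso; apply Hj; now left.
Qed.

Lemma mono_upd e xi v z : In v Vs ->
  mono e (upd xi v z) = mono (fun j => if Nat.eqb j v then 0%Z else e j) xi * Cpowz z (e v).
Proof.
  intros Hv. unfold mono. pose proof (rem1_perm v Vs HVs Hv) as HP.
  rewrite !(bprod_perm _ _ _ HP), !bprod_cons, upd_same, Nat.eqb_refl, Cpowz_0_r.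
  rewrite (bprod_ext (fun i => Cpowz (upd xi v z i) (e i))
    (fun i => Cpowz (xi i) (if Nat.eqb i v then 0%Z else e i))); [ring|].
  intros i Hi. apply in_rem1 in Hi as [_ Hi]. rewrite upd_other by assumption.
  destruct (Nat.eqb_spec i v); [contradiction|reflexivity].
Qed.

Lemma Cmod_mono e xi : onT xi -> Cmod (mono e xi) = Cmod (mono e (fun _ => RtoC R0)).
Proof.
  intros H. unfold mono. clear HVs. induction Vs as [|i l IH]; [reflexivity|].
  rewrite !bprod_cons, !Cmod_mult. f_equal.
  - apply Cmod_Cpowz_eq; [|now apply onT_neq_0|apply RtoC_R0_neq_0].
    rewrite H. symmetry. apply (onT_const 0%nat).
  - apply IH.
Qed.

Lemma leval_app P Q xi : leval (P ++ Q) xi = leval P xi + leval Q xi.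
Proof. apply bsum_app. Qed.

Definition pshift (c : C) (e : nat -> Z) (P : list (C * (nat -> Z))) :=
  map (fun ce => (c * fst ce, eadd e (snd ce))) P.

Lemma leval_pshift c e P xi : onT xi -> leval (pshift c e P) xi = c * mono e xi * leval P xi.
Proof.
  intros H. unfold leval, pshift. rewrite bsum_map, <- bsum_scal. apply bsum_ext.
  intros ce _. simpl. rewrite mono_add by assumption. ring.
Qed.

Definition pmul (P Q : list (C * (nat -> Z))) :=
  flat_map (fun ce => pshift (fst ce) (snd ce) Q) P.

Lemma leval_pmul P Q xi : onT xi -> leval (pmul P Q) xi = leval P xi * leval Q xi.
Proof.
  intros H. unfold leval at 1, pmul. rewrite bsum_flat_map.
  rewrite (bsum_ext _ (fun ce => leval Q xi * (fst ce * mono (snd ce) xi))).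
  - rewrite bsum_scal. unfold leval. ring.
  - intros ce _. fold (leval (pshift (fst ce) (snd ce) Q) xi). rewrite leval_pshift by assumption. ring.
Qed.

Lemma leval_bound P : exists M, (0 < M)%R /\ forall xi, onT xi -> (Cmod (leval P xi) <= M)%R.
Proof.
  induction P as [|ce P (M & HM & IH)].
  - exists 1%R. split; [lra|]. intros xi _. unfold leval. rewrite bsum_nil, Cmod_0. lra.
  - exists (Cmod (fst ce * mono (snd ce) (fun _ => RtoC R0)) + M)%R.
    split; [pose proof (Cmod_ge_0 (fst ce * mono (snd ce) (fun _ => RtoC R0))); lra|].
    intros xi H. unfold leval. rewrite bsum_cons.
    eapply Rle_trans; [apply Cmod_triangle|]. apply Rplus_le_compat; [|now apply IH].
    rewrite !Cmod_mult, (Cmod_mono _ xi) by assumption. lra.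
Qed.

Lemma filter_filter_and {T : Type} (f g : T -> bool) l :
  filter f (filter g l) = filter (fun x => andb (f x) (g x)) l.
Proof.
  induction l as [|a l IH]; [reflexivity|]. simpl.
  destruct (g a); simpl; destruct (f a); simpl; now rewrite IH.
Qed.

Lemma leval_circle P xi v : In v Vs -> ContC (fun th => leval P (upd xi v (RtoC R0 * Cexp (0%R, th)))) /\
  RtoC (/ (2 * PI)) * JC (fun th => leval P (upd xi v (RtoC R0 * Cexp (0%R, th))))
   = leval (filter (fun ce => Z.eqb (snd ce v) 0) P) xi.
Proof.
  intros Hv. induction P as [|[c e] P [IH1 IH2]].
  - split; [apply (ContC_const 0)|]. simpl filter.
    change (RtoC (/ (2 * PI)) * JC (fun _ => 0) = 0). rewrite JC_0. ring.
  (* [k] is the coefficient of the mode of frequency [e v]; it survives the mean exactly when that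
     frequency is 0. *)
  - pose (k := c * (mono (fun j => if Nat.eqb j v then 0%Z else e j) xi * Cpowz (RtoC R0) (e v))).
    assert (E : (fun th => leval ((c, e) :: P) (upd xi v (RtoC R0 * Cexp (0%R, th)))) =
                (fun th => k * wave (e v) th + leval P (upd xi v (RtoC R0 * Cexp (0%R, th))))).
    { apply functional_extensionality; intros th. unfold leval. rewrite bsum_cons; simpl.
      rewrite mono_upd, Cpowz_circle by assumption. unfold k. ring. }
    assert (C1 : ContC (fun th => k * wave (e v) th)) by (apply ContC_scal, wave_continuous).
    rewrite E. split; [now apply ContC_plus|].
    rewrite JC_plus, JC_scal, JC_wave by (assumption || apply wave_continuous).
    rewrite Cmult_plus_distr_l, IH2. simpl.
    destruct (Z.eqb_spec (e v) 0) as [He|He].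
    + unfold leval at 2. rewrite bsum_cons; simpl. fold (leval (filter (fun ce => Z.eqb (snd ce v) 0) P) xi).
      f_equal. unfold k. rewrite He, Cpowz_0_r.
      rewrite (mono_ext (fun j => if Nat.eqb j v then 0%Z else e j) e).
      * replace (RtoC (/ (2 * PI)) * (c * (mono e xi * 1) * RtoC (2 * PI)))
          with (c * mono e xi * (RtoC (/ (2 * PI)) * RtoC (2 * PI))) by ring.
        rewrite <- RtoC_mult, Rinv_l by (pose proof two_PI_pos; lra). ring.
      * intros i _. destruct (Nat.eqb_spec i v); congruence.
    + ring.
Qed.

Lemma LC_ContC A F xi v : In v Vs -> LC A F -> onT xi ->
  ContC (fun th => F (upd xi v (RtoC R0 * Cexp (0%R, th)))).
Proof.
  intros Hv HF Hxi. apply ContC_lim. intros eps He.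
  destruct (HF eps He) as (P & _ & HP).
  exists (fun th => leval P (upd xi v (RtoC R0 * Cexp (0%R, th)))).
  split; [now apply leval_circle|]. intros t. now apply HP, onT_upd.
Qed.

Lemma avg1_diff F G xi v eps :
  ContC (fun th => F (upd xi v (RtoC R0 * Cexp (0%R, th)))) ->
  ContC (fun th => G (upd xi v (RtoC R0 * Cexp (0%R, th)))) ->
  (forall th, (Cmod (F (upd xi v (RtoC R0 * Cexp (0%R, th))) - G (upd xi v (RtoC R0 * Cexp (0%R, th)))) <= eps)%R) ->
  (Cmod (avg1 R0 v F xi - avg1 R0 v G xi) <= eps)%R.
Proof.
  intros HF HG H. unfold avg1.
  set (h := fun th => F (upd xi v (RtoC R0 * Cexp (0%R, th)))) in *.
  set (g := fun th => G (upd xi v (RtoC R0 * Cexp (0%R, th)))) in *.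
  assert (HG' : ContC (fun t => (-(1)) * g t)) by now apply ContC_scal.
  replace (RtoC (/ (2 * PI)) * JC h - RtoC (/ (2 * PI)) * JC g)
    with (RtoC (/ (2 * PI)) * JC (fun t => h t + (-(1)) * g t)).
  - rewrite Cmod_mult, Cmod_R, Rabs_pos_eq
      by (apply Rlt_le, Rinv_0_lt_compat, two_PI_pos).
    assert (B : (Cmod (JC (fun t => (h t + - (1) * g t)%C)) <= eps * (2 * PI))%R).
    { apply JC_bound; [now apply ContC_plus|]. intros t.
      replace (h t + - (1) * g t) with (h t - g t) by ring. apply H. }
    pose proof two_PI_pos as HP.
    apply (Rmult_le_compat_l (/ (2 * PI))) in B; [|apply Rlt_le, Rinv_0_lt_compat, HP].
    replace (/ (2 * PI) * (eps * (2 * PI)))%R with eps in B by (field; lra). exact B.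
  - rewrite JC_plus, JC_scal by assumption. ring.
Qed.

Lemma pmeans_nil P : pmeans [] P = P.
Proof. unfold pmeans; simpl. induction P as [|a P IH]; simpl; [|rewrite IH]; reflexivity. Qed.

Lemma pmeans_incl vars P ce : In ce (pmeans vars P) -> In ce P.
Proof. intros H. now apply filter_In in H. Qed.

(** Averaging is a contraction in the sup norm and acts on Laurent polynomials by discarding terms,
    so an approximation of [F] passes to its averages. The bound on the difference needs linearity
    of the integral, hence continuity of the partial averages; this comes from their own
    approximation by Laurent polynomials. *)
Lemma avgs_approx vars : incl vars Vs -> forall A F, LC A F ->
  LC A (avgs R0 vars F) /\
  forall P eps, (forall xi, onT xi -> (Cmod (F xi - leval P xi) <= eps)%R) ->
    forall xi, onT xi -> (Cmod (avgs R0 vars F xi - leval (pmeans vars P) xi) <= eps)%R.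
Proof.
  intros Hincl A F HF.
  assert (W : forall P eps, (forall xi, onT xi -> (Cmod (F xi - leval P xi) <= eps)%R) ->
    forall xi, onT xi -> (Cmod (avgs R0 vars F xi - leval (pmeans vars P) xi) <= eps)%R).
  { induction vars as [|v vs IH].
    - intros P eps H xi Hxi. rewrite pmeans_nil. now apply H.
    - assert (Hv : In v Vs) by (apply Hincl; now left).
      assert (Hvs : incl vs Vs) by (intros u Hu; apply Hincl; now right).
      specialize (IH Hvs). intros P eps H xi Hxi. simpl.
      destruct (leval_circle (pmeans vs P) xi v Hv) as [C1 C2].
      replace (pmeans (v :: vs) P) with (filter (fun ce => Z.eqb (snd ce v) 0) (pmeans vs P))
        by apply filter_filter_and.
      rewrite <- C2.
      apply (avg1_diff (avgs R0 vs F) (leval (pmeans vs P))).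
      + apply (LC_ContC A); [assumption| |assumption].
        intros e He. destruct (HF e He) as (Q & HQ & HFQ).
        exists (pmeans vs Q). split; [intros ce Hce; apply HQ; now apply pmeans_incl in Hce|].
        intros eta Heta. now apply IH.
      + exact C1.
      + intros th. apply IH; [assumption|]. now apply onT_upd. }
  split; [|exact W].
  intros e He. destruct (HF e He) as (Q & HQ & HFQ).
  exists (pmeans vars Q). split; [intros ce Hce; apply HQ; now apply pmeans_incl in Hce|].
  intros eta Heta. now apply W.
Qed.

Definition pmean (P : list (C * (nat -> Z))) : C := bsum fst (pmeans Vs P).

(** The mean is thereby determined by the constant terms of approximating polynomials. Linearity,
    exchange of variables and vanishing are all derived from this instead of from iterated
    integrals. *)
Lemma EE_approx A F P eps : LC A F ->
  (forall xi, onT xi -> (Cmod (F xi - leval P xi) <= eps)%R) ->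
  (Cmod (EE F - pmean P) <= eps)%R.
Proof.
  intros HF H. destruct (avgs_approx Vs (incl_refl Vs) A F HF) as [_ W].
  specialize (W P eps H _ onT_const). unfold EE.
  replace (pmean P) with (leval (pmeans Vs P) (fun _ => RtoC R0)); [exact W|].
  unfold pmean, leval. apply bsum_ext. intros [c e] Hce. simpl.
  rewrite mono_0; [ring|]. intros i Hi. apply filter_In in Hce as [_ Hce]. simpl in Hce.
  rewrite forallb_forall in Hce. now apply Z.eqb_eq, Hce.
Qed.

Lemma avgs_ext vars F G : (forall xi, onT xi -> F xi = G xi) ->
  forall xi, onT xi -> avgs R0 vars F xi = avgs R0 vars G xi.
Proof.
  intros H. induction vars as [|v vs IH]; [exact H|]. intros xi Hxi. simpl. unfold avg1.
  f_equal. f_equal. apply functional_extensionality. intros th. apply IH. now apply onT_upd.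
Qed.

Lemma EE_ext F G : (forall xi, onT xi -> F xi = G xi) -> EE F = EE G.
Proof. intros H. apply avgs_ext; [exact H | apply onT_const]. Qed.

Lemma LC_ext A F G : (forall xi, onT xi -> F xi = G xi) -> LC A F -> LC A G.
Proof.
  intros H HF e He. destruct (HF e He) as (P & HP & HFP). exists P. split; [exact HP|].
  intros xi Hxi. rewrite <- H by assumption. now apply HFP.
Qed.

Lemma LC_weaken (A B : (nat -> Z) -> Prop) F : (forall e, A e -> B e) -> LC A F -> LC B F.
Proof.
  intros H HF e He. destruct (HF e He) as (P & HP & HFP). exists P. split; [auto|exact HFP].
Qed.

Lemma Cmod_eq_0_lim (z : C) : (forall eps, (0 < eps)%R -> (Cmod z <= eps)%R) -> z = 0.
Proof.
  intros H. apply Cmod_eq_0. apply Rle_antisym; [|apply Cmod_ge_0].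
  apply le_epsilon. intros e He. rewrite Rplus_0_l. now apply H.
Qed.

Lemma LC_plus A F G : LC A F -> LC A G -> LC A (fun xi => F xi + G xi).
Proof.
  intros HF HG e He. destruct (HF (e / 2)%R ltac:(lra)) as (P & HP & HFP).
  destruct (HG (e / 2)%R ltac:(lra)) as (Q & HQ & HGQ).
  exists (P ++ Q). split; [intros ce Hce; apply in_app_or in Hce as []; auto|].
  intros xi Hxi. rewrite leval_app.
  replace (F xi + G xi - (leval P xi + leval Q xi)) with ((F xi - leval P xi) + (G xi - leval Q xi)) by ring.
  eapply Rle_trans; [apply Cmod_triangle|]. specialize (HFP xi Hxi). specialize (HGQ xi Hxi). lra.
Qed.

Lemma LC_bounded A F : LC A F -> exists M, (0 < M)%R /\ forall xi, onT xi -> (Cmod (F xi) <= M)%R.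
Proof.
  intros HF. destruct (HF 1%R ltac:(lra)) as (P & _ & HFP).
  destruct (leval_bound P) as (M & HM & HPM). exists (M + 1)%R. split; [lra|].
  intros xi Hxi. replace (F xi) with ((F xi - leval P xi) + leval P xi) by ring.
  eapply Rle_trans; [apply Cmod_triangle|]. specialize (HFP xi Hxi). specialize (HPM xi Hxi). lra.
Qed.

Lemma LC_mult (A B D : (nat -> Z) -> Prop) F G :
  (forall a b, A a -> B b -> D (eadd a b)) ->
  LC A F -> LC B G -> LC D (fun xi => F xi * G xi).
Proof.
  intros HABD HF HG e He.
  destruct (LC_bounded B G HG) as (M & HM & HGM).
  destruct (HF (e / 2 / M)%R) as (P & HP & HFP); [apply Rdiv_lt_0_compat; lra|].
  destruct (leval_bound P) as (K & HK & HPK).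
  destruct (HG (e / 2 / K)%R) as (Q & HQ & HGQ); [apply Rdiv_lt_0_compat; lra|].
  exists (pmul P Q). split.
  - intros ce Hce. apply in_flat_map in Hce as ([c a] & Ha & Hce).
    apply in_map_iff in Hce as ([c' b] & <- & Hb). simpl. apply HABD; [apply (HP _ Ha)|apply (HQ _ Hb)].
  - intros xi Hxi. rewrite leval_pmul by assumption.
    replace (F xi * G xi - leval P xi * leval Q xi)
      with ((F xi - leval P xi) * G xi + leval P xi * (G xi - leval Q xi)) by ring.
    eapply Rle_trans; [apply Cmod_triangle|]. rewrite !Cmod_mult.
    specialize (HFP xi Hxi). specialize (HGQ xi Hxi). specialize (HPK xi Hxi). specialize (HGM xi Hxi).
    pose proof (Cmod_ge_0 (F xi - leval P xi)). pose proof (Cmod_ge_0 (G xi - leval Q xi)).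
    pose proof (Cmod_ge_0 (G xi)). pose proof (Cmod_ge_0 (leval P xi)).
    assert (Cmod (F xi - leval P xi) * Cmod (G xi) <= e / 2 / M * M)%R by (apply Rmult_le_compat; lra).
    assert (Cmod (leval P xi) * Cmod (G xi - leval Q xi) <= K * (e / 2 / K))%R by (apply Rmult_le_compat; lra).
    replace (e / 2 / M * M)%R with (e / 2)%R in * by (field; lra).
    replace (K * (e / 2 / K))%R with (e / 2)%R in * by (field; lra). lra.
Qed.

Lemma LC_mono (A : (nat -> Z) -> Prop) c e : A e -> LC A (fun xi => c * mono e xi).
Proof.
  intros HA eps He. exists [(c, e)]. split; [intros ce [<-|[]]; exact HA|].
  intros xi _. unfold leval. rewrite bsum_cons, bsum_nil. simpl.
  replace (_ - _) with (RtoC 0) by ring. rewrite Cmod_0; lra.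
Qed.

Lemma LC_const (A : (nat -> Z) -> Prop) c : A (fun _ => 0%Z) -> LC A (fun _ => c).
Proof.
  intros HA. apply (LC_ext _ (fun xi => c * mono (fun _ => 0%Z) xi)); [|now apply LC_mono].
  intros xi _. rewrite mono_0 by reflexivity. ring.
Qed.

Lemma LC_0 A : LC A (fun _ => 0).
Proof.
  intros e He. exists []. split; [intros ? []|]. intros xi _. unfold leval. rewrite bsum_nil.
  replace (0 - 0) with (RtoC 0) by ring. rewrite Cmod_0. lra.
Qed.

Lemma LC_var (A : (nat -> Z) -> Prop) i z : In i Vs -> A (dl i z) -> LC A (fun xi => Cpowz (xi i) z).
Proof.
  intros Hi HA. apply (LC_ext _ (fun xi => 1 * mono (dl i z) xi)); [|now apply LC_mono].
  intros xi _. rewrite mono_dl by assumption. ring.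
Qed.

Lemma LC_scal A c F : LC A F -> LC A (fun xi => c * F xi).
Proof.
  intros HF. apply (LC_mult (fun e => forall i, e i = 0%Z) A); [| |exact HF].
  - intros a b Ha Hb. replace (eadd a b) with b; [exact Hb|].
    apply functional_extensionality; intros i; unfold eadd; now rewrite Ha.
  - now apply LC_const.
Qed.

Lemma LC_bsum {T : Type} A (F : T -> (nat -> C) -> C) l :
  (forall a, In a l -> LC A (F a)) -> LC A (fun xi => bsum (fun a => F a xi) l).
Proof.
  induction l as [|a l IH]; intros H; [apply LC_0|].
  apply (LC_plus A (F a) (fun xi => bsum (fun a => F a xi) l)); [apply H; now left|]. apply IH; intros; apply H; now right.
Qed.

Lemma LC_lim A F : (forall eps, (0 < eps)%R -> exists G, LC A G /\ forall xi, onT xi -> (Cmod (F xi - G xi) <= eps)%R) ->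
  LC A F.
Proof.
  intros H e He. destruct (H (e / 2)%R ltac:(lra)) as (G & HG & HFG).
  destruct (HG (e / 2)%R ltac:(lra)) as (P & HP & HGP). exists P. split; [exact HP|].
  intros xi Hxi. replace (F xi - leval P xi) with ((F xi - G xi) + (G xi - leval P xi)) by ring.
  eapply Rle_trans; [apply Cmod_triangle|]. specialize (HFG xi Hxi). specialize (HGP xi Hxi). lra.
Qed.

Lemma LC_pow (A : (nat -> Z) -> Prop) F n : A (fun _ => 0%Z) -> (forall a b, A a -> A b -> A (eadd a b)) ->
  LC A F -> LC A (fun xi => F xi ^ n).
Proof.
  intros H0 HA HF. induction n as [|n IH]; [now apply (LC_const A 1)|].
  apply (LC_mult A A A F (fun xi => F xi ^ n)); assumption.
Qed.

(** The geometric series produces only sums of exponents of [g], so [A] may be any additive monoid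
    containing these. The bound 1/2 is what the lower bound on the radius guarantees in every
    use. *)
Lemma LC_geom (A : (nat -> Z) -> Prop) g : A (fun _ => 0%Z) -> (forall a b, A a -> A b -> A (eadd a b)) ->
  LC A g -> (forall xi, onT xi -> (Cmod (g xi) <= / 2)%R) -> LC A (fun xi => / (1 - g xi)).
Proof.
  intros H0 HA Hg Hb. apply LC_lim. intros eps He.
  (* The remainder is z^n / (1 - z) with |z| at most 1/2, so 1/|1 - z| is at most 2 and it suffices
     that 2^-n is below eps/2. *)
  destruct (pow_lt_1_zero (/ 2) ltac:(rewrite Rabs_pos_eq; lra) (eps / 2)%R ltac:(lra)) as (n & Hn).
  exists (fun xi => bsum (fun k => g xi ^ k) (seq 0 n)). split.
  - apply LC_bsum. intros k _. now apply LC_pow.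
  - intros xi Hxi. specialize (Hb xi Hxi). set (z := g xi) in *.
    assert (Hz : (/ 2 <= Cmod (1 - z))%R).
    { pose proof (Cmod_triangle (1 - z) z) as T. replace (1 - z + z) with (RtoC 1) in T by ring.
      rewrite Cmod_1 in T. lra. }
    assert (Hz0 : 1 - z <> 0) by (intros E; rewrite E, Cmod_0 in Hz; lra).
    assert (G : forall m, bsum (fun k => z ^ k) (seq 0 m) = (1 - z ^ m) / (1 - z)).
    { induction m as [|m IHm]; [simpl; unfold bsum; simpl; field; assumption|].
      rewrite seq_S, bsum_app, IHm, bsum_cons, bsum_nil, Nat.add_0_l, Cpow_S. field. assumption. }
    rewrite G. replace (/ (1 - z) - (1 - z ^ n) / (1 - z)) with (z ^ n * / (1 - z)) by (field; assumption).
    rewrite Cmod_mult, Cmod_pow, Cmod_inv by assumption.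
    specialize (Hn n (Nat.le_refl n)). rewrite Rabs_pos_eq in Hn by (apply pow_le; lra).
    assert (Cmod z ^ n <= (/ 2) ^ n)%R by (apply pow_incr; split; [apply Cmod_ge_0|exact Hb]).
    assert (/ Cmod (1 - z) <= 2)%R
      by (replace 2%R with (/ / 2)%R by (field; lra); apply Rinv_le_contravar; lra).
    assert (0 <= Cmod z ^ n)%R by (apply pow_le, Cmod_ge_0).
    assert (0 < / Cmod (1 - z))%R by (apply Rinv_0_lt_compat; lra).
    nra.
Qed.

Lemma EE_plus A B F G : LC A F -> LC B G -> EE (fun xi => F xi + G xi) = EE F + EE G.
Proof.
  intros HF HG.
  apply (LC_weaken _ (fun _ => True)) in HF; [|auto]. apply (LC_weaken _ (fun _ => True)) in HG; [|auto].
  assert (H : EE (fun xi => F xi + G xi) - (EE F + EE G) = 0).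
  { apply Cmod_eq_0_lim. intros e He.
    destruct (HF (e / 4)%R ltac:(lra)) as (P & _ & HFP). destruct (HG (e / 4)%R ltac:(lra)) as (Q & _ & HGQ).
    pose proof (EE_approx _ _ _ _ HF HFP) as E1. pose proof (EE_approx _ _ _ _ HG HGQ) as E2.
    assert (E3 : (Cmod (EE (fun xi => (F xi + G xi)%C) - pmean (P ++ Q)) <= e / 2)%R).
    { apply (EE_approx (fun _ => True)); [now apply LC_plus|]. intros xi Hxi. rewrite leval_app.
      replace (F xi + G xi - (leval P xi + leval Q xi)) with ((F xi - leval P xi) + (G xi - leval Q xi)) by ring.
      eapply Rle_trans; [apply Cmod_triangle|]. specialize (HFP xi Hxi). specialize (HGQ xi Hxi). lra. }
    assert (E4 : pmean (P ++ Q) = pmean P + pmean Q)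
      by (unfold pmean, pmeans; rewrite filter_app; apply bsum_app).
    rewrite E4 in E3.
    replace (EE (fun xi => F xi + G xi) - (EE F + EE G))
      with ((EE (fun xi => F xi + G xi) - (pmean P + pmean Q)) + - (EE F - pmean P) + - (EE G - pmean Q)) by ring.
    eapply Rle_trans; [apply Cmod_triangle|]. rewrite Cmod_opp.
    eapply Rle_trans; [apply Rplus_le_compat_r, Cmod_triangle|]. rewrite Cmod_opp. lra. }
  replace (EE (fun xi => F xi + G xi)) with ((EE (fun xi => F xi + G xi) - (EE F + EE G)) + (EE F + EE G)) by ring.
  rewrite H. ring.
Qed.

Lemma EE_unique A F z : LC A F ->
  (forall eps, (0 < eps)%R -> exists P, (forall xi, onT xi -> (Cmod (F xi - leval P xi) <= eps)%R) /\
     (Cmod (z - pmean P) <= eps)%R) -> EE F = z.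
Proof.
  intros HF H.
  assert (E : EE F - z = 0).
  { apply Cmod_eq_0_lim. intros e He. destruct (H (e / 2)%R ltac:(lra)) as (P & HP & Hz).
    pose proof (EE_approx _ _ _ _ HF HP) as E1.
    replace (EE F - z) with ((EE F - pmean P) + - (z - pmean P)) by ring.
    eapply Rle_trans; [apply Cmod_triangle|]. rewrite Cmod_opp. lra. }
  replace (EE F) with ((EE F - z) + z) by ring. rewrite E. ring.
Qed.

Lemma pmean_pshift0 c P : pmean (pshift c (fun _ => 0%Z) P) = c * pmean P.
Proof.
  unfold pmean, pmeans, pshift. induction P as [|[k e] P IH]; [unfold bsum; simpl; ring|].
  cbn [map filter snd fst].
  change (forallb (fun v => Z.eqb (eadd (fun _ => 0%Z) e v) 0) Vs)
    with (forallb (fun v => Z.eqb (e v) 0) Vs).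
  destruct (forallb (fun v : nat => Z.eqb (e v) 0) Vs); rewrite ?bsum_cons, IH; cbn [fst]; ring.
Qed.

Lemma EE_scal A c F : LC A F -> EE (fun xi => c * F xi) = c * EE F.
Proof.
  intros HF. apply (EE_unique A); [now apply LC_scal|]. intros e He.
  assert (Hc : (0 < Cmod c + 1)%R) by (pose proof (Cmod_ge_0 c); lra).
  destruct (HF (e / (Cmod c + 1))%R) as (P & _ & HFP); [now apply Rdiv_lt_0_compat|].
  assert (K : forall z, (Cmod z <= e / (Cmod c + 1))%R -> (Cmod (c * z) <= e)%R).
  { intros z Hz. rewrite Cmod_mult. pose proof (Cmod_ge_0 z). pose proof (Cmod_ge_0 c).
    apply Rle_trans with ((Cmod c + 1) * (e / (Cmod c + 1)))%R; [apply Rmult_le_compat; lra|].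
    apply Req_le. field. lra. }
  exists (pshift c (fun _ => 0%Z) P). split.
  - intros xi Hxi. rewrite leval_pshift, mono_0 by (assumption || reflexivity).
    replace (c * F xi - c * 1 * leval P xi) with (c * (F xi - leval P xi)) by ring.
    apply K. now apply HFP.
  - rewrite pmean_pshift0. replace (c * EE F - c * pmean P) with (c * (EE F - pmean P)) by ring.
    apply K. now apply (EE_approx A).
Qed.

(** A Laurent monomial has mean 0 unless its exponents on [Vs] all vanish, and [A] excludes that
    case. *)
Lemma EE_zero A F : (forall e, A e -> exists i, In i Vs /\ e i <> 0%Z) -> LC A F -> EE F = 0.
Proof.
  intros HA HF. apply (EE_unique A); [exact HF|]. intros e He.
  destruct (HF e He) as (P & HP & HFP). exists P. split; [exact HFP|].
  replace (pmean P) with (RtoC 0).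
  - replace (0 - 0) with (RtoC 0) by ring. rewrite Cmod_0. lra.
  - unfold pmean, pmeans. clear HFP. induction P as [|[c a] P IH]; [reflexivity|]. simpl.
    destruct (forallb (fun v : nat => Z.eqb (a v) 0) Vs) eqn:E.
    + destruct (HA a (HP _ (or_introl eq_refl))) as (i & Hi & Hai).
      rewrite forallb_forall in E. specialize (E i Hi). apply Z.eqb_eq in E. contradiction.
    + apply IH. intros ce Hce. apply HP. now right.
Qed.

Lemma EE_const c : EE (fun _ => c) = c.
Proof.
  apply (EE_unique (fun _ => True)); [now apply LC_const|]. intros e He.
  exists [(c, fun _ => 0%Z)]. split.
  - intros xi _. unfold leval. rewrite bsum_cons, bsum_nil. simpl. rewrite mono_0 by reflexivity.
    replace (_ - _) with (RtoC 0) by ring. rewrite Cmod_0; lra.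
  - unfold pmean, pmeans. simpl. replace (forallb (fun _ : nat => true) Vs) with true
      by (symmetry; apply forallb_forall; auto).
    rewrite bsum_cons, bsum_nil. simpl. replace (_ - _) with (RtoC 0) by ring. rewrite Cmod_0; lra.
Qed.

Lemma EE_bsum {T : Type} A (F : T -> (nat -> C) -> C) l :
  (forall a, In a l -> LC A (F a)) -> EE (fun xi => bsum (fun a => F a xi) l) = bsum (fun a => EE (F a)) l.
Proof.
  induction l as [|a l IH]; intros H.
  - unfold bsum; simpl. apply EE_const.
  - rewrite bsum_cons, <- IH by (intros; apply H; now right).
    apply (EE_plus A A); [apply H; now left|]. apply LC_bsum. intros; apply H; now right.
Qed.

Lemma EE_lim A F : LC A F -> (forall eps, (0 < eps)%R -> exists G, LC A G /\ EE G = 0 /\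
  forall xi, onT xi -> (Cmod (F xi - G xi) <= eps)%R) -> EE F = 0.
Proof.
  intros HF H. apply Cmod_eq_0_lim. intros e He.
  destruct (H (e / 3)%R ltac:(lra)) as (G & HG & HG0 & HFG).
  destruct (HG (e / 3)%R ltac:(lra)) as (P & _ & HGP).
  pose proof (EE_approx _ _ _ _ HG HGP) as E1. rewrite HG0 in E1.
  assert (E2 : (Cmod (EE F - pmean P) <= e / 3 + e / 3)%R).
  { apply (EE_approx A); [exact HF|]. intros xi Hxi.
    replace (F xi - leval P xi) with ((F xi - G xi) + (G xi - leval P xi)) by ring.
    eapply Rle_trans; [apply Cmod_triangle|]. specialize (HFG xi Hxi). specialize (HGP xi Hxi). lra. }
  replace (EE F) with ((EE F - pmean P) + - (0 - pmean P)) by ring.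
  eapply Rle_trans; [apply Cmod_triangle|]. rewrite Cmod_opp. lra.
Qed.

(** Lets one factor be expanded in monomials: each monomial merely shifts the exponents of the other
    factor, so a vanishing statement valid for all shifts in [A] extends to the product. *)
Lemma EE_mult_zero A B F G : LC B F -> LC A G ->
  (forall e, A e -> EE (fun xi => F xi * mono e xi) = 0) -> EE (fun xi => F xi * G xi) = 0.
Proof.
  intros HF HG H.
  apply (LC_weaken _ (fun _ => True)) in HF; [|auto].
  assert (HG' : LC (fun _ => True) G) by (apply (LC_weaken A); auto).
  destruct (LC_bounded _ F HF) as (M & HM & HFM).
  apply (EE_lim (fun _ => True)); [now apply (LC_mult (fun _ => True) (fun _ => True))|].
  intros e He. destruct (HG (e / M)%R) as (P & HP & HGP); [apply Rdiv_lt_0_compat; lra|].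
  exists (fun xi => bsum (fun ce => fst ce * (F xi * mono (snd ce) xi)) P).
  assert (HL : forall ce : C * (nat -> Z), LC (fun _ => True) (fun xi => F xi * mono (snd ce) xi)).
  { intros ce. apply (LC_mult (fun _ => True) (fun _ => True)); [auto|exact HF|].
    apply (LC_ext _ (fun xi => 1 * mono (snd ce) xi)); [intros; ring | now apply LC_mono]. }
  split; [|split].
  - apply LC_bsum. intros ce _. apply LC_scal, HL.
  - rewrite (EE_bsum (fun _ => True)) by (intros; apply LC_scal, HL).
    apply bsum_0. intros ce Hce. rewrite (EE_scal (fun _ => True)) by apply HL.
    rewrite H by now apply HP. ring.
  - intros xi Hxi.
    replace (bsum _ P) with (F xi * leval P xi).
    + replace (F xi * G xi - F xi * leval P xi) with (F xi * (G xi - leval P xi)) by ring.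
      rewrite Cmod_mult. specialize (HFM xi Hxi). specialize (HGP xi Hxi).
      pose proof (Cmod_ge_0 (F xi)). pose proof (Cmod_ge_0 (G xi - leval P xi)).
      apply Rle_trans with (M * (e / M))%R; [apply Rmult_le_compat; lra|].
      apply Req_le. field. lra.
    + unfold leval. rewrite <- bsum_scal. apply bsum_ext. intros ce _. ring.
Qed.

Lemma mono_sw e xi i j : In i Vs -> In j Vs ->
  mono e (fun v => xi (sw i j v)) = mono (fun v => e (sw i j v)) xi.
Proof.
  intros Hi Hj. unfold mono.
  rewrite <- (bprod_perm _ _ _ (sw_perm i j Vs HVs ltac:(tauto))), bprod_map.
  apply bprod_ext. intros v _. now rewrite sw_invol.
Qed.

Lemma onT_sw xi i j : onT xi -> onT (fun v => xi (sw i j v)).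
Proof. intros H v. apply H. Qed.

Lemma leval_sw P xi i j : In i Vs -> In j Vs ->
  leval P (fun v => xi (sw i j v)) = leval (map (fun ce => (fst ce, fun v => snd ce (sw i j v))) P) xi.
Proof.
  intros Hi Hj. unfold leval. rewrite bsum_map. apply bsum_ext. intros ce _. simpl.
  now rewrite mono_sw.
Qed.

Lemma LC_sw F i j : In i Vs -> In j Vs -> LC (fun _ => True) F ->
  LC (fun _ => True) (fun xi => F (fun v => xi (sw i j v))).
Proof.
  intros Hi Hj HF e He. destruct (HF e He) as (P & _ & HFP).
  exists (map (fun ce => (fst ce, fun v => snd ce (sw i j v))) P). split; [auto|].
  intros xi Hxi. rewrite <- leval_sw by assumption. now apply HFP, onT_sw.
Qed.

(** Exchanging two variables permutes the exponents of a Laurent polynomial and leaves its constant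
    term alone. This takes the place of Fubini for the iterated means. *)
Lemma EE_sw F i j : In i Vs -> In j Vs -> LC (fun _ => True) F ->
  EE (fun xi => F (fun v => xi (sw i j v))) = EE F.
Proof.
  intros Hi Hj HF. apply (EE_unique (fun _ => True)); [now apply LC_sw|]. intros e He.
  destruct (HF e He) as (P & _ & HFP).
  exists (map (fun ce => (fst ce, fun v => snd ce (sw i j v))) P). split.
  - intros xi Hxi. rewrite <- leval_sw by assumption. now apply HFP, onT_sw.
  - replace (pmean (map _ P)) with (pmean P); [now apply (EE_approx (fun _ => True))|].
    unfold pmean, pmeans. clear HFP. induction P as [|[c a] P IH]; [reflexivity|]. simpl.
    replace (forallb (fun v => Z.eqb (a (sw i j v)) 0) Vs) with (forallb (fun v => Z.eqb (a v) 0) Vs).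
    + destruct (forallb _ Vs); rewrite ?bsum_cons, IH; reflexivity.
    + apply Bool.eq_true_iff_eq. rewrite !forallb_forall.
      assert (Hs : forall v, In v Vs -> In (sw i j v) Vs).
      { intros v Hv. unfold sw. destruct (Nat.eqb v i); [assumption|]. destruct (Nat.eqb v j); assumption. }
      split; intros H v Hv; [now apply H, Hs|].
      rewrite <- (sw_invol i j v). now apply H, Hs.
Qed.

Lemma avg1_onT_scal A F v u xi : In v Vs -> LC A F -> onT xi -> u <> v ->
  avg1 R0 v (fun eta => F eta * eta u) xi = avg1 R0 v F xi * xi u.
Proof.
  intros Hv HF Hxi Hu. unfold avg1.
  replace (fun th => F (upd xi v (RtoC R0 * Cexp (0%R, th))) * upd xi v (RtoC R0 * Cexp (0%R, th)) u)
    with (fun th => xi u * F (upd xi v (RtoC R0 * Cexp (0%R, th)))).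
  - rewrite JC_scal by now apply (LC_ContC A). ring.
  - apply functional_extensionality; intros th. rewrite upd_other by assumption. ring.
Qed.

Lemma avgs_onT_scal A F vs u : incl vs Vs -> LC A F -> ~ In u vs -> forall xi, onT xi ->
  avgs R0 vs (fun eta => F eta * eta u) xi = avgs R0 vs F xi * xi u.
Proof.
  intros Hincl HF. induction vs as [|v vs IH]; intros Hu xi Hxi; [reflexivity|]. simpl.
  assert (Hvs : incl vs Vs) by (intros w Hw; apply Hincl; now right).
  rewrite <- (avg1_onT_scal A); [|apply Hincl; now left|now apply avgs_approx|assumption|intros ->; apply Hu; now left].
  unfold avg1. f_equal. f_equal. apply functional_extensionality; intros th.
  apply IH; [assumption|intros H; apply Hu; now right|]. now apply onT_upd.
Qed.

(** The factors xi_v coming from d xi_v sit between the nested integrals; each is constant for the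
    integrations inside it and can be moved into the integrand. *)
Lemma mcint_avgs F vars : NoDup vars -> incl vars Vs -> LC (fun _ => True) F -> forall xi, onT xi ->
  mcint R0 vars F xi = avgs R0 vars (fun eta => F eta * bprod eta vars) xi.
Proof.
  intros Hnd Hincl HF. induction vars as [|v vs IH]; intros xi Hxi.
  - simpl. rewrite bprod_nil. ring.
  - inversion Hnd as [|? ? Hv Hvs]; subst.
    assert (Hincl' : incl vs Vs) by (intros w Hw; apply Hincl; now right).
    assert (HL : LC (fun _ => True) (fun eta => F eta * bprod eta vs)).
    { clear - HF Hincl' HR HVs. apply (LC_mult (fun _ => True) (fun _ => True)); [auto|exact HF|].
      induction vs as [|u vs IH]; [now apply (LC_const _ 1)|].
      apply (LC_mult (fun _ => True) (fun _ => True) _ (fun xi => xi u) (fun xi => bprod xi vs)); [auto| |].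
      - apply (LC_ext _ (fun xi => Cpowz (xi u) 1)); [intros; apply Cpowz_1_r|].
        apply LC_var; [apply Hincl'; now left|auto].
      - apply IH. intros w Hw; apply Hincl'; now right. }
    change (mcint R0 (v :: vs) F xi) with
      (RtoC (/ (2 * PI)) * JC (fun th => mcint R0 vs F (upd xi v (RtoC R0 * Cexp (0%R, th))) * (RtoC R0 * Cexp (0%R, th)))).
    simpl avgs. unfold avg1. f_equal. f_equal. apply functional_extensionality; intros th.
    rewrite IH by (try apply onT_upd; assumption).
    set (eta := upd xi v (RtoC R0 * Cexp (0%R, th))).
    assert (Heta : onT eta) by now apply onT_upd.
    replace (RtoC R0 * Cexp (0%R, th)) with (eta v) by apply upd_same.
    rewrite <- (avgs_onT_scal (fun _ => True)) by assumption.
    apply avgs_ext; [|assumption]. intros zeta _. rewrite bprod_cons. ring.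
Qed.

(** [D] is the set of variables on which the environments are known to agree; it grows by the
    integration variable on the way inwards. *)
Lemma mcint_env F vars (D : nat -> Prop) :
  (forall xi eta, (forall i, D i \/ In i vars -> xi i = eta i) -> F xi = F eta) ->
  forall xi eta, (forall i, D i -> xi i = eta i) -> mcint R0 vars F xi = mcint R0 vars F eta.
Proof.
  revert D. induction vars as [|v vs IH]; intros D HF xi eta H.
  - apply HF. intros i [Hi|[]]. now apply H.
  - change (mcint R0 (v :: vs) F) with (fun xi =>
      (RtoC (/ (2 * PI)) * JC (fun th => mcint R0 vs F (upd xi v (RtoC R0 * Cexp (0%R, th))) * (RtoC R0 * Cexp (0%R, th))))).
    cbv beta. f_equal. f_equal. apply functional_extensionality; intros th. f_equal.
    apply (IH (fun i => D i \/ i = v)).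
    + intros a b Hab. apply HF. intros i Hi. apply Hab. simpl in Hi. intuition.
    + intros i [Hi|Hi]; unfold upd; destruct (Nat.eqb_spec i v); auto. contradiction.
Qed.

(** The variables of [Vs] outside [vars] are averaged as well, harmlessly, since neither the
    integrand nor the Jacobian depends on them. One mean over [Vs] thus serves all index sets at
    once. *)
Lemma EE_mcint F vars xi0 : NoDup vars -> incl vars Vs -> LC (fun _ => True) F ->
  (forall xi eta, (forall i, In i vars -> xi i = eta i) -> F xi = F eta) ->
  mcint R0 vars F xi0 = EE (fun xi => F xi * bprod xi vars).
Proof.
  intros Hnd Hincl HF Hdep.
  rewrite (mcint_env F vars (fun _ => False) ltac:(intros; apply Hdep; intuition) xi0 (fun _ => RtoC R0) ltac:(intros ? [])).
  set (c := mcint R0 vars F (fun _ => RtoC R0)).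
  assert (Hc : forall xi, onT xi -> avgs R0 vars (fun eta => F eta * bprod eta vars) xi = c).
  { intros xi Hxi. rewrite <- mcint_avgs by assumption.
    apply (mcint_env F vars (fun _ => False)); [intros; apply Hdep; intuition | intros ? []]. }
  assert (HL : LC (fun _ => True) (fun eta => F eta * bprod eta vars)).
  { clear - HF Hincl HR HVs. apply (LC_mult (fun _ => True) (fun _ => True)); [auto|exact HF|].
    induction vars as [|u vs IH]; [now apply (LC_const _ 1)|].
    apply (LC_mult (fun _ => True) (fun _ => True) _ (fun xi => xi u) (fun xi => bprod xi vs)); [auto| |].
    - apply (LC_ext _ (fun xi => Cpowz (xi u) 1)); [intros; apply Cpowz_1_r|].
      apply LC_var; [apply Hincl; now left|auto].
    - apply IH. intros w Hw; apply Hincl; now right. }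
  symmetry. apply (EE_unique (fun _ => True)); [exact HL|]. intros e He.
  destruct (HL e He) as (P & _ & HP). exists P. split; [exact HP|].
  destruct (avgs_approx vars Hincl _ _ HL) as [HL2 W]. specialize (W P e HP).
  assert (E : (Cmod (EE (fun _ => c) - pmean (pmeans vars P)) <= e)%R).
  { apply (EE_approx (fun _ => True)); [now apply LC_const|]. intros xi Hxi.
    rewrite <- (Hc xi Hxi). now apply W. }
  rewrite EE_const in E.
  replace (pmean P) with (pmean (pmeans vars P)); [exact E|].
  unfold pmean, pmeans. rewrite filter_filter_and. f_equal. apply filter_ext. intros ce.
  destruct (forallb (fun v : nat => Z.eqb (snd ce v) 0) Vs) eqn:E1; [|reflexivity]. simpl.
  rewrite forallb_forall in E1 |- *. intros v Hv. now apply E1, Hincl.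
Qed.

End Torus.

(** * The numerators of the integrands *)

(** The sign that makes [sg u v * (xi v - xi u)] symmetric in u and v: it is always the variable of
    larger index minus the other. *)
Definition sg (u v : nat) : C := if Nat.ltb u v then 1 else - (1).

(** The case m = 1, where only S is left. The sign is a parameter [s] because relabelling the
    indices does not preserve their order and so changes it. *)
Definition amp0 (s : nat -> nat -> C) (z : Z) (U : list nat) (xi : nat -> C) : C :=
  pprod (fun u v => s u v * (xi v - xi u)) U *
  ((1 - bprod xi U) / bprod (fun v => 1 - xi v) U) * bprod (fun v => Cpowz (xi v) z) U.

(** [amp p s xs z U] is, for [xs = [x_1; ...; x_(m-1)]] and [z = x_m], the sum over all
    [(Lambda, S)] with [Lambda] and [S] partitioning [U] of the numerators of the integrands
    in the theorem, organized by the choice of [ell_1], then [ell_2], and so on; the signs are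
    collected as one factor [s u v] per pair of indices in word order. *)
Fixpoint amp (p : R) (s : nat -> nat -> C) (xs : list Z) (z : Z) (U : list nat) (xi : nat -> C) : C :=
  match xs with
  | [] => amp0 s z U xi
  | x :: xs' =>
      bsum (fun l => bprod (fun v => s l v * fA p (xi l) (xi v)) (rem1 l U) *
                     Cpowz (xi l) x * amp p s xs' z (rem1 l U) xi) U
  end.

(** The factor f of the common denominator, its arguments put in index order; being symmetric in u
    and v, its product over pairs depends on the index set only. *)
Definition fo (p : R) (xi : nat -> C) (u v : nat) : C :=
  if Nat.ltb u v then fA p (xi u) (xi v) else fA p (xi v) (xi u).

Lemma sg_antisym u v : u <> v -> sg u v = - sg v u.
Proof.
  intros H. unfold sg.
  destruct (Nat.ltb_spec u v), (Nat.ltb_spec v u); try lia; ring.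
Qed.

Lemma sg_sq u v : sg u v * sg u v = 1.
Proof. unfold sg. destruct (Nat.ltb u v); ring. Qed.

Lemma fo_sym p xi u v : fo p xi u v = fo p xi v u.
Proof.
  unfold fo. destruct (Nat.ltb_spec u v), (Nat.ltb_spec v u); try lia; try reflexivity.
  now replace u with v by lia.
Qed.

Lemma amp0_perm s z U V xi : (forall u v, u <> v -> s u v = - s v u) -> Permutation U V ->
  amp0 s z U xi = amp0 s z V xi.
Proof.
  intros Hs HP. unfold amp0.
  assert (Hsym : forall a b, s a b * (xi b - xi a) = s b a * (xi a - xi b)).
  { intros a b. destruct (Nat.eq_dec a b) as [->|H]; [reflexivity | rewrite (Hs a b H); ring]. }
  rewrite (pprod_perm _ _ _ Hsym HP).
  now rewrite !(bprod_perm _ _ _ HP).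
Qed.

Lemma amp_perm p s xs z : (forall u v, u <> v -> s u v = - s v u) ->
  forall U V xi, NoDup U -> Permutation U V -> amp p s xs z U xi = amp p s xs z V xi.
Proof.
  intros Hs. induction xs as [|x xs IH]; intros U V xi Hnd HP; [now apply amp0_perm|]. simpl.
  rewrite (bsum_perm _ _ _ HP). apply bsum_ext. intros l _.
  pose proof (rem1_Permutation l U V HP Hnd) as HP'.
  rewrite (bprod_perm _ _ _ HP'). f_equal.
  apply IH; [now apply NoDup_rem1|exact HP'].
Qed.

Lemma amp_map_sw p i j xs z : forall s U xi,
  amp p s xs z (map (sw i j) U) xi =
  amp p (fun u v => s (sw i j u) (sw i j v)) xs z U (fun v => xi (sw i j v)).
Proof.
  induction xs as [|x xs IH]; intros s U xi.
  - simpl. unfold amp0. now rewrite pprod_map, !bprod_map.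
  - simpl. rewrite bsum_map. apply bsum_ext. intros l _.
    rewrite rem1_map_sw, bprod_map, IH. reflexivity.
Qed.

(** Every term of [amp] contains each unordered pair of [U] exactly once through [s], either when
    one of its indices is chosen or in [amp0]. A symmetric factor therefore comes out as a whole. *)
Lemma amp_sign p (rho : nat -> nat -> C) xs z : (forall u v, rho u v = rho v u) ->
  forall s s' U xi, NoDup U ->
  (forall u v, In u U -> In v U -> u <> v -> s' u v = rho u v * s u v) ->
  amp p s' xs z U xi = pprod rho U * amp p s xs z U xi.
Proof.
  intros Hrho. induction xs as [|x xs IH]; intros s s' U xi Hnd Hs.
  - simpl. unfold amp0.
    rewrite (pprod_ext_NoDup _ (fun u v => rho u v * (s u v * (xi v - xi u))) U Hnd).
    + rewrite pprod_mult. ring.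
    + intros u v Hu Hv Huv. rewrite Hs by assumption. ring.
  - simpl. rewrite <- bsum_scal. apply bsum_ext. intros l Hl.
    rewrite (pprod_perm rho _ _ Hrho (rem1_perm l U Hnd Hl)), pprod_cons.
    rewrite (IH s s') by (try (now apply NoDup_rem1); intros u v Hu Hv; apply in_rem1 in Hu, Hv; now apply Hs).
    rewrite (bprod_ext _ (fun v => rho l v * (s l v * fA p (xi l) (xi v)))).
    + rewrite bprod_mult. ring.
    + intros v Hv. apply in_rem1 in Hv as [Hv Hvl]. rewrite Hs by auto. ring.
Qed.

Lemma amp_sign_ext p xs z s s' U xi : NoDup U ->
  (forall u v, In u U -> In v U -> u <> v -> s' u v = s u v) ->
  amp p s' xs z U xi = amp p s xs z U xi.
Proof.
  intros Hnd H. rewrite (amp_sign p (fun _ _ => 1) xs z (fun _ _ => eq_refl) s s' U xi Hnd).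
  - rewrite pprod_1. ring.
  - intros u v Hu Hv Huv. rewrite H by assumption. ring.
Qed.

Lemma pprod_sw_sg i j U : i <> j -> NoDup U -> In i U -> In j U ->
  pprod (fun u v => sg (sw i j u) (sw i j v) * sg u v) U = - (1).
Proof.
  intros Hij Hnd Hi Hj. set (rho := fun u v => sg (sw i j u) (sw i j v) * sg u v).
  assert (Hrho : forall u v, rho u v = rho v u).
  { intros u v. unfold rho. destruct (Nat.eq_dec u v) as [->|H]; [reflexivity|].
    rewrite (sg_antisym u v), (sg_antisym (sw i j u)); [ring| |assumption].
    intros E. now apply sw_inj in E. }
  assert (HP : Permutation U (i :: j :: rem1 j (rem1 i U))).
  { rewrite (rem1_perm i U Hnd Hi) at 1. constructor. apply rem1_perm; [now apply NoDup_rem1|].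
    apply in_rem1; auto. }
  rewrite (pprod_perm rho _ _ Hrho HP), !pprod_cons, bprod_cons.
  set (W := rem1 j (rem1 i U)).
  assert (HW : forall v, In v W -> v <> i /\ v <> j).
  { intros v Hv. unfold W in Hv. rewrite !in_rem1 in Hv. tauto. }
  (* A third index v meets both i and j and the two sign changes multiply to 1, so only the pair of
     i and j itself contributes -1. *)
  assert (E1 : bprod (rho i) W * bprod (rho j) W = 1).
  { rewrite <- bprod_mult. apply bprod_1. intros v Hv. destruct (HW v Hv).
    unfold rho. rewrite sw_l, sw_r, !(sw_other i j v) by assumption.
    transitivity ((sg j v * sg j v) * (sg i v * sg i v)); [ring|]. rewrite !sg_sq. ring. }
  assert (E2 : pprod rho W = 1).
  { rewrite <- (pprod_1 W). apply pprod_ext. intros u v Hu Hv.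
    destruct (HW v Hv), (HW u Hu). unfold rho. rewrite !sw_other by assumption. apply sg_sq. }
  rewrite E2. transitivity (rho i j * (bprod (rho i) W * bprod (rho j) W)); [ring|]. rewrite E1.
  unfold rho. rewrite sw_l, sw_r, (sg_antisym j i) by auto.
  transitivity (- (sg i j * sg i j)); [ring|]. rewrite sg_sq. reflexivity.
Qed.

(** The sum over all ordered choices is invariant under relabelling except for its signs, and by
    [pprod_sw_sg] these change by -1 in total. *)
Lemma amp_antisym p xs z U xi i j : i <> j -> NoDup U -> In i U -> In j U ->
  amp p sg xs z U (fun v => xi (sw i j v)) = - amp p sg xs z U xi.
Proof.
  intros Hij Hnd Hi Hj.
  set (B := amp p sg xs z U (fun v => xi (sw i j v))).
  assert (E : amp p sg xs z U xi = - (1) * B).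
  { rewrite <- (amp_perm p sg xs z sg_antisym (map (sw i j) U) U xi)
      by (try apply NoDup_map_sw; try apply sw_perm; tauto).
    rewrite amp_map_sw, <- (pprod_sw_sg i j U Hij Hnd Hi Hj). unfold B.
    apply amp_sign; [|assumption|].
    - intros u v. destruct (Nat.eq_dec u v) as [->|H]; [reflexivity|].
      rewrite (sg_antisym u v), (sg_antisym (sw i j u)); [ring| |assumption].
      intros E. now apply sw_inj in E.
    - intros u v _ _ _. transitivity (sg (sw i j u) (sw i j v) * (sg u v * sg u v)); [rewrite sg_sq; ring | ring]. }
  rewrite E. ring.
Qed.

(** No integer lies strictly between i and i + 1, so exchanging the two preserves the order of every
    other pair. *)
Lemma sg_sw_adjacent i u v : ~ (u = i /\ v = S i) -> ~ (u = S i /\ v = i) -> u <> v ->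
  sg (sw i (S i) u) (sw i (S i) v) = sg u v.
Proof.
  intros H1 H2 H3. unfold sg, sw.
  destruct (Nat.eqb_spec u i), (Nat.eqb_spec u (S i)), (Nat.eqb_spec v i), (Nat.eqb_spec v (S i));
    subst; try lia; try tauto;
    repeat match goal with |- context [Nat.ltb ?a ?b] => destruct (Nat.ltb_spec a b) end; try lia; reflexivity.
Qed.

Lemma amp_sw_adjacent p xs z U xi i : NoDup U -> ~ (In i U /\ In (S i) U) ->
  amp p sg xs z (map (sw i (S i)) U) xi = amp p sg xs z U (fun v => xi (sw i (S i) v)).
Proof.
  intros Hnd H. rewrite amp_map_sw. apply amp_sign_ext; [assumption|].
  intros u v Hu Hv Huv. apply sg_sw_adjacent; [| |assumption]; intros [-> ->]; tauto.
Qed.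

(** When the choices exhaust [U], one reaches either a sum over no index or [amp0] of the empty set,
    where 1 minus the empty product is 0. *)
Lemma amp_small p s xs z : forall U xi, NoDup U -> (length U <= length xs)%nat -> amp p s xs z U xi = 0.
Proof.
  induction xs as [|x xs IH]; intros U xi Hnd H; simpl in H.
  - destruct U; [|simpl in H; lia]. simpl. unfold amp0. rewrite pprod_nil, !bprod_nil. unfold Cdiv. ring.
  - simpl. apply bsum_0. intros l Hl. rewrite IH; [ring|now apply NoDup_rem1|].
    rewrite (length_rem1 l U) in H by assumption. lia.
Qed.

(** * Vanishing of arrays *)

Definition dec (i : nat) (y : nat -> Z) : nat -> Z := fun v => if Nat.eqb v i then (y v - 1)%Z else y v.

Lemma dec_same i y : dec i y i = (y i - 1)%Z.
Proof. unfold dec. now rewrite Nat.eqb_refl. Qed.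

Lemma dec_other i y v : v <> i -> dec i y v = y v.
Proof. intros H. unfold dec. destruct (Nat.eqb_spec v i); [contradiction|reflexivity]. Qed.

Lemma argmin_exists (y : nat -> Z) K : K <> [] -> exists i, In i K /\ forall j, In j K -> (y i <= y j)%Z.
Proof.
  induction K as [|k K IH]; [congruence|]. intros _. destruct K as [|k' K].
  - exists k. split; [now left|]. intros j [<-|[]]. lia.
  - destruct IH as (i & Hi & Hmin); [congruence|].
    destruct (Z_le_gt_dec (y k) (y i)).
    + exists k. split; [now left|]. intros j [<-|Hj]; [lia|]. specialize (Hmin j Hj). lia.
    + exists i. split; [now right|]. intros j [<-|Hj]; [lia|]. auto.
Qed.

(* The recursion says that [V (j :: K)] is [V K] divided by [f(xi_a, xi_j)].  Running it in [y j]
   from [y j = y i], where antisymmetry makes the array vanish, leaves only [V [i]] for the index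
   [i] in [K] with the smallest [y i]. *)
Lemma array_vanish (p : R) (V : list nat -> (nat -> Z) -> C) (a : nat) (J : list nat) (c : Z) :
  (0 < p)%R -> ~ In a J ->
  (forall j K y, NoDup (j :: K) -> incl (j :: K) J ->
    RtoC p * V (j :: K) y - V (j :: K) (dec a y) + RtoC (1 - p) * V (j :: K) (dec a (dec j y)) = V K y) ->
  (forall K i j y, NoDup K -> incl K J -> In i K -> In j K -> i <> j -> y i = y j -> V K y = 0) ->
  (forall K y, NoDup K -> incl K J ->
    exists B, forall y', (forall v, v <> a -> y' v = y v) -> (y' a < B)%Z -> V K y' = 0) ->
  (forall i y, In i J -> (y a < c)%Z -> (y a < y i)%Z -> V [i] y = 0) ->
  (forall K K' y, Permutation K K' -> V K y = V K' y) ->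
  forall K y, K <> [] -> NoDup K -> incl K J -> (y a < c)%Z ->
    (forall j, In j K -> (y a < y j)%Z) -> V K y = 0.
Proof.
  intros Hp Ha HRec HS HZ HB HP.
  (* Induction on the other indices, with an index of minimal y in front, so that the antisymmetric
     case [y j = y i] is reached by lowering [y j] only. *)
  assert (Main : forall i K, NoDup (i :: K) -> incl (i :: K) J -> forall y, (y a < c)%Z -> (y a < y i)%Z ->
    (forall j, In j K -> (y i <= y j)%Z) -> V (i :: K) y = 0).
  { intros i K. induction K as [|j K IH]; intros Hnd Hincl y Hc Hi Hmin.
    - apply HB; auto. apply Hincl; now left.
    - assert (Hp1 : Permutation (i :: j :: K) (j :: i :: K)) by apply perm_swap.
      assert (Hnd' : NoDup (j :: i :: K)) by now apply (Permutation_NoDup Hp1).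
      assert (Hincl' : incl (j :: i :: K) J)
        by (intros v Hv; apply Hincl; now apply (Permutation_in _ (Permutation_sym Hp1))).
      assert (HndK : NoDup (i :: K)) by now inversion Hnd'.
      assert (HinclK : incl (i :: K) J) by (intros v Hv; apply Hincl'; now right).
      assert (Hij : j <> i) by (inversion Hnd' as [|? ? H _]; intros ->; apply H; now left).
      assert (Haj : a <> j) by (intros ->; apply Ha, Hincl'; now left).
      assert (Hai : a <> i) by (intros ->; apply Ha, Hincl; now left).
      rewrite (HP _ _ _ Hp1).
      assert (Claim : forall d y, (y j = y i + Z.of_nat d)%Z -> (y a < c)%Z -> (y a < y i)%Z ->
         (forall k, In k K -> (y i <= y k)%Z) -> V (j :: i :: K) y = 0).
      { clear y Hc Hi Hmin. induction d as [|d IHd]; intros y Hd Hc Hi Hmin.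
        - apply (HS _ i j); auto; [now right; left | now left | lia].
        (* [V (i :: K)] vanishes by the outer induction, and the term with [y j] lowered by the
           inner one; what remains of the recursion is a two-term relation in [y a]. *)
        - assert (Hstep : forall y', (forall v, v <> a -> y' v = y v) -> (y' a <= y a)%Z ->
            RtoC p * V (j :: i :: K) y' = V (j :: i :: K) (dec a y')).
          { intros y' Hy' Hya.
            assert (Ei : y' i = y i) by auto. assert (Ej : y' j = y j) by auto.
            assert (Hmin' : forall k, In k K -> (y' i <= y' k)%Z).
            { intros k Hk. rewrite Ei, Hy'; [auto|]. intros ->. apply Ha, HinclK; now right. }
            pose proof (HRec j (i :: K) y' Hnd' Hincl') as E.
            rewrite (IH HndK HinclK y') in E by (auto; lia).
            rewrite (IHd (dec a (dec j y'))) in E.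
            - transitivity (RtoC p * V (j :: i :: K) y' - V (j :: i :: K) (dec a y') + RtoC (1 - p) * 0
                 + V (j :: i :: K) (dec a y')); [ring|]. rewrite E. ring.
            - rewrite (dec_other a), dec_same, (dec_other a), (dec_other j) by auto. lia.
            - rewrite dec_same, dec_other by auto. lia.
            - rewrite dec_same, (dec_other j), (dec_other a), (dec_other j) by auto. lia.
            - intros k Hk.
              assert (k <> a) by (intros ->; apply Ha, HinclK; now right).
              assert (k <> j) by (intros ->; inversion Hnd' as [|? ? H1 _]; apply H1; now right).
              rewrite !(dec_other a), !(dec_other j) by auto. auto. }
          destruct (HZ (j :: i :: K) y Hnd' Hincl') as (B & HBz).
          (* The two-term relation is followed upwards from the far left, where the array vanishes;
             each step divides by p. *)
          assert (Down : forall n y', (forall v, v <> a -> y' v = y v) -> (y' a <= y a)%Z ->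
             (y' a < B + Z.of_nat n)%Z -> V (j :: i :: K) y' = 0).
          { induction n as [|n IHn]; intros y' Hy' Hya Hn; [apply HBz; auto; lia|].
            pose proof (Hstep y' Hy' Hya) as E.
            rewrite (IHn (dec a y')) in E.
            - assert (Hp0 : RtoC p <> 0) by (intros H; apply RtoC_inj in H; lra).
              transitivity (/ RtoC p * (RtoC p * V (j :: i :: K) y')); [field; exact Hp0|]. rewrite E; ring.
            - intros v Hv. rewrite dec_other by assumption. auto.
            - rewrite dec_same. lia.
            - rewrite dec_same. lia. }
          apply (Down (Z.to_nat (y a - B + 1))); auto; lia. }
      apply (Claim (Z.to_nat (y j - y i))); auto.
      + specialize (Hmin j (or_introl eq_refl)). lia.
      + intros k Hk. apply Hmin. now right. }
  intros K y HK Hnd Hincl Hc Hlt.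
  destruct (argmin_exists y K HK) as (i & Hi & Hmin).
  assert (HPK : Permutation K (i :: rem1 i K)) by now apply rem1_perm.
  rewrite (HP _ _ _ HPK). apply Main; auto.
  - now apply (Permutation_NoDup HPK).
  - intros v Hv. apply Hincl. now apply (Permutation_in _ (Permutation_sym HPK)).
  - intros j Hj. apply in_rem1 in Hj as [Hj _]. auto.
Qed.

(** * The complex exponential *)

Lemma Cexp_add z w : Cexp (z + w) = Cexp z * Cexp w.
Proof.
  destruct z as [a b], w as [c d]. unfold Cexp; simpl.
  rewrite exp_plus, cos_plus, sin_plus. apply injective_projections; simpl; ring.
Qed.

Lemma Cexp_0 : Cexp 0 = 1.
Proof.
  unfold Cexp; simpl. rewrite exp_0, cos_0, sin_0. apply injective_projections; simpl; ring.
Qed.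

Lemma Cexp_RtoC (r : R) : Cexp (RtoC r) = RtoC (exp r).
Proof.
  unfold Cexp; simpl. rewrite cos_0, sin_0. apply injective_projections; simpl; ring.
Qed.

Lemma Cmod_Cexp_le z : (Cmod (Cexp z) <= exp (Cmod z))%R.
Proof.
  unfold Cexp. rewrite Cmod_mult, Cmod_R, Rabs_pos_eq by apply Rlt_le, exp_pos.
  replace (Cmod (cos (snd z), sin (snd z))) with 1%R.
  - rewrite Rmult_1_r.
    destruct (Rle_lt_or_eq_dec (fst z) (Cmod z)) as [H|H].
    + eapply Rle_trans; [apply Rle_abs|apply Cmod_fst].
    + apply Rlt_le, exp_increasing, H.
    + rewrite H; lra.
  - replace (cos (snd z), sin (snd z)) with (wave 1 (snd z)) by (unfold wave; now rewrite Rmult_1_l).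
    symmetry. apply Cmod_wave.
Qed.

Definition exp_part (M : nat) (z : C) : C := bsum (fun n => z ^ n / RtoC (INR (fact n))) (seq 0 (S M)).

Lemma RtoC_sum_n (f : nat -> R) M : RtoC (sum_n f M) = bsum (fun n => RtoC (f n)) (seq 0 (S M)).
Proof.
  induction M as [|M IH].
  - rewrite sum_O. cbn. ring.
  - rewrite sum_Sn, seq_S, bsum_app, <- IH, bsum_cons, bsum_nil. unfold plus; cbn [AbelianMonoid.plus]. simpl. rewrite RtoC_plus. ring.
Qed.

Lemma bsum_lim {T : Type} (u : T -> nat -> C) (v : T -> C) l :
  (forall a, In a l -> forall eps, (0 < eps)%R -> exists M0, forall M, (M0 <= M)%nat -> (Cmod (u a M - v a) <= eps)%R) ->
  forall eps, (0 < eps)%R ->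
  exists M0, forall M, (M0 <= M)%nat -> (Cmod (bsum (fun a => u a M) l - bsum v l) <= eps)%R.
Proof.
  induction l as [|a l IH]; intros H eps Heps.
  - exists 0%nat. intros M _. rewrite !bsum_nil. replace (RtoC 0 - RtoC 0) with (RtoC 0) by ring. rewrite Cmod_0. lra.
  - destruct (H a (or_introl eq_refl) (eps / 2)%R ltac:(lra)) as (M1 & HM1).
    destruct (IH (fun b Hb => H b (or_intror Hb)) (eps / 2)%R ltac:(lra)) as (M2 & HM2).
    exists (Nat.max M1 M2). intros M HM. rewrite !bsum_cons.
    replace (u a M + bsum (fun b => u b M) l - (v a + bsum v l)) with
      ((u a M - v a) + (bsum (fun b => u b M) l - bsum v l)) by ring.
    eapply Rle_trans; [apply Cmod_triangle|].
    specialize (HM1 M ltac:(lia)). specialize (HM2 M ltac:(lia)). lra.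
Qed.

Definition Cderiv (u : R -> C) (s : R) (d : C) : Prop :=
  is_derive (fun t => fst (u t)) s (fst d) /\ is_derive (fun t => snd (u t)) s (snd d).

Lemma Cderiv_ext u v s d : (forall t, u t = v t) -> Cderiv u s d -> Cderiv v s d.
Proof.
  intros H [H1 H2]. split.
  - apply (is_derive_ext (fun t => fst (u t))); [intros t; now rewrite H|assumption].
  - apply (is_derive_ext (fun t => snd (u t))); [intros t; now rewrite H|assumption].
Qed.

Lemma Cderiv_const c s : Cderiv (fun _ => c) s 0.
Proof. split; apply (is_derive_const (K := R_AbsRing) (V := R_NormedModule)). Qed.

Lemma Cderiv_plus u v s d e : Cderiv u s d -> Cderiv v s e -> Cderiv (fun t => u t + v t) s (d + e).
Proof.
  intros [H1 H2] [H3 H4]. split; simpl.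
  - apply (is_derive_plus (K := R_AbsRing) (V := R_NormedModule) (fun t => fst (u t)) (fun t => fst (v t))); assumption.
  - apply (is_derive_plus (K := R_AbsRing) (V := R_NormedModule) (fun t => snd (u t)) (fun t => snd (v t))); assumption.
Qed.

Lemma is_derive_mult_R (f g : R -> R) s d e : is_derive f s d -> is_derive g s e ->
  is_derive (fun t => f t * g t)%R s (d * g s + f s * e)%R.
Proof.
  intros H1 H2. apply (is_derive_mult (K := R_AbsRing) f g s d e); [assumption..|].
  intros n m. apply Rmult_comm.
Qed.

Lemma Cderiv_mult u v s d e : Cderiv u s d -> Cderiv v s e ->
  Cderiv (fun t => u t * v t) s (d * v s + u s * e).
Proof.
  intros [H1 H2] [H3 H4]. split; simpl.
  - replace (fst d * fst (v s) - snd d * snd (v s) + (fst (u s) * fst e - snd (u s) * snd e))%R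
      with (minus (fst d * fst (v s) + fst (u s) * fst e) (snd d * snd (v s) + snd (u s) * snd e))%R
      by (unfold minus, plus, opp; simpl; ring).
    apply (is_derive_minus (K := R_AbsRing) (V := R_NormedModule) (fun t => fst (u t) * fst (v t))%R (fun t => snd (u t) * snd (v t))%R);
      apply is_derive_mult_R; assumption.
  - replace (fst d * snd (v s) + snd d * fst (v s) + (fst (u s) * snd e + snd (u s) * fst e))%R
      with (plus (fst d * snd (v s) + fst (u s) * snd e) (snd d * fst (v s) + snd (u s) * fst e))%R
      by (unfold plus; simpl; ring).
    apply (is_derive_plus (K := R_AbsRing) (V := R_NormedModule) (fun t => fst (u t) * snd (v t))%R (fun t => snd (u t) * fst (v t))%R);
      apply is_derive_mult_R; assumption.
Qed.

Lemma Cderiv_exp z s : Cderiv (fun t => Cexp (RtoC t * z)) s (z * Cexp (RtoC s * z)).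
Proof.
  destruct z as [a b].
  apply (Cderiv_ext (fun t => (exp (t * a) * cos (t * b), exp (t * a) * sin (t * b))%R)).
  - intros t. unfold Cexp; simpl. apply injective_projections; simpl;
      replace (t * a - 0 * b)%R with (t * a)%R by ring; replace (t * b + 0 * a)%R with (t * b)%R by ring; ring.
  - unfold Cexp; split; simpl;
      replace (s * a - 0 * b)%R with (s * a)%R by ring; replace (s * b + 0 * a)%R with (s * b)%R by ring;
      auto_derive; trivial; ring.
Qed.

Lemma Cderiv_exp_part z s M : Cderiv (fun t => exp_part M (RtoC t * z)) s
  (match M with O => 0 | S K => z * exp_part K (RtoC s * z) end).
Proof.
  assert (Lin : Cderiv (fun t => RtoC t * z) s z).
  { split; simpl; auto_derive; trivial; ring. }
  assert (Pow : forall n, Cderiv (fun t => (RtoC t * z) ^ S n) s (RtoC (INR (S n)) * (z * (RtoC s * z) ^ n))).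
  { induction n as [|n IH].
    - apply (Cderiv_ext (fun t => RtoC t * z)); [intros; now rewrite Cpow_1_r|].
      replace (RtoC (INR 1) * (z * (RtoC s * z) ^ 0)) with z by (simpl; ring). exact Lin.
    - replace (RtoC (INR (S (S n))) * (z * (RtoC s * z) ^ S n)) with
        (z * (RtoC s * z) ^ S n + RtoC s * z * (RtoC (INR (S n)) * (z * (RtoC s * z) ^ n))).
      + apply (Cderiv_mult (fun t => RtoC t * z) (fun t => (RtoC t * z) ^ S n)); assumption.
      + rewrite (S_INR (S n)), RtoC_plus, !Cpow_S. ring. }
  induction M as [|M IH].
  - apply (Cderiv_ext (fun _ => 1)); [|apply Cderiv_const].
    intros t. unfold exp_part. cbn [seq]. rewrite bsum_cons, bsum_nil. simpl. field.
  - assert (ES : forall K w, exp_part (S K) w = exp_part K w + w ^ S K / RtoC (INR (fact (S K)))).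
    { intros K w. unfold exp_part. rewrite (seq_S (S K)), bsum_app, bsum_cons, bsum_nil, Nat.add_0_l. ring. }
    apply (Cderiv_ext (fun t => exp_part M (RtoC t * z) + / RtoC (INR (fact (S M))) * (RtoC t * z) ^ S M)).
    { intros t. rewrite ES. unfold Cdiv. ring. }
    assert (Hf : forall K, RtoC (INR (fact K)) <> 0) by (intros K H; apply RtoC_inj in H; now apply (INR_fact_neq_0 K)).
    assert (Q : Cderiv (fun t => / RtoC (INR (fact (S M))) * (RtoC t * z) ^ S M) s (z * ((RtoC s * z) ^ M / RtoC (INR (fact M))))).
    { replace (z * ((RtoC s * z) ^ M / RtoC (INR (fact M)))) with
        (0 * (RtoC s * z) ^ S M + / RtoC (INR (fact (S M))) * (RtoC (INR (S M)) * (z * (RtoC s * z) ^ M))).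
      - apply (Cderiv_mult (fun _ => / RtoC (INR (fact (S M)))) (fun t => (RtoC t * z) ^ S M)); [apply Cderiv_const|apply Pow].
      - assert (HS : RtoC (INR (S M)) <> 0) by (intros H; apply RtoC_inj in H; now apply (not_0_INR (S M))).
        rewrite fact_simpl, mult_INR, RtoC_mult. pose proof (Hf M). field. tauto. }
    destruct M as [|M].
    + replace (z * exp_part 0 (RtoC s * z)) with (0 + z * ((RtoC s * z) ^ 0 / RtoC (INR (fact 0)))).
      * apply Cderiv_plus; assumption.
      * unfold exp_part. cbn [seq]. rewrite bsum_cons, bsum_nil. ring.
    + rewrite ES, Cmult_plus_distr_l. apply Cderiv_plus; assumption.
Qed.

(** Along phi(t) = e^(-tz) T(tz), with T the Taylor polynomial, the derivative telescopes to a
    single term. This bounds e^(-z) T(z) - 1, and multiplication by e^z gives the claim. The factor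
    2 comes from bounding real and imaginary parts separately. *)
Lemma Cexp_part_bound z B M : (Cmod z <= B)%R ->
  (Cmod (Cexp z - exp_part (S M) z) <= 2 * (exp B * exp B * B * (B ^ S M / INR (fact (S M)))))%R.
Proof.
  intros HB. assert (HB0 : (0 <= B)%R) by (pose proof (Cmod_ge_0 z); lra).
  assert (Hf : (0 < INR (fact (S M)))%R) by apply INR_fact_lt_0.
  assert (Hf0 : RtoC (INR (fact (S M))) <> 0) by (intros H; apply RtoC_inj in H; lra).
  pose (phi := fun t : R => Cexp (RtoC t * - z) * exp_part (S M) (RtoC t * z)).
  pose (dphi := fun s : R => - z * Cexp (RtoC s * - z) * ((RtoC s * z) ^ S M / RtoC (INR (fact (S M))))).
  assert (HD : forall s, Cderiv phi s (dphi s)).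
  { intros s. replace (dphi s) with (- z * Cexp (RtoC s * - z) * exp_part (S M) (RtoC s * z) +
       Cexp (RtoC s * - z) * (z * exp_part M (RtoC s * z))).
    - apply (Cderiv_mult (fun t => Cexp (RtoC t * - z)) (fun t => exp_part (S M) (RtoC t * z)));
        [apply Cderiv_exp|apply (Cderiv_exp_part z s (S M))].
    - unfold dphi, exp_part. rewrite (seq_S (S M)), bsum_app, bsum_cons, bsum_nil, Nat.add_0_l. ring. }
  set (D := (exp B * B * (B ^ S M / INR (fact (S M))))%R).
  assert (HDb : forall s, (Rabs s <= 1)%R -> (Cmod (dphi s) <= D)%R).
  { intros s Hs. unfold dphi, D. rewrite !Cmod_mult, Cmod_opp, Cmod_div, Cmod_pow, Cmod_mult, !Cmod_R by assumption.
    rewrite (Rabs_pos_eq (INR _)) by lra.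
    assert (E1 : (Rabs s * Cmod z <= B)%R) by (pose proof (Cmod_ge_0 z); pose proof (Rabs_pos s); nra).
    assert (E2 : (Cmod (Cexp (RtoC s * - z)) <= exp B)%R).
    { eapply Rle_trans; [apply Cmod_Cexp_le|]. rewrite Cmod_mult, Cmod_R, Cmod_opp.
      destruct (Rle_lt_or_eq_dec _ _ E1) as [H|H]; [apply Rlt_le, exp_increasing, H|rewrite H; lra]. }
    assert (E3 : ((Rabs s * Cmod z) ^ S M <= B ^ S M)%R).
    { apply pow_incr. split; [apply Rmult_le_pos; [apply Rabs_pos|apply Cmod_ge_0]|assumption]. }
    assert (E4 : (0 <= (Rabs s * Cmod z) ^ S M)%R) by (apply pow_le, Rmult_le_pos; [apply Rabs_pos|apply Cmod_ge_0]).
    rewrite (Rmult_comm (exp B) B). apply Rmult_le_compat.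
    - apply Rmult_le_pos; apply Cmod_ge_0.
    - apply Rmult_le_pos; [assumption|apply Rlt_le, Rinv_0_lt_compat, Hf].
    - apply Rmult_le_compat; auto using Cmod_ge_0.
    - unfold Rdiv. apply Rmult_le_compat_r; [apply Rlt_le, Rinv_0_lt_compat, Hf|assumption]. }
  assert (HV : (Cmod (phi 1%R - phi 0%R) <= 2 * D)%R).
  { eapply Rle_trans; [apply Cmod_le_sum|].
    assert (V1 : (Rabs (fst (phi 1) - fst (phi 0)) <= D * Rabs (1 - 0))%R).
    { apply (bounded_variation (fun t => fst (phi t)) (fun t => fst (dphi t)) D 0 1). intros t Ht.
      rewrite !Rminus_0_r, Rabs_R1 in Ht. split; [apply HD|].
      eapply Rle_trans; [apply Cmod_fst|now apply HDb]. }
    assert (V2 : (Rabs (snd (phi 1) - snd (phi 0)) <= D * Rabs (1 - 0))%R).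
    { apply (bounded_variation (fun t => snd (phi t)) (fun t => snd (dphi t)) D 0 1). intros t Ht.
      rewrite !Rminus_0_r, Rabs_R1 in Ht. split; [apply HD|].
      eapply Rle_trans; [apply Cmod_snd|now apply HDb]. }
    rewrite Rminus_0_r, Rabs_R1 in V1, V2.
    change (fst (phi 1%R - phi 0%R)) with (fst (phi 1) - fst (phi 0))%R.
    change (snd (phi 1%R - phi 0%R)) with (snd (phi 1) - snd (phi 0))%R. lra. }
  assert (H0 : phi 0%R = 1).
  { unfold phi. rewrite !Cmult_0_l, Cexp_0. unfold exp_part. cbn [seq]. rewrite bsum_cons.
    rewrite bsum_0; [simpl; field|]. intros n Hn. change (1%nat :: seq 2 M) with (seq 1 (S M)) in Hn.
    apply in_seq in Hn. destruct n as [|n]; [lia|].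
    rewrite Cpow_S. unfold Cdiv. ring. }
  rewrite H0 in HV. unfold phi in HV. rewrite !Cmult_1_l in HV.
  replace (Cexp z - exp_part (S M) z) with (- (Cexp z * (Cexp (- z) * exp_part (S M) z - 1))).
  - rewrite Cmod_opp, Cmod_mult.
    assert (E : (Cmod (Cexp z) <= exp B)%R).
    { eapply Rle_trans; [apply Cmod_Cexp_le|].
      destruct (Rle_lt_or_eq_dec _ _ HB) as [H|H]; [apply Rlt_le, exp_increasing, H|rewrite H; lra]. }
    replace (2 * (exp B * exp B * B * (B ^ S M / INR (fact (S M)))))%R with (exp B * (2 * D))%R by (unfold D; ring).
    apply Rmult_le_compat; auto using Cmod_ge_0.
  - assert (E : Cexp z * Cexp (- z) = 1) by (rewrite <- Cexp_add, Cplus_opp_r; apply Cexp_0).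
    transitivity (Cexp z - Cexp z * Cexp (- z) * exp_part (S M) z); [ring|]. rewrite E. ring.
Qed.

Lemma exp_part_uniform B eps : (0 <= B)%R -> (0 < eps)%R ->
  exists M0, forall M, (M0 <= M)%nat -> forall z, (Cmod z <= B)%R -> (Cmod (Cexp z - exp_part M z) <= eps)%R.
Proof.
  intros HB He.
  pose proof (cv_speed_pow_fact B) as Hcv.
  (* The summand 1 keeps [K] positive when B = 0. *)
  set (K := (2 * (exp B * exp B * B) + 1)%R).
  assert (HK : (0 < K)%R).
  { unfold K. pose proof (exp_pos B). assert (0 <= exp B * exp B * B)%R by (apply Rmult_le_pos; [apply Rmult_le_pos; lra|lra]). lra. }
  destruct (Hcv (eps / K)%R) as (M0 & HM0); [now apply Rdiv_lt_0_compat|].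
  exists (S M0). intros M HM z Hz. destruct M as [|M]; [lia|].
  eapply Rle_trans; [apply (Cexp_part_bound z B M Hz)|].
  specialize (HM0 (S M) ltac:(lia)). unfold Rdist in HM0. rewrite Rminus_0_r in HM0.
  assert (P : (0 <= B ^ S M / INR (fact (S M)))%R).
  { apply Rmult_le_pos; [now apply pow_le|]. apply Rlt_le, Rinv_0_lt_compat, INR_fact_lt_0. }
  rewrite Rabs_pos_eq in HM0 by assumption.
  set (r := (B ^ S M / INR (fact (S M)))%R) in *.
  replace (2 * (exp B * exp B * B * r))%R with ((K - 1) * r)%R by (unfold K; ring).
  apply Rle_trans with (K * (eps / K))%R; [|apply Req_le; field; lra].
  apply Rle_trans with (K * r)%R; [lra|]. apply Rmult_le_compat_l; lra.
Qed.

(** * Reindexing the pairs of S and Λ *)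

(** Words without repetition, generated by the same recursion on the first letter as [amp]. *)
Fixpoint arrangements (r : nat) (U : list nat) : list (list nat) :=
  match r with
  | O => [[]]
  | S r' => flat_map (fun l => map (cons l) (arrangements r' (rem1 l U))) U
  end.

Definition minus_list (U L : list nat) : list nat := filter (fun v => negb (memb v L)) U.

Lemma memb_In a l : memb a l = true <-> In a l.
Proof.
  unfold memb. rewrite existsb_exists. split.
  - intros (b & Hb & E). apply Nat.eqb_eq in E. now subst.
  - intros H. exists a. split; [assumption|apply Nat.eqb_refl].
Qed.

Lemma memb_false a l : memb a l = false <-> ~ In a l.
Proof. rewrite <- memb_In. destruct (memb a l); split; congruence. Qed.

Lemma nodupb_NoDup l : nodupb l = true <-> NoDup l.
Proof.
  induction l as [|a l IH]; simpl; [split; [constructor|reflexivity]|].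
  rewrite Bool.andb_true_iff, Bool.negb_true_iff, memb_false, IH. split.
  - intros [H1 H2]. now constructor.
  - intros H. now inversion H.
Qed.

Lemma in_minus_list v U L : In v (minus_list U L) <-> In v U /\ ~ In v L.
Proof. unfold minus_list. rewrite filter_In, Bool.negb_true_iff, memb_false. reflexivity. Qed.

Lemma in_arrangements r : forall U L, NoDup U ->
  In L (arrangements r U) <-> length L = r /\ NoDup L /\ incl L U.
Proof.
  induction r as [|r IH]; intros U L HU; cbn [arrangements].
  - split.
    + intros [<-|[]]. repeat split; [constructor|intros v []].
    + intros (H & _). destruct L; [now left|discriminate].
  - rewrite in_flat_map. split.
    + intros (l & Hl & H). apply in_map_iff in H as (L' & <- & H).
      apply IH in H as (H1 & H2 & H3); [|now apply NoDup_rem1].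
      repeat split; [simpl; lia| |].
      * constructor; [|assumption]. intros H. apply H3, in_rem1 in H. tauto.
      * intros v [<-|Hv]; [assumption|]. apply H3, in_rem1 in Hv. tauto.
    + intros (H1 & H2 & H3). destruct L as [|l L]; [discriminate|]. inversion H2 as [|? ? Hl HL]; subst.
      exists l. split; [apply H3; now left|]. apply in_map. apply IH; [now apply NoDup_rem1|].
      repeat split; [simpl in H1; lia|assumption|]. intros v Hv. apply in_rem1. split; [apply H3; now right|].
      intros ->; contradiction.
Qed.

Lemma NoDup_flat_map_intro {A B : Type} (f : A -> list B) l : NoDup l -> (forall a, In a l -> NoDup (f a)) ->
  (forall a b c, In a l -> In b l -> In c (f a) -> In c (f b) -> a = b) -> NoDup (flat_map f l).
Proof.
  induction 1 as [|a l Ha Hl IH]; intros H1 H2; cbn [flat_map]; [constructor|].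
  apply NoDup_app.
  - apply H1; now left.
  - apply IH; [intros; apply H1; now right|]. intros b c d Hb Hc. apply H2; now right.
  - intros c Hc H. apply in_flat_map in H as (b & Hb & Hcb).
    assert (a = b) by (apply (H2 a b c); auto; [now left|now right]). subst; contradiction.
Qed.

Lemma NoDup_words {A : Type} (pool : list A) r : NoDup pool -> NoDup (words pool r).
Proof.
  intros Hp. induction r as [|r IH]; cbn [words]; [repeat constructor; intros []|].
  apply NoDup_flat_map_intro; [assumption| |].
  - intros a _. apply FinFun.Injective_map_NoDup; [intros ? ? ?; congruence|assumption].
  - intros a b c _ _ Ha Hb. apply in_map_iff in Ha as (u & <- & _), Hb as (v & E & _). congruence.
Qed.

Lemma in_words {A : Type} (pool : list A) r w : In w (words pool r) <-> length w = r /\ incl w pool.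
Proof.
  revert w. induction r as [|r IH]; intros w; cbn [words].
  - split; [intros [<-|[]]; split; [reflexivity|intros v []]|]. intros [H _]. destruct w; [now left|discriminate].
  - rewrite in_flat_map. split.
    + intros (a & Ha & H). apply in_map_iff in H as (u & <- & Hu). apply IH in Hu as [H1 H2].
      split; [simpl; lia|]. intros v [<-|Hv]; auto.
    + intros [H1 H2]. destruct w as [|a w]; [discriminate|]. exists a. split; [apply H2; now left|].
      apply in_map, IH. split; [simpl in H1; lia|intros v Hv; apply H2; now right].
Qed.

Lemma NoDup_arrangements r : forall U, NoDup U -> NoDup (arrangements r U).
Proof.
  induction r as [|r IH]; intros U HU; cbn [arrangements]; [repeat constructor; intros []|].
  apply NoDup_flat_map_intro; [assumption| |].
  - intros l _. apply FinFun.Injective_map_NoDup; [intros ? ? ?; congruence|]. now apply IH, NoDup_rem1.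
  - intros a b c _ _ Ha Hb. apply in_map_iff in Ha as (u & <- & _), Hb as (v & E & _). congruence.
Qed.

Lemma subsets_incl I U : In U (subsets I) -> incl U I.
Proof.
  revert U. induction I as [|a I IH]; intros U; simpl.
  - intros [<-|[]] v [].
  - rewrite in_app_iff, in_map_iff. intros [(V & <- & HV)|HU].
    + intros v [<-|Hv]; [now left|]. right. now apply (IH V).
    + intros v Hv. right. now apply (IH U).
Qed.

Lemma subsets_NoDup I U : NoDup I -> In U (subsets I) -> NoDup U.
Proof.
  intros HI. revert U. induction HI as [|a I Ha HI IH]; intros U; simpl.
  - intros [<-|[]]. constructor.
  - rewrite in_app_iff, in_map_iff. intros [(V & <- & HV)|HU]; [|now apply IH].
    constructor; [|now apply IH]. intros H. apply Ha. now apply (subsets_incl I V).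
Qed.

Lemma filter_in_subsets f I : In (filter f I) (subsets I).
Proof.
  induction I as [|a I IH]; cbn [filter subsets]; [now left|].
  apply in_or_app. destruct (f a); [left; now apply in_map|now right].
Qed.

(** A listed subset keeps the order of [I] and is therefore recovered from membership alone. This
    turns equality of sets into equality of lists, which [pairs_reindex] relies on. *)
Lemma subsets_filter I U : NoDup I -> In U (subsets I) -> U = filter (fun v => memb v U) I.
Proof.
  intros HI. revert U. induction HI as [|a I Ha HI IH]; intros U; cbn [subsets].
  - intros [<-|[]]. reflexivity.
  - rewrite in_app_iff, in_map_iff. intros [(V & <- & HV)|HU]; cbn [filter].
    + replace (memb a (a :: V)) with true by (symmetry; apply memb_In; now left). f_equal.
      rewrite (IH V HV) at 1. apply filter_ext_in. intros v Hv.
      destruct (memb v (a :: V)) eqn:E.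
      * apply memb_In in E as [->|E]; [contradiction|now apply memb_In].
      * apply memb_false in E. apply memb_false. intros H; apply E; now right.
    + replace (memb a U) with false; [now apply IH|]. symmetry. apply memb_false. intros H. apply Ha. now apply (subsets_incl I U).
Qed.

Lemma NoDup_subsets I : NoDup I -> NoDup (subsets I).
Proof.
  induction 1 as [|a I Ha HI IH]; cbn [subsets]; [repeat constructor; intros []|].
  apply NoDup_app; [apply FinFun.Injective_map_NoDup; [intros ? ? ?; congruence|assumption]|assumption|].
  intros U HU HU'. apply in_map_iff in HU as (V & <- & HV).
  pose proof (subsets_filter I (a :: V) HI HU') as E.
  assert (H : In a (filter (fun v => memb v (a :: V)) I)) by (rewrite <- E; now left).
  apply filter_In in H. tauto.
Qed.

(** A pair (S, Lambda) is encoded by its union U together with Lambda. Both enumerations are free of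
    repetitions and have the same elements, so they are permutations of each other. *)
Lemma pairs_reindex N m (F : list nat -> list nat -> C) :
  bsum (fun S => bsum (fun L => F S L) (Lambdas N m S)) (subsets (iota1 N)) =
  bsum (fun U => bsum (fun L => F (minus_list U L) L) (arrangements (m - 1) U)) (subsets (iota1 N)).
Proof.
  assert (HI : NoDup (iota1 N)) by apply seq_NoDup.
  assert (HsubI : forall U, In U (subsets (iota1 N)) -> NoDup U /\ incl U (iota1 N))
    by (intros U HU; split; [exact (subsets_NoDup _ _ HI HU)|exact (subsets_incl _ _ HU)]).
  pose (P1 := flat_map (fun S => map (fun L => (S, L)) (Lambdas N m S)) (subsets (iota1 N))).
  pose (P2 := flat_map (fun U => map (fun L => (minus_list U L, L)) (arrangements (m - 1) U)) (subsets (iota1 N))).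
  assert (HP : Permutation P1 P2).
  { apply NoDup_Permutation.
    - apply NoDup_flat_map_intro; [now apply NoDup_subsets| |].
      + intros S _. apply FinFun.Injective_map_NoDup; [intros ? ? ?; congruence|]. apply NoDup_filter. now apply NoDup_words.
      + intros S S' c _ _ H H'. apply in_map_iff in H as (L & <- & _), H' as (L' & E & _). congruence.
    - apply NoDup_flat_map_intro; [now apply NoDup_subsets| |].
      + intros U HU. apply FinFun.Injective_map_NoDup; [intros ? ? ?; congruence|]. now apply NoDup_arrangements, HsubI.
      + intros U U' c HU HU' H H'. apply in_map_iff in H as (L & <- & HL), H' as (L' & E & HL').
        injection E as E1 E2. subst L'.
        apply in_arrangements in HL as (_ & _ & HL); [|now apply HsubI].
        apply in_arrangements in HL' as (_ & _ & HL'); [|now apply HsubI].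
        rewrite (subsets_filter _ _ HI HU), (subsets_filter _ _ HI HU'). apply filter_ext. intros v.
        assert (Hv : In v U <-> In v U').
        { pose proof (in_minus_list v U L) as M1. pose proof (in_minus_list v U' L) as M2. rewrite E1 in M2.
          destruct (in_dec Nat.eq_dec v L) as [H|H]; [split; auto|tauto]. }
        destruct (memb v U) eqn:E3, (memb v U') eqn:E4; try reflexivity.
        * apply memb_In, Hv, memb_In in E3. congruence.
        * apply memb_In, Hv, memb_In in E4. congruence.
    - intros [S L]. unfold P1, P2. rewrite !in_flat_map. split.
      + intros (S' & HS & H). apply in_map_iff in H as (L' & E & HL). injection E as -> ->.
        apply filter_In in HL as [HL Hc]. apply in_words in HL as [Hlen HL].
        apply Bool.andb_true_iff in Hc as [Hnd Hdis]. apply nodupb_NoDup in Hnd.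
        rewrite forallb_forall in Hdis.
        assert (Hdis' : forall v, In v L -> ~ In v S).
        { intros v Hv. specialize (Hdis v Hv). now apply Bool.negb_true_iff, memb_false in Hdis. }
        exists (filter (fun v => memb v (S ++ L)) (iota1 N)). split; [apply filter_in_subsets|].
        apply in_map_iff. exists L. split.
        * f_equal. unfold minus_list. rewrite filter_filter_and.
          etransitivity; [|symmetry; exact (subsets_filter _ _ HI HS)]. apply filter_ext. intros v.
          destruct (memb v S) eqn:E1.
          -- apply memb_In in E1. rewrite Bool.andb_true_iff, Bool.negb_true_iff. split.
             ++ apply memb_false. intros H. now apply (Hdis' v).
             ++ apply memb_In, in_or_app. now left.
          -- apply memb_false in E1. apply Bool.andb_false_iff.
             destruct (memb v L) eqn:E2; [now left|right]. apply memb_false in E2. apply memb_false.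
             rewrite in_app_iff. tauto.
        * apply in_arrangements; [now apply NoDup_filter|]. repeat split; auto.
          intros v Hv. apply filter_In. split; [now apply HL|]. apply memb_In, in_or_app. now right.
      + intros (U & HU & H). apply in_map_iff in H as (L' & E & HL). injection E as E ->. subst S.
        destruct (HsubI U HU) as [HndU HUI].
        apply in_arrangements in HL as (Hlen & Hnd & HL); [|assumption].
        exists (minus_list U L). split.
        * rewrite (subsets_filter _ _ HI HU). unfold minus_list. rewrite filter_filter_and. apply filter_in_subsets.
        * apply in_map. apply filter_In. split.
          -- apply in_words. split; [assumption|]. intros v Hv. auto.
          -- apply Bool.andb_true_iff. split; [now apply nodupb_NoDup|]. apply forallb_forall. intros v Hv.
             apply Bool.negb_true_iff, memb_false. rewrite in_minus_list. tauto. }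
  transitivity (bsum (fun SL => F (fst SL) (snd SL)) P1).
  - unfold P1. rewrite bsum_flat_map. apply bsum_ext. intros S _. now rewrite bsum_map.
  - rewrite (bsum_perm _ _ _ HP). unfold P2. rewrite bsum_flat_map. apply bsum_ext. intros U _. now rewrite bsum_map.
Qed.

(** * Signs and exponents of the individual terms *)

Fixpoint front (p : R) (xs : list Z) (L S : list nat) (xi : nat -> C) : C :=
  match xs, L with
  | x :: xs', l :: L' => bprod (fun v => sg l v * fA p (xi l) (xi v)) (L' ++ S) * Cpowz (xi l) x * front p xs' L' S xi
  | _, _ => 1
  end.

Lemma minus_list_perm U L : NoDup U -> NoDup L -> incl L U -> Permutation U (L ++ minus_list U L).
Proof.
  intros HU HL Hincl. apply NoDup_Permutation; [assumption| |].
  - apply NoDup_app; [assumption|now apply NoDup_filter|]. intros v Hv. rewrite in_minus_list. tauto.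
  - intros v. rewrite in_app_iff, in_minus_list. destruct (in_dec Nat.eq_dec v L); split; [auto|intros [H|H]; auto; tauto|tauto|tauto].
Qed.

Lemma minus_list_cons U l L : minus_list U (l :: L) = minus_list (rem1 l U) L.
Proof.
  unfold minus_list. induction U as [|u U IH]; [reflexivity|]. unfold rem1 in *. cbn [filter remove].
  destruct (Nat.eq_dec l u) as [->|Hne].
  - replace (memb u (u :: L)) with true by (symmetry; apply memb_In; now left). exact IH.
  - cbn [filter]. replace (memb u (l :: L)) with (memb u L); [destruct (memb u L); cbn [negb]; now rewrite IH|].
    unfold memb; simpl. destruct (Nat.eqb_spec u l); [congruence|reflexivity].
Qed.

(** Unfolding the recursion of [amp] down to complete words brings back the sum over Lambda, with S
    as the complement in U. *)
Lemma amp_expand p xs z : forall U xi, NoDup U ->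
  amp p sg xs z U xi =
  bsum (fun L => front p xs L (minus_list U L) xi * amp0 sg z (minus_list U L) xi) (arrangements (length xs) U).
Proof.
  induction xs as [|x xs IH]; intros U xi HU; cbn [amp length arrangements].
  - rewrite bsum_cons, bsum_nil. cbn [front]. replace (minus_list U []) with U; [ring|].
    unfold minus_list. clear HU. induction U as [|u U IHU]; [reflexivity|]. cbn [filter memb existsb negb]. now f_equal.
  - rewrite bsum_flat_map. apply bsum_ext. intros l Hl. rewrite IH by now apply NoDup_rem1.
    rewrite bsum_map, <- bsum_scal. apply bsum_ext. intros L HL.
    apply in_arrangements in HL as (H1 & H2 & H3); [|now apply NoDup_rem1].
    cbn [front]. rewrite minus_list_cons.
    rewrite (bprod_perm _ _ _ (minus_list_perm (rem1 l U) L (NoDup_rem1 l U HU) H2 H3)). ring.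
Qed.

Lemma bprod_filter {T : Type} (g : T -> C) (P : T -> bool) l :
  bprod g (filter P l) = bprod (fun a => if P a then g a else 1) l.
Proof.
  induction l as [|a l IH]; [reflexivity|]. cbn [filter]. rewrite bprod_cons, <- IH.
  destruct (P a); [now rewrite bprod_cons|ring].
Qed.

(** In the theorem i < j compares integers, while [U] may be listed in any order. Each unordered
    pair is met once on either side, oriented by the comparison. *)
Lemma bprod_ordered_pairs (g : nat -> nat -> C) U : NoDup U ->
  bprod (fun i => bprod (g i) (filter (fun j => Nat.ltb i j) U)) U =
  pprod (fun u v => if Nat.ltb u v then g u v else g v u) U.
Proof.
  induction 1 as [|a U Ha HU IH]; [reflexivity|].
  rewrite pprod_cons, bprod_cons, <- IH. cbn [filter]. rewrite Nat.ltb_irrefl.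
  rewrite (bprod_ext (fun i => bprod _ _) (fun i => (if Nat.ltb i a then g i a else 1) *
     bprod (g i) (filter (fun j => Nat.ltb i j) U))).
  2: { intros i _. destruct (Nat.ltb i a); [now rewrite bprod_cons|ring]. }
  rewrite bprod_mult, bprod_filter, Cmult_assoc. f_equal. rewrite <- bprod_mult.
  apply bprod_ext. intros v Hv.
  assert (v <> a) by (intros ->; contradiction).
  destruct (Nat.ltb_spec a v), (Nat.ltb_spec v a); try lia; ring.
Qed.

Lemma RtoC_m1 : RtoC (-1) = - (1).
Proof. now rewrite <- RtoC_opp. Qed.

Lemma RtoC_pow_countb {T : Type} (P : T -> bool) l :
  RtoC ((-1) ^ countb P l) = bprod (fun a => if P a then - (1) else 1) l.
Proof.
  induction l as [|a l IH]; [reflexivity|]. unfold countb in *. cbn [filter].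
  rewrite bprod_cons, <- IH. destruct (P a); [|ring]. cbn [length pow].
  now rewrite RtoC_mult, RtoC_m1.
Qed.

Lemma RtoC_sgnL L : NoDup L -> RtoC (sgnL L) = pprod sg L.
Proof.
  intros HL. unfold sgnL, inversions. rewrite RtoC_pow_countb.
  apply (pprod_ext_NoDup (fun u v => if Nat.ltb v u then - (1) else 1) sg L HL).
  intros u v _ _ Huv. unfold sg. destruct (Nat.ltb_spec v u), (Nat.ltb_spec u v); try lia; reflexivity.
Qed.

(** As [s] is not in [L], the exponent is minus the number of l > s in [L], and these are the l for
    which [sg l s] is -1. *)
Lemma sign_row s L : ~ In s L ->
  RtoC (powerRZ (-1) (Z.of_nat (countb (fun j => Nat.leb j s) L) - Z.of_nat (length L))) =
  bprod (fun l => sg l s) L.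
Proof.
  induction L as [|l L IH]; intros Hs; [reflexivity|].
  rewrite bprod_cons, <- IH by (intros H; apply Hs; now right). unfold countb. cbn [filter length].
  assert (l <> s) by (intros ->; apply Hs; now left). unfold sg.
  destruct (Nat.leb_spec l s), (Nat.ltb_spec l s); try lia.
  - cbn [length]. rewrite !Nat2Z.inj_succ, Z.sub_succ_l, Z.sub_succ_r, Z.succ_pred. ring.
  - rewrite Nat2Z.inj_succ, Z.sub_succ_r, <- Z.sub_1_r.
    replace (Z.of_nat (length (filter (fun j => Nat.leb j s) L)) - Z.of_nat (length L) - 1)%Z with
      ((Z.of_nat (length (filter (fun j => Nat.leb j s) L)) - Z.of_nat (length L)) + (-1))%Z by lia.
    rewrite powerRZ_add by lra. rewrite RtoC_mult. 
    replace (powerRZ (-1) (-1)) with (-1)%R by (simpl; field). rewrite RtoC_m1. ring.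
Qed.

Lemma sign_block S L : (forall v, In v L -> ~ In v S) ->
  RtoC (powerRZ (-1) (Z.of_nat (sigmaUV S L) - Z.of_nat (length L * length S))) =
  bprod (fun l => bprod (sg l) S) L.
Proof.
  intros Hd. rewrite bprod_exchange. induction S as [|s S IH].
  - cbn [length]. rewrite Nat.mul_0_r. reflexivity.
  - rewrite bprod_cons, <- IH by (intros v Hv H; apply (Hd v Hv); now right).
    rewrite <- sign_row by (intros H; apply (Hd s H); now left).
    rewrite <- RtoC_mult, <- powerRZ_add by lra. do 2 f_equal. unfold sigmaUV, sumn.
    cbn [map fold_right length]. rewrite Nat.mul_succ_r, !Nat2Z.inj_add. lia.
Qed.

Lemma front_eq p xi S : forall xs L, length xs = length L ->
  front p xs L S xi = bprod (fun l => bprod (sg l) S) L * pprod sg L *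
    (bprod (fun l => bprod (fun v => fA p (xi l) (xi v)) S) L * pprod (fun u v => fA p (xi u) (xi v)) L) *
    bprod (fun ab => Cpowz (xi (fst ab)) (snd ab)) (combine L xs).
Proof.
  induction xs as [|x xs IH]; intros [|l L] H; try discriminate.
  - cbn [front combine]. rewrite !bprod_nil, !pprod_nil. ring.
  - cbn [front combine]. rewrite IH by (simpl in H; lia).
    rewrite !bprod_cons, !pprod_cons, bprod_app, !bprod_mult. cbn [fst snd]. ring.
Qed.

Lemma powers_combine (x : nat -> Z) (xi : nat -> C) L : forall s,
  bprod (fun a => Cpowz (xi (nth (a - s) L 0%nat)) (x a)) (seq s (length L)) =
  bprod (fun ab => Cpowz (xi (fst ab)) (snd ab)) (combine L (map x (seq s (length L)))).
Proof.
  induction L as [|l L IH]; intros s; [reflexivity|]. cbn [length seq map combine].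
  rewrite !bprod_cons, <- IH, Nat.sub_diag. f_equal. apply bprod_ext. intros a Ha. apply in_seq in Ha.
  replace (a - s)%nat with (S (a - S s)) by lia. reflexivity.
Qed.

(** The sums of ell_i - i and of ell_i - s differ by 0 + 1 + ... + (n - 1), with n the length. The
    equation is doubled to avoid a division, and s is general for the induction. *)
Lemma sum_ell_shift L : forall s : nat,
  (2 * sumZ (map (fun i => Z.of_nat (nth (i - s) L 0%nat) - Z.of_nat i) (seq s (length L)))
   + Z.of_nat (length L) * (Z.of_nat (length L) - 1) = 2 * sumZ (map (fun l => Z.of_nat l - Z.of_nat s) L))%Z.
Proof.
  induction L as [|l L IH]; intros s; [reflexivity|]. cbn [length seq map sumZ fold_right].
  rewrite Nat.sub_diag. cbn [nth].
  rewrite (map_ext_in _ (fun i => (Z.of_nat (nth (i - S s) L 0%nat) - Z.of_nat i)%Z)).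
  2: { intros a Ha. apply in_seq in Ha. replace (a - s)%nat with (S (a - S s)) by lia. reflexivity. }
  specialize (IH (S s)). fold (sumZ (map (fun l => (Z.of_nat l - Z.of_nat s)%Z) L)).
  change (fold_right Z.add 0%Z) with sumZ.
  assert (E : (sumZ (map (fun l => Z.of_nat l - Z.of_nat s) L) =
     sumZ (map (fun l => Z.of_nat l - Z.of_nat (S s)) L) + Z.of_nat (length L))%Z).
  { clear. induction L as [|l L IH]; [reflexivity|]. cbn [map sumZ fold_right length].
    change (fold_right Z.add 0%Z) with sumZ. rewrite IH. lia. }
  rewrite E. nia.
Qed.

Lemma countb_le_seq s n : forall a, (s <= a)%nat -> (a < s + n)%nat -> countb (fun j => Nat.leb j a) (seq s n) = S (a - s).
Proof.
  unfold countb. revert s. induction n as [|n IH]; intros s a H1 H2; [lia|]. cbn [seq filter].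
  destruct (Nat.leb_spec s a); [|lia]. cbn [length]. f_equal.
  destruct (Nat.eq_dec s a) as [->|Hne].
  - rewrite Nat.sub_diag. clear IH. replace (filter _ _) with (@nil nat); [reflexivity|]. symmetry.
    assert (Hg : forall k b, (a < b)%nat -> filter (fun j => Nat.leb j a) (seq b k) = []).
    { induction k as [|k IHk]; intros b Hb; [reflexivity|]. cbn [seq filter].
      destruct (Nat.leb_spec b a); [lia|]. apply IHk. lia. }
    apply Hg. lia.
  - rewrite IH by lia. lia.
Qed.

(** Among 1, ..., N exactly s numbers are at most s. *)
Lemma sigmaU_sum N S : incl S (iota1 N) -> Z.of_nat (sigmaU N S) = sumZ (map Z.of_nat S).
Proof.
  unfold sigmaU, sigmaUV, sumn. induction S as [|s S IH]; intros H; [reflexivity|].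
  cbn [map fold_right sumZ]. change (fold_right Z.add 0%Z) with sumZ.
  rewrite Nat2Z.inj_add, IH by (intros v Hv; apply H; now right).
  assert (Hs : In s (iota1 N)) by (apply H; now left). unfold iota1 in *. apply in_seq in Hs.
  rewrite countb_le_seq by lia. lia.
Qed.

(** * Bounds on weighted degrees *)

Definition wt (Vs : list nat) (w e : nat -> Z) : Z := sumZ (map (fun i => (w i * e i)%Z) Vs).

Lemma sumZ_map_add {T : Type} (f g : T -> Z) l :
  sumZ (map (fun i => f i + g i)%Z l) = (sumZ (map f l) + sumZ (map g l))%Z.
Proof. induction l as [|a l IH]; simpl; [reflexivity|]. unfold sumZ in *; simpl. lia. Qed.

Lemma wt_eadd Vs w a b : wt Vs w (eadd a b) = (wt Vs w a + wt Vs w b)%Z.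
Proof.
  unfold wt. rewrite <- sumZ_map_add. f_equal. apply map_ext. intros i. unfold eadd. ring.
Qed.

Lemma wt_0 Vs w : wt Vs w (fun _ => 0%Z) = 0%Z.
Proof. unfold wt. induction Vs as [|a l IH]; simpl; [reflexivity|]. unfold sumZ in *; simpl. lia. Qed.

Lemma wt_dl Vs w i z : NoDup Vs -> In i Vs -> wt Vs w (dl i z) = (w i * z)%Z.
Proof.
  unfold wt. induction 1 as [|a l Ha Hl IH]; intros Hi; [destruct Hi|]. cbn [map sumZ fold_right].
  change (fold_right Z.add 0%Z) with sumZ. destruct Hi as [->|Hi].
  - replace (map _ l) with (map (fun j => (w j * 0)%Z) l).
    + change (sumZ (map (fun j => (w j * 0)%Z) l)) with (wt l w (fun _ => 0%Z)). rewrite wt_0.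
      unfold dl. rewrite Nat.eqb_refl. lia.
    + apply map_ext_in. intros j Hj. unfold dl.
      destruct (Nat.eqb_spec j i); [subst; contradiction|reflexivity].
  - rewrite IH by assumption. unfold dl at 1. destruct (Nat.eqb_spec a i); [subst; contradiction|lia].
Qed.

Section Weights.
Variables (R0 : R) (Vs : list nat) (p : R).
Hypothesis Hp : (0 <= p < 1)%R.
Hypothesis HRp : (4 / (1 - p) < R0)%R.
Hypothesis HVs : NoDup Vs.

Notation onT := (onT R0).
Notation LC := (LC R0 Vs).

(** The exponent vector 0 has weight 0, so a negative bound forces the mean to vanish ([EE_neg]). A
    weight -1 at an index bounds the exponent there from below. *)
Definition LCw (w : nat -> Z) (d : Z) : ((nat -> C) -> C) -> Prop :=
  LC (fun e => (wt Vs w e <= d)%Z).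

Lemma qR0_bound : (4 < (1 - p) * R0)%R.
Proof.
  apply (Rmult_lt_compat_l (1 - p)) in HRp; [|lra].
  replace ((1 - p) * (4 / (1 - p)))%R with 4%R in HRp by (field; lra). exact HRp.
Qed.

Lemma R0_gt_4 : (4 < R0)%R.
Proof. pose proof qR0_bound. nra. Qed.

Let HR : (0 < R0)%R.
Proof. pose proof R0_gt_4; lra. Qed.

Lemma RtoC_q_neq_0 : RtoC (1 - p) <> 0.
Proof. intros H. apply RtoC_inj in H. lra. Qed.

(** The relative correction in f(xi_i, xi_j) = q xi_i xi_j (1 - [fgap]). On the torus its two
    summands are at most 1/4 each, which is the origin of the 4 in the bound on the radius. *)
Definition fgap (xi : nat -> C) (i j : nat) : C :=
  RtoC (/ (1 - p)) * / xi j + RtoC (- p / (1 - p)) * (/ xi i * / xi j).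

Lemma fA_fgap xi i j : onT xi -> fA p (xi i) (xi j) = RtoC (1 - p) * xi i * xi j * (1 - fgap xi i j).
Proof.
  intros H. pose proof (onT_neq_0 R0 HR xi i H). pose proof (onT_neq_0 R0 HR xi j H).
  pose proof RtoC_q_neq_0 as Hq. unfold fA, fgap, Rdiv.
  rewrite RtoC_mult, RtoC_opp, RtoC_inv by lra. set (q := RtoC (1 - p)) in *. field. tauto.
Qed.

Lemma Cmod_fgap xi i j : onT xi -> (Cmod (fgap xi i j) <= / 2)%R.
Proof.
  intros H. pose proof qR0_bound as Hq. pose proof R0_gt_4 as H4. unfold fgap.
  eapply Rle_trans; [apply Cmod_triangle|].
  rewrite !Cmod_mult, !Cmod_inv by (now apply (onT_neq_0 R0 HR)). rewrite !Cmod_R, !H.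
  rewrite Rabs_pos_eq by (apply Rlt_le, Rinv_0_lt_compat; lra).
  unfold Rdiv. rewrite Rabs_mult, Rabs_Ropp, (Rabs_pos_eq p), (Rabs_pos_eq (/ (1 - p)))
    by (try (apply Rlt_le, Rinv_0_lt_compat); lra).
  assert (E : (/ (1 - p) * / R0 <= / 4)%R).
  { rewrite <- Rinv_mult. apply Rinv_le_contravar; lra. }
  assert (E2 : (0 < / (1 - p) * / R0)%R).
  { rewrite <- Rinv_mult. apply Rinv_0_lt_compat; lra. }
  assert (E3 : (/ R0 <= / 4)%R) by (apply Rinv_le_contravar; lra).
  assert (E4 : (0 < / R0)%R) by (apply Rinv_0_lt_compat; lra).
  replace (p * / (1 - p) * (/ R0 * / R0))%R with ((p * / R0) * (/ (1 - p) * / R0))%R by ring.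
  assert (p * / R0 <= 1)%R by nra. nra.
Qed.

Lemma one_minus_fgap_neq_0 xi i j : onT xi -> 1 - fgap xi i j <> 0.
Proof.
  intros H E. pose proof (Cmod_fgap xi i j H) as B.
  replace (fgap xi i j) with (1 - (1 - fgap xi i j)) in B by ring. rewrite E in B.
  replace (1 - 0) with (RtoC 1) in B by ring. rewrite Cmod_1 in B. lra.
Qed.

Lemma fA_neq_0 xi i j : onT xi -> fA p (xi i) (xi j) <> 0.
Proof.
  intros H. rewrite fA_fgap by assumption.
  repeat apply Cmult_neq_0; [apply RtoC_q_neq_0 | now apply (onT_neq_0 R0 HR) | now apply (onT_neq_0 R0 HR)|].
  now apply one_minus_fgap_neq_0.
Qed.

Lemma fo_neq_0 xi i j : onT xi -> fo p xi i j <> 0.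
Proof. intros H. unfold fo. destruct (Nat.ltb i j); now apply fA_neq_0. Qed.

Lemma one_minus_neq_0 xi i : onT xi -> 1 - xi i <> 0.
Proof.
  intros H E. pose proof R0_gt_4. specialize (H i).
  replace (xi i) with (1 - (1 - xi i)) in H by ring. rewrite E in H.
  replace (1 - 0) with (RtoC 1) in H by ring. rewrite Cmod_1 in H. lra.
Qed.

(** The expansion contains no power of 1/xi_i that is not accompanied by one of 1/xi_j. This
    asymmetry permits weights that are negative at i, as long as the weights of i and j have
    non-negative sum. *)
Lemma LC_fnorm (A : (nat -> Z) -> Prop) i j : In i Vs -> In j Vs ->
  A (fun _ => 0%Z) -> (forall a b, A a -> A b -> A (eadd a b)) ->
  A (dl j (-1)) -> A (eadd (dl i (-1)) (dl j (-1))) ->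
  LC A (fun xi => xi i * xi j / fA p (xi i) (xi j)).
Proof.
  intros Hi Hj H0 HA Hj1 Hij1.
  apply (LC_ext _ _ _ (fun xi => RtoC (/ (1 - p)) * / (1 - fgap xi i j))).
  { intros xi H. rewrite fA_fgap by assumption. rewrite RtoC_inv by lra.
    pose proof (onT_neq_0 R0 HR xi i H). pose proof (onT_neq_0 R0 HR xi j H).
    pose proof RtoC_q_neq_0. pose proof (one_minus_fgap_neq_0 xi i j H).
    set (u := 1 - fgap xi i j) in *. set (q := RtoC (1 - p)) in *. field. tauto. }
  apply LC_scal; [assumption..|].
  apply (LC_geom R0 Vs HR A (fun xi => fgap xi i j)); [assumption..| |].
  - unfold fgap. apply LC_plus; (apply LC_scal; [assumption..|]).
    + apply (LC_ext _ _ _ (fun xi => Cpowz (xi j) (-1))); [intros; apply Cpowz_m1_r|].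
      apply LC_var; assumption.
    + apply (LC_mult R0 Vs HR (fun e => e = dl i (-1)) (fun e => e = dl j (-1)) _ (fun xi => / xi i) (fun xi => / xi j)).
      * intros a b -> ->. assumption.
      * apply (LC_ext _ _ _ (fun xi => Cpowz (xi i) (-1))); [intros; apply Cpowz_m1_r|].
        apply LC_var; [assumption..|reflexivity].
      * apply (LC_ext _ _ _ (fun xi => Cpowz (xi j) (-1))); [intros; apply Cpowz_m1_r|].
        apply LC_var; [assumption..|reflexivity].
  - intros xi H. now apply Cmod_fgap.
Qed.

Lemma LCw_weaken w d d' F : (d <= d')%Z -> LCw w d F -> LCw w d' F.
Proof. intros H. apply LC_weaken. intros e He. lia. Qed.

Lemma LCw_LC w d F : LCw w d F -> LC (fun _ => True) F.
Proof. apply LC_weaken. auto. Qed.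

Lemma LCw_ext w d F G : (forall xi, onT xi -> F xi = G xi) -> LCw w d F -> LCw w d G.
Proof. apply LC_ext. Qed.

Lemma LCw_mult w d1 d2 d F G : (d1 + d2 <= d)%Z ->
  LCw w d1 F -> LCw w d2 G -> LCw w d (fun xi => F xi * G xi).
Proof.
  intros H. apply LC_mult; [assumption..|]. intros a b Ha Hb. rewrite wt_eadd. lia.
Qed.

Ltac lcw_mult d1 d2 :=
  lazymatch goal with
  | |- LCw ?w ?d (fun xi => @?F xi * @?G xi) => apply (LCw_mult w d1 d2 d F G)
  end.

Lemma LCw_plus w d F G : LCw w d F -> LCw w d G -> LCw w d (fun xi => F xi + G xi).
Proof. now apply LC_plus. Qed.

Lemma LCw_const w d c : (0 <= d)%Z -> LCw w d (fun _ => c).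
Proof. intros H. apply LC_const; [assumption..|]. rewrite wt_0. lia. Qed.

Lemma LCw_scal w d c F : LCw w d F -> LCw w d (fun xi => c * F xi).
Proof. now apply LC_scal. Qed.

Lemma LCw_opp w d F : LCw w d F -> LCw w d (fun xi => - F xi).
Proof.
  intros H. apply (LCw_ext _ _ (fun xi => - (1) * F xi)); [intros; ring|]. now apply LCw_scal.
Qed.

Lemma LCw_minus w d F G : LCw w d F -> LCw w d G -> LCw w d (fun xi => F xi - G xi).
Proof. intros HF HG. apply (LCw_plus w d F (fun xi => - G xi)); [assumption | now apply LCw_opp]. Qed.

Lemma LCw_powz w d i z : In i Vs -> (w i * z <= d)%Z -> LCw w d (fun xi => Cpowz (xi i) z).
Proof. intros Hi H. apply LC_var; [assumption..|]. now rewrite wt_dl. Qed.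

Lemma LCw_var w d i : In i Vs -> (w i <= d)%Z -> LCw w d (fun xi => xi i).
Proof.
  intros Hi H. apply (LCw_ext _ _ (fun xi => Cpowz (xi i) 1)); [intros; apply Cpowz_1_r|].
  apply LCw_powz; [assumption|lia].
Qed.

Lemma LCw_bsum {T : Type} w d (F : T -> (nat -> C) -> C) l :
  (forall a, In a l -> LCw w d (F a)) -> LCw w d (fun xi => bsum (fun a => F a xi) l).
Proof. now apply LC_bsum. Qed.

Lemma LCw_bprod {T : Type} w (k : T -> Z) (F : T -> (nat -> C) -> C) l :
  (forall a, In a l -> LCw w (k a) (F a)) ->
  LCw w (sumZ (map k l)) (fun xi => bprod (fun a => F a xi) l).
Proof.
  induction l as [|a l IH]; intros H; [apply (LCw_const w 0 1); lia|].
  apply (LCw_mult w (k a) (sumZ (map k l)) _ (F a) (fun xi => bprod (fun a => F a xi) l)).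
  - simpl. unfold sumZ; simpl. lia.
  - apply H; now left.
  - apply IH. intros; apply H; now right.
Qed.

Lemma sumZ_const {T : Type} (c : Z) (l : list T) : sumZ (map (fun _ => c) l) = (Z.of_nat (length l) * c)%Z.
Proof. induction l as [|a l IH]; [reflexivity|]. cbn [map length]. unfold sumZ in *. simpl fold_right. rewrite IH. lia. Qed.

Lemma LCw_bprod_const {T : Type} w d k (F : T -> (nat -> C) -> C) l : (Z.of_nat (length l) * k <= d)%Z ->
  (forall a, In a l -> LCw w k (F a)) -> LCw w d (fun xi => bprod (fun a => F a xi) l).
Proof.
  intros Hd H. apply (LCw_weaken _ (sumZ (map (fun _ : T => k) l))); [rewrite sumZ_const; exact Hd|].
  now apply LCw_bprod.
Qed.

Lemma LCw_bprod0 {T : Type} w d (F : T -> (nat -> C) -> C) l : (0 <= d)%Z ->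
  (forall a, In a l -> LCw w 0 (F a)) -> LCw w d (fun xi => bprod (fun a => F a xi) l).
Proof. intros Hd. apply LCw_bprod_const. lia. Qed.

Lemma LCw_pprod0 w d (F : nat -> nat -> (nat -> C) -> C) l : (0 <= d)%Z ->
  (forall a b, In a l -> In b l -> LCw w 0 (F a b)) -> LCw w d (fun xi => pprod (fun a b => F a b xi) l).
Proof.
  intros Hd H. unfold pprod. apply (LCw_bprod0 w d (fun ab xi => F (fst ab) (snd ab) xi)); [exact Hd|].
  intros ab Hab. apply in_pairs in Hab as [H1 H2]. now apply H.
Qed.

Lemma LCw_fA w d i j : In i Vs -> In j Vs -> (0 <= d)%Z -> (w i + w j <= d)%Z -> (w i <= d)%Z ->
  LCw w d (fun xi => fA p (xi i) (xi j)).
Proof.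
  intros Hi Hj H0 Hij Hii. unfold fA.
  apply (LCw_minus w d (fun xi => RtoC p + RtoC (1 - p) * xi i * xi j) (fun xi => xi i)); [|now apply LCw_var].
  apply (LCw_plus w d (fun _ => RtoC p) (fun xi => RtoC (1 - p) * xi i * xi j)); [now apply LCw_const|].
  lcw_mult (w i)%Z (w j)%Z; [lia| |apply LCw_var; [assumption|lia]].
  apply LCw_scal. apply LCw_var; [assumption|lia].
Qed.

Lemma LCw_finv w d i j : In i Vs -> In j Vs -> (0 <= w j)%Z -> (0 <= w i + w j)%Z -> (- (w i + w j) <= d)%Z ->
  LCw w d (fun xi => / fA p (xi i) (xi j)).
Proof.
  intros Hi Hj Hw Hij Hd.
  apply (LCw_ext _ _ (fun xi => (xi i * xi j / fA p (xi i) (xi j)) * (Cpowz (xi i) (-1) * Cpowz (xi j) (-1)))).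
  { intros xi H. rewrite !Cpowz_m1_r.
    pose proof (onT_neq_0 R0 HR xi i H). pose proof (onT_neq_0 R0 HR xi j H).
    pose proof (fA_neq_0 xi i j H). field. tauto. }
  lcw_mult 0%Z (- (w i + w j))%Z; [lia| |].
  - apply LC_fnorm; try assumption; cbv beta; rewrite ?wt_0, ?wt_eadd, ?wt_dl by assumption; try lia.
    intros a b Ha Hb. rewrite wt_eadd. lia.
  - lcw_mult (- w i)%Z (- w j)%Z; [lia| |];
      apply LCw_powz; try assumption; lia.
Qed.

(** Expansion at infinity: 1/(1 - xi) = - xi^-1 / (1 - xi^-1). *)
Lemma LCw_oneinv w d i : In i Vs -> (0 <= w i)%Z -> (- w i <= d)%Z ->
  LCw w d (fun xi => / (1 - xi i)).
Proof.
  intros Hi Hw Hd.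
  apply (LCw_ext _ _ (fun xi => (- (1) * Cpowz (xi i) (-1)) * / (1 - / xi i))).
  { intros xi H. rewrite Cpowz_m1_r. pose proof (onT_neq_0 R0 HR xi i H). pose proof (one_minus_neq_0 xi i H) as H1.
    assert (xi i - 1 <> 0) by (intros E; apply H1; transitivity (- (xi i - 1)); [ring|rewrite E; ring]).
    field. tauto. }
  lcw_mult (- w i)%Z 0%Z; [lia| |].
  - apply LCw_scal. apply LCw_powz; [assumption|lia].
  - apply (LC_geom R0 Vs HR _ (fun xi => / xi i)).
    + rewrite wt_0; lia.
    + intros a b Ha Hb. rewrite wt_eadd. lia.
    + apply (LC_ext _ _ _ (fun xi => Cpowz (xi i) (-1))); [intros; apply Cpowz_m1_r|].
      apply LC_var; [assumption..|]. rewrite wt_dl by assumption. lia.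
    + intros xi H. pose proof R0_gt_4. rewrite Cmod_inv by now apply (onT_neq_0 R0 HR).
      rewrite H. apply Rinv_le_contravar; lra.
Qed.

Lemma EE_neg w d F : (d < 0)%Z -> LCw w d F -> EE R0 Vs F = 0.
Proof.
  intros Hd. apply (EE_zero R0 Vs HR HVs). intros e He.
  destruct (Forall_Exists_dec (fun i => e i = 0%Z) (fun i => Z.eq_dec (e i) 0) Vs) as [H|H].
  - exfalso. replace (wt Vs w e) with (wt Vs w (fun _ => 0%Z)) in He; [rewrite wt_0 in He; lia|].
    unfold wt. f_equal. apply map_ext_in. intros i Hi. rewrite Forall_forall in H. now rewrite (H i Hi).
  - apply Exists_exists in H as (i & Hi & Hei). now exists i.
Qed.

Lemma LCw_amp0_wt0 w z U : incl U Vs -> (forall v, In v U -> w v = 0%Z) ->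
  LCw w 0 (amp0 sg z U).
Proof.
  intros HU Hw. unfold amp0.
  assert (Hb : LCw w 0 (fun xi => bprod xi U)).
  { apply (LCw_bprod0 w 0 (fun v xi => xi v)); [lia|]. intros v Hv. apply LCw_var; [auto|]. rewrite Hw by assumption; lia. }
  lcw_mult 0%Z 0%Z; [lia| |].
  - lcw_mult 0%Z 0%Z; [lia| |].
    + apply (LCw_pprod0 w 0 (fun u v xi => sg u v * (xi v - xi u))); [lia|]. intros u v Hu Hv.
      apply LCw_scal. apply (LCw_minus w 0 (fun xi => xi v) (fun xi => xi u)); apply LCw_var; auto; rewrite Hw by assumption; lia.
    + apply (LCw_ext _ _ (fun xi => (1 - bprod xi U) * bprod (fun v => / (1 - xi v)) U)).
      { intros xi H. rewrite bprod_inv; [reflexivity|]. intros; now apply one_minus_neq_0. }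
      lcw_mult 0%Z 0%Z; [lia| |].
      * apply (LCw_minus w 0 (fun _ => 1) (fun xi => bprod xi U)); [apply LCw_const; lia|exact Hb].
      * apply (LCw_bprod0 w 0 (fun v xi => / (1 - xi v))); [lia|]. intros v Hv. apply LCw_oneinv; auto; rewrite Hw by assumption; lia.
  - apply (LCw_bprod0 w 0 (fun v xi => Cpowz (xi v) z)); [lia|]. intros v Hv. apply LCw_powz; auto. rewrite Hw by assumption; lia.
Qed.

Lemma LCw_amp_wt0 w xs z : forall U, incl U Vs -> (forall v, In v U -> w v = 0%Z) ->
  LCw w 0 (amp p sg xs z U).
Proof.
  induction xs as [|x xs IH]; intros U HU Hw; [now apply LCw_amp0_wt0|].
  change (LCw w 0 (fun xi => bsum (fun l => bprod (fun v => sg l v * fA p (xi l) (xi v)) (rem1 l U) *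
                     Cpowz (xi l) x * amp p sg xs z (rem1 l U) xi) U)).
  apply (LCw_bsum w 0 (fun l xi => bprod (fun v => sg l v * fA p (xi l) (xi v)) (rem1 l U) *
                     Cpowz (xi l) x * amp p sg xs z (rem1 l U) xi)).
  intros l Hl.
  lcw_mult 0%Z 0%Z; [lia| |].
  - lcw_mult 0%Z 0%Z; [lia| |].
    + apply (LCw_bprod0 w 0 (fun v xi => sg l v * fA p (xi l) (xi v))); [lia|]. intros v Hv. apply in_rem1 in Hv as [Hv _].
      apply LCw_scal. apply LCw_fA; auto; rewrite ?(Hw l), ?(Hw v) by assumption; lia.
    + apply LCw_powz; auto. rewrite Hw by assumption. lia.
  - apply IH; intros v Hv; apply in_rem1 in Hv as [Hv _]; auto.
Qed.

Definition monoU (U : list nat) (y : nat -> Z) (xi : nat -> C) : C :=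
  bprod (fun v => Cpowz (xi v) (- y v)) U.

(** The running lower bound [X] is what the degree bounds consume; as positions are integers, strict
    increase is the bound [x + 1] for the rest. *)
Fixpoint incr (X : Z) (xs : list Z) (z : Z) : Prop :=
  match xs with
  | [] => (X <= z)%Z
  | x :: xs' => (X <= x)%Z /\ incr (x + 1) xs' z
  end.

Lemma incr_le X X' xs z : (X' <= X)%Z -> incr X xs z -> incr X' xs z.
Proof. destruct xs as [|x xs]; simpl; [lia|]. intros H [H1 H2]. split; [lia|exact H2]. Qed.

(** Bounds of degree 0 are compositional, so every product is split as 0 + 0. Where factors
    compensate each other the split is given by hand with [lcw_mult]. *)
Ltac lc_step :=
  cbv beta;
  match goal with
  | |- LCw ?w 0 (fun xi => ?c) => apply (LCw_const w 0 c); lia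
  | |- LCw ?w 0 (fun xi => @?F xi * @?G xi) => lcw_mult 0%Z 0%Z; [lia| |]
  | |- LCw ?w 0 (fun xi => @?F xi / @?G xi) => lcw_mult 0%Z 0%Z; [lia| |]
  | |- LCw ?w 0 (fun xi => @?F xi + @?G xi) => apply (LCw_plus w 0 F G)
  | |- LCw ?w 0 (fun xi => @?F xi - @?G xi) => apply (LCw_minus w 0 F G)
  | |- LCw ?w 0 (fun xi => fA p (xi ?i) (xi ?j)) => apply (LCw_fA w 0 i j)
  | |- LCw ?w 0 (fun xi => / fA p (xi ?i) (xi ?j)) => apply (LCw_finv w 0 i j)
  | |- LCw ?w 0 (fun xi => / (RtoC 1 - xi ?i)) => apply (LCw_oneinv w 0 i)
  | |- LCw ?w 0 (fun xi => Cpowz (xi ?i) ?z) => apply (LCw_powz w 0 i z)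
  | |- LCw ?w 0 (fun xi => xi ?i) => apply (LCw_var w 0 i)
  | |- LCw ?w 0 (fun xi => bprod xi ?l) => apply (LCw_bprod0 w 0 (fun v xi => xi v) l); [lia|intros]
  | |- LCw ?w 0 (fun xi => bprod (fun v => @?F v xi) ?l) => apply (LCw_bprod0 w 0 F l); [lia|intros]
  | |- LCw ?w 0 (fun xi => pprod (fun u v => @?F u v xi) ?l) => apply (LCw_pprod0 w 0 F l); [lia|intros]
  | |- LCw ?w 0 (fun xi => bsum (fun v => @?F v xi) ?l) => apply (LCw_bsum w 0 F l); intros
  end.

Lemma dl_same i z : dl i z i = z.
Proof. unfold dl. now rewrite Nat.eqb_refl. Qed.

Lemma dl_other i z v : v <> i -> dl i z v = 0%Z.
Proof. intros H. unfold dl. destruct (Nat.eqb_spec v i); [contradiction|reflexivity]. Qed.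

Lemma dl_m1_le i v : (dl i (-1) v <= 0)%Z.
Proof. unfold dl. destruct (Nat.eqb v i); lia. Qed.

Lemma rem1_cons_neq l a U : l <> a -> rem1 l (a :: U) = a :: rem1 l U.
Proof. intros H. unfold rem1; simpl. destruct (Nat.eq_dec l a); [contradiction|reflexivity]. Qed.

Lemma incl_rem1 l U W : incl U W -> incl (rem1 l U) W.
Proof. intros H v Hv. apply in_rem1 in Hv as [Hv _]. auto. Qed.

Lemma amp_cons_split s x xs z a U xi : ~ In a U ->
  amp p s (x :: xs) z (a :: U) xi =
    bprod (fun v => s a v * fA p (xi a) (xi v)) U * Cpowz (xi a) x * amp p s xs z U xi +
    bsum (fun l => s l a * fA p (xi l) (xi a) *
      bprod (fun v => s l v * fA p (xi l) (xi v)) (rem1 l U) * Cpowz (xi l) x *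
      amp p s xs z (a :: rem1 l U) xi) U.
Proof.
  intros Ha. cbn [amp]. rewrite bsum_cons, rem1_cons_eq by assumption. f_equal.
  apply bsum_ext. intros l Hl. rewrite rem1_cons_neq by (intros ->; contradiction).
  rewrite bprod_cons. ring.
Qed.

(** The only pole of [amp0] in xi_a off the origin is the simple one at 1; once it is cleared, xi_a
    enters polynomially apart from the power [z]. *)
Lemma amp0_regular s z a U xi : onT xi ->
  (1 - xi a) * amp0 s z (a :: U) xi =
  bprod (fun v => s a v * (xi v - xi a)) U *
  pprod (fun u v => s u v * (xi v - xi u)) U *
  (1 - xi a * bprod xi U) * bprod (fun v => / (1 - xi v)) U * bprod (fun v => Cpowz (xi v) z) U *
  Cpowz (xi a) z.
Proof.
  intros H. unfold amp0. rewrite pprod_cons, !bprod_cons.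
  rewrite bprod_inv by (intros; now apply one_minus_neq_0).
  pose proof (one_minus_neq_0 xi a H).
  assert (bprod (fun v => 1 - xi v) U <> 0) by (apply bprod_neq_0; intros; now apply one_minus_neq_0).
  set (k := bprod (fun v => 1 - xi v) U) in *. field. tauto.
Qed.

Lemma NoDup_cons_inv (a : nat) U : NoDup (a :: U) -> ~ In a U /\ NoDup U.
Proof. intros H; inversion H; tauto. Qed.

Lemma NoDup_cons_rem1 (a l : nat) U : NoDup (a :: U) -> NoDup (a :: rem1 l U).
Proof.
  intros H. apply NoDup_cons_inv in H as [H1 H2]. constructor; [|now apply NoDup_rem1].
  rewrite in_rem1. tauto.
Qed.

(** The weight is minus the exponent of xi_a. With the pole at 1 cleared, xi_a occurs polynomially
    except for one power x_i or [z], and all of these are at least [X]. *)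
Lemma LCw_amp_low xs z : forall w a U X, NoDup (a :: U) -> incl (a :: U) Vs -> incr X xs z ->
  w a = (-1)%Z -> (forall v, In v U -> w v = 0%Z) ->
  LCw w (- X) (fun xi => (1 - xi a) * amp p sg xs z (a :: U) xi).
Proof.
  induction xs as [|x xs IH]; intros w a U X Hnd Hincl HX Hwa Hw0;
    apply NoDup_cons_inv in Hnd as Hnd'; destruct Hnd' as [Ha HU];
    assert (HaV : In a Vs) by (apply Hincl; now left);
    assert (HUV : incl U Vs) by (intros v Hv; apply Hincl; now right).
  - simpl in HX.
    apply (LCw_ext w _ _ _ (fun xi H => eq_sym (amp0_regular sg z a U xi H))).
    lcw_mult 0%Z (- z)%Z; [lia| |apply LCw_powz; [assumption|lia]].
    repeat lc_step; auto; rewrite ?Hwa, ?Hw0 by assumption; lia.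
  - destruct HX as [HX1 HX2].
    apply (LCw_ext _ _ (fun xi => (1 - xi a) *
      (bprod (fun v => sg a v * fA p (xi a) (xi v)) U * amp p sg xs z U xi) * Cpowz (xi a) x +
      bsum (fun l => (sg l a * fA p (xi l) (xi a) *
      bprod (fun v => sg l v * fA p (xi l) (xi v)) (rem1 l U) * Cpowz (xi l) x) *
      ((1 - xi a) * amp p sg xs z (a :: rem1 l U) xi)) U)).
    { intros xi _. rewrite amp_cons_split, Cmult_plus_distr_l, <- bsum_scal by assumption.
      f_equal; [ring|]. apply bsum_ext. intros; ring. }
    apply (LCw_plus _ _ (fun xi => (1 - xi a) *
      (bprod (fun v => sg a v * fA p (xi a) (xi v)) U * amp p sg xs z U xi) * Cpowz (xi a) x)
      (fun xi => bsum (fun l => (sg l a * fA p (xi l) (xi a) *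
      bprod (fun v => sg l v * fA p (xi l) (xi v)) (rem1 l U) * Cpowz (xi l) x) *
      ((1 - xi a) * amp p sg xs z (a :: rem1 l U) xi)) U)).
    + lcw_mult 0%Z (- x)%Z;
        [lia| |apply LCw_powz; [assumption|lia]].
      lcw_mult 0%Z 0%Z; [lia| |].
      * repeat lc_step; auto; lia.
      * lcw_mult 0%Z 0%Z; [lia| |].
        -- repeat lc_step; auto; rewrite ?Hwa, ?Hw0 by assumption; lia.
        -- now apply LCw_amp_wt0.
    + apply (LCw_bsum _ _ (fun l xi => (sg l a * fA p (xi l) (xi a) *
      bprod (fun v => sg l v * fA p (xi l) (xi v)) (rem1 l U) * Cpowz (xi l) x) *
      ((1 - xi a) * amp p sg xs z (a :: rem1 l U) xi))). intros l Hl.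
      lcw_mult 0%Z (- X)%Z; [lia| |].
      * repeat lc_step; auto; try (apply in_rem1 in H as [H _]); auto; rewrite ?Hwa, ?Hw0 by assumption; lia.
      * apply IH; [now apply NoDup_cons_rem1| | |assumption|].
        -- intros v [<-|Hv]; [assumption|]. apply in_rem1 in Hv as [Hv _]; auto.
        -- apply (incr_le (x + 1)); [lia|assumption].
        -- intros v Hv. apply in_rem1 in Hv as [Hv _]; auto.
Qed.

Lemma amp_cons2_split s x xs z a i W xi : ~ In a (i :: W) -> ~ In i W ->
  amp p s (x :: xs) z (a :: i :: W) xi =
    bprod (fun v => s a v * fA p (xi a) (xi v)) (i :: W) * Cpowz (xi a) x * amp p s xs z (i :: W) xi +
    (s i a * fA p (xi i) (xi a) * bprod (fun v => s i v * fA p (xi i) (xi v)) W * Cpowz (xi i) x *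
      amp p s xs z (a :: W) xi +
    bsum (fun l => s l a * fA p (xi l) (xi a) * (s l i * fA p (xi l) (xi i)) *
      bprod (fun v => s l v * fA p (xi l) (xi v)) (rem1 l W) * Cpowz (xi l) x *
      amp p s xs z (a :: i :: rem1 l W) xi) W).
Proof.
  intros Ha Hi. rewrite amp_cons_split by assumption. f_equal.
  rewrite bsum_cons, rem1_cons_eq by assumption. f_equal.
  apply bsum_ext. intros l Hl. rewrite rem1_cons_neq by (intros ->; contradiction).
  rewrite bprod_cons. ring.
Qed.

(** The exponent of xi_i minus that of xi_a. For this weight 1/f(xi_a, xi_i) has degree 0, so one
    moving pole does no harm. *)
Definition wdiff (i a : nat) : nat -> Z := eadd (dl i 1) (dl a (-1)).

Lemma wdiff_l i a : i <> a -> wdiff i a i = 1%Z.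
Proof. intros H. unfold wdiff, eadd. rewrite dl_same, dl_other by assumption. reflexivity. Qed.

Lemma wdiff_r i a : i <> a -> wdiff i a a = (-1)%Z.
Proof. intros H. unfold wdiff, eadd. rewrite dl_same, dl_other by auto. reflexivity. Qed.

Lemma wdiff_other i a v : v <> i -> v <> a -> wdiff i a v = 0%Z.
Proof. intros H1 H2. unfold wdiff, eadd. rewrite !dl_other by assumption. reflexivity. Qed.

Lemma bsum_two_classes {T : Type} w1 d1 w2 d2 (F : T -> (nat -> C) -> C) l :
  (forall a, In a l -> exists G1 G2, (forall xi, onT xi -> F a xi = G1 xi + G2 xi) /\ LCw w1 d1 G1 /\ LCw w2 d2 G2) ->
  exists G1 G2, (forall xi, onT xi -> bsum (fun a => F a xi) l = G1 xi + G2 xi) /\ LCw w1 d1 G1 /\ LCw w2 d2 G2.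
Proof.
  induction l as [|a l IH]; intros H.
  - exists (fun _ => 0), (fun _ => 0). split; [intros; unfold bsum; simpl; ring|]. split; apply LC_0.
  - destruct (H a (or_introl eq_refl)) as (A1 & A2 & E & HA1 & HA2).
    destruct IH as (B1 & B2 & E' & HB1 & HB2); [intros; apply H; now right|].
    exists (fun xi => A1 xi + B1 xi), (fun xi => A2 xi + B2 xi).
    split; [|split; now apply LCw_plus]. intros xi Hxi. rewrite bsum_cons, E, E' by assumption. ring.
Qed.

(* Either the exponent of [xi_a] is at least [X], or the pole at [f(xi_a, xi_i) = 0] comes with
   a decay in [xi_i]; in both cases the coefficient extracted in [bracket_single] is zero. *)
Lemma amp_single_pole xs z : forall a i W X, NoDup (a :: i :: W) -> incl (a :: i :: W) Vs -> incr X xs z ->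
  exists G1 G2,
    (forall xi, onT xi -> (1 - xi a) * amp p sg xs z (a :: i :: W) xi / fA p (xi a) (xi i) = G1 xi + G2 xi) /\
    LCw (dl a (-1)) (- X) G1 /\ LCw (wdiff i a) (Z.of_nat (length W)) G2.
Proof.
  induction xs as [|x xs IH]; intros a i W X Hnd Hincl HX;
    apply NoDup_cons_inv in Hnd as Hnd'; destruct Hnd' as [Ha HU];
    apply NoDup_cons_inv in HU as HU'; destruct HU' as [Hi HW];
    assert (HaV : In a Vs) by (apply Hincl; now left);
    assert (HiV : In i Vs) by (apply Hincl; right; now left);
    assert (HWV : incl W Vs) by (intros v Hv; apply Hincl; right; now right);
    assert (Hia : i <> a) by (intros ->; apply Ha; now left);
    assert (Hne : forall v, In v W -> v <> a) by (intros v Hv ->; apply Ha; now right);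
    assert (Hnei : forall v, In v W -> v <> i) by (intros v Hv ->; contradiction);
    set (w := wdiff i a);
    assert (Hwi : w i = 1%Z) by (now apply wdiff_l);
    assert (Hwa : w a = (-1)%Z) by (now apply wdiff_r);
    assert (Hw0 : forall v, In v W -> w v = 0%Z) by (intros v Hv; apply wdiff_other; auto);
    set (n := Z.of_nat (length W)).
  (* Here everything lies in the second class: xi_i - xi_a has degree 1, the differences of xi_i
     with [W] degree |W|, 1/(1 - xi_i) degree -1, and the powers [z] of xi_i and xi_a cancel. *)
  - exists (fun _ => 0).
    exists (fun xi => (1 - xi a) * amp p sg [] z (a :: i :: W) xi / fA p (xi a) (xi i)).
    split; [intros; ring|]. split; [apply LC_0|].
    apply (LCw_ext _ _ (fun xi =>
      (bprod (fun v => sg a v * (xi v - xi a)) W * pprod (fun u v => sg u v * (xi v - xi u)) W *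
        (1 - xi a * xi i * bprod xi W) * bprod (fun v => / (1 - xi v)) W * bprod (fun v => Cpowz (xi v) z) W) *
      ((sg a i * (xi i - xi a)) * (bprod (fun v => sg i v * (xi v - xi i)) W *
       (/ (1 - xi i) * (Cpowz (xi i) z * (Cpowz (xi a) z * / fA p (xi a) (xi i)))))))).
    { intros xi H. cbn [amp]. rewrite amp0_regular by assumption. rewrite pprod_cons, !bprod_cons.
      unfold Cdiv. ring. }
    lcw_mult 0%Z n%Z; [lia| |].
    + lcw_mult 0%Z 0%Z; [lia| |].
      2: { repeat lc_step; auto. rewrite Hw0 by assumption; lia. }
      lcw_mult 0%Z 0%Z; [lia| |].
      2: { repeat lc_step; auto; rewrite Hw0 by assumption; lia. }
      lcw_mult 0%Z 0%Z; [lia| |].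
      * repeat lc_step; auto; rewrite ?Hwa, ?Hw0 by assumption; lia.
      * apply (LCw_minus w 0 (fun _ => 1) (fun xi => xi a * xi i * bprod xi W)); [apply LCw_const; lia|].
        lcw_mult 0%Z 0%Z; [lia| |].
        -- lcw_mult (-1)%Z 1%Z; [lia| |]; apply LCw_var; auto; lia.
        -- repeat lc_step; auto; rewrite Hw0 by assumption; lia.
    + lcw_mult 1%Z (n - 1)%Z; [lia| |].
      { apply LCw_scal. apply (LCw_minus w 1 (fun xi => xi i) (fun xi => xi a)); apply LCw_var; auto; lia. }
      lcw_mult n%Z (-1)%Z; [lia| |].
      { apply (LCw_bprod_const w n 1 (fun v xi => sg i v * (xi v - xi i))); [unfold n; lia|]. intros v Hv.
        apply LCw_scal. apply (LCw_minus w 1 (fun xi => xi v) (fun xi => xi i)); apply LCw_var; auto; rewrite ?Hw0 by assumption; lia. }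
      lcw_mult (-1)%Z 0%Z; [lia| |].
      { apply LCw_oneinv; auto; lia. }
      lcw_mult z%Z (-z)%Z; [lia|apply LCw_powz; auto; lia|].
      lcw_mult (-z)%Z 0%Z; [lia|apply LCw_powz; auto; lia|].
      apply LCw_finv; auto; lia.
  - destruct HX as [HX1 HX2].
    (* The choice ell_1 = a: its factor f(xi_a, xi_i) cancels the denominator, and xi_a carries the
       power x, at least [X]. *)
    pose (T1 := fun xi : nat -> C => (1 - xi a) * (sg a i * (bprod (fun v => sg a v * fA p (xi a) (xi v)) W *
       amp p sg xs z (i :: W) xi)) * Cpowz (xi a) x).
    assert (HT1 : LCw (dl a (-1)) (- X) T1).
    { assert (Hle := dl_m1_le a).
      apply (LCw_mult _ 0 (- x) _ (fun xi => (1 - xi a) * (sg a i * (bprod (fun v => sg a v * fA p (xi a) (xi v)) W *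
        amp p sg xs z (i :: W) xi))) (fun xi => Cpowz (xi a) x)); [lia| |apply LCw_powz; [assumption|rewrite dl_same; lia]].
      lcw_mult 0%Z 0%Z; [lia| |].
      - repeat lc_step; auto.
      - apply LCw_scal.
        lcw_mult 0%Z 0%Z; [lia| |].
        + repeat lc_step; auto; try lia. pose proof (Hle a); pose proof (Hle a0); lia.
        + apply LCw_amp_wt0; [intros v Hv; apply Hincl; now right|]. intros v Hv. apply dl_other. intros ->; auto. }
    (* The choice ell_1 = i: the quotient of the two f has degree 1, the other factors of xi_i have
       degree |W| + x, and the remaining positions are at least x + 1, which gives degree -(x + 1).
       The total is |W|. *)
    pose (T2 := fun xi : nat -> C => (sg i a * (fA p (xi i) (xi a) * / fA p (xi a) (xi i))) *
       ((bprod (fun v => sg i v * fA p (xi i) (xi v)) W * Cpowz (xi i) x) * ((1 - xi a) * amp p sg xs z (a :: W) xi))).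
    assert (HT2 : LCw w n T2).
    { apply (LCw_mult w 1 (n - 1) n (fun xi => sg i a * (fA p (xi i) (xi a) * / fA p (xi a) (xi i)))
        (fun xi => (bprod (fun v => sg i v * fA p (xi i) (xi v)) W * Cpowz (xi i) x) * ((1 - xi a) * amp p sg xs z (a :: W) xi))); [lia| |].
      { apply LCw_scal. lcw_mult 1%Z 0%Z; [lia| |].
        - apply LCw_fA; auto; lia.
        - apply LCw_finv; auto; lia. }
      lcw_mult (n + x)%Z (- (x + 1))%Z; [lia| |].
      { lcw_mult n%Z x%Z; [lia| |].
        - apply (LCw_bprod_const w n 1 (fun v xi => sg i v * fA p (xi i) (xi v))); [unfold n; lia|]. intros v Hv.
          apply LCw_scal, LCw_fA; auto; rewrite ?(Hw0 v) by assumption; lia.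
        - apply LCw_powz; auto; lia. }
      apply LCw_amp_low; auto.
      - now constructor; [intros H; apply Ha; now right|].
      - intros v [<-|Hv]; auto. }
    (* The choice of ell_1 in [W]: by induction |W| is one less, and f(xi_l, xi_i) supplies the
       missing degree. *)
    assert (HT3 : exists G1 G2, (forall xi, onT xi ->
        bsum (fun l => (sg l a * fA p (xi l) (xi a) * (sg l i * fA p (xi l) (xi i)) *
          bprod (fun v => sg l v * fA p (xi l) (xi v)) (rem1 l W) * Cpowz (xi l) x) *
          ((1 - xi a) * amp p sg xs z (a :: i :: rem1 l W) xi / fA p (xi a) (xi i))) W = G1 xi + G2 xi) /\
        LCw (dl a (-1)) (- X) G1 /\ LCw w n G2).
    { apply (bsum_two_classes _ _ _ _ (fun l xi => (sg l a * fA p (xi l) (xi a) * (sg l i * fA p (xi l) (xi i)) *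
          bprod (fun v => sg l v * fA p (xi l) (xi v)) (rem1 l W) * Cpowz (xi l) x) *
          ((1 - xi a) * amp p sg xs z (a :: i :: rem1 l W) xi / fA p (xi a) (xi i)))).
      intros l Hl.
      destruct (IH a i (rem1 l W) (x + 1)%Z) as (G1 & G2 & E & HG1 & HG2).
      - constructor; [|constructor; [|now apply NoDup_rem1]].
        + intros [->|H]; [now apply Ha; left|]. apply in_rem1 in H as [H _]. apply Ha; now right.
        + rewrite in_rem1. tauto.
      - intros v [<-|[<-|Hv]]; auto. apply in_rem1 in Hv as [Hv _]; auto.
      - assumption.
      - pose (K := fun xi : nat -> C => (fA p (xi l) (xi a) * (bprod (fun v => sg l v * fA p (xi l) (xi v)) (rem1 l W) * Cpowz (xi l) x))
            * (sg l a * (sg l i * fA p (xi l) (xi i)))).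
        exists (fun xi => K xi * G1 xi), (fun xi => K xi * G2 xi). split; [|split].
        + intros xi Hxi. rewrite E by assumption. unfold K. ring.
        + lcw_mult 0%Z (- (x + 1))%Z; [lia| |assumption].
          unfold K. repeat lc_step; auto; try (apply in_rem1 in H as [H _]); auto; unfold dl;
            repeat match goal with |- context [Nat.eqb ?u ?v] => destruct (Nat.eqb u v) eqn:? end; try lia;
            match goal with H : Nat.eqb ?u a = true |- _ => apply Nat.eqb_eq in H; subst; exfalso end;
            try (now apply (Hne a)); apply Ha; auto; now left.
        + lcw_mult 1%Z (Z.of_nat (length (rem1 l W)))%Z;
            [unfold n; rewrite (length_rem1 l W) by assumption; lia| |assumption].
          apply (LCw_mult w 0 1 1 (fun xi => fA p (xi l) (xi a) * (bprod (fun v => sg l v * fA p (xi l) (xi v)) (rem1 l W) * Cpowz (xi l) x))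
             (fun xi => sg l a * (sg l i * fA p (xi l) (xi i)))); [lia| |].
          * repeat lc_step; auto; try (apply in_rem1 in H as [H _]); auto; rewrite ?Hwa, ?Hw0 by assumption; lia.
          * apply LCw_scal, LCw_scal, LCw_fA; auto; rewrite ?(Hw0 l) by assumption; lia. }
    destruct HT3 as (G1 & G2 & E3 & HG1 & HG2).
    exists (fun xi => T1 xi + G1 xi), (fun xi => T2 xi + G2 xi). split; [|split; now apply LCw_plus].
    intros xi Hxi. rewrite amp_cons2_split by assumption.
    transitivity (T1 xi + T2 xi + (G1 xi + G2 xi)); [|ring]. rewrite <- E3 by assumption.
    pose proof (fA_neq_0 xi a i Hxi) as Hf.
    unfold T1, T2. rewrite bprod_cons.
    rewrite (bsum_ext (fun l => _ * ((1 - xi a) * _ / _)) (fun l => (1 - xi a) / fA p (xi a) (xi i) *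
      (sg l a * fA p (xi l) (xi a) * (sg l i * fA p (xi l) (xi i)) *
      bprod (fun v => sg l v * fA p (xi l) (xi v)) (rem1 l W) * Cpowz (xi l) x *
      amp p sg xs z (a :: i :: rem1 l W) xi))) by (intros; unfold Cdiv; ring).
    rewrite bsum_scal. field. exact Hf.
Qed.

(** * Values at xi_a = 1 through difference quotients *)

Definition wout (a : nat) : nat -> Z := fun v => if Nat.eqb v a then (-1)%Z else 1%Z.

(* Exponents of [xi_a] are bounded below in terms of the other exponents. *)
Definition Bd (a : nat) (F : (nat -> C) -> C) : Prop := exists d, LCw (wout a) d F.

Lemma Bd_ext a F G : (forall xi, onT xi -> F xi = G xi) -> Bd a F -> Bd a G.
Proof. intros H [d Hd]. exists d. now apply (LCw_ext _ _ F). Qed.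

Lemma Bd_const a c : Bd a (fun _ => c).
Proof. exists 0%Z. apply LCw_const. lia. Qed.

Lemma Bd_mult a F G : Bd a F -> Bd a G -> Bd a (fun xi => F xi * G xi).
Proof. intros [d Hd] [d' Hd']. exists (d + d')%Z. apply (LCw_mult _ d d'); auto; lia. Qed.

Lemma Bd_plus a F G : Bd a F -> Bd a G -> Bd a (fun xi => F xi + G xi).
Proof.
  intros [d Hd] [d' Hd']. exists (Z.max d d').
  apply LCw_plus; [apply (LCw_weaken _ d) | apply (LCw_weaken _ d')]; auto; lia.
Qed.

Lemma Bd_minus a F G : Bd a F -> Bd a G -> Bd a (fun xi => F xi - G xi).
Proof.
  intros [d Hd] [d' Hd']. exists (Z.max d d').
  apply LCw_minus; [apply (LCw_weaken _ d) | apply (LCw_weaken _ d')]; auto; lia.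
Qed.

Lemma Bd_powz a i z : In i Vs -> Bd a (fun xi => Cpowz (xi i) z).
Proof. intros H. exists (wout a i * z)%Z. apply LCw_powz; [assumption|lia]. Qed.

Lemma Bd_var a i : In i Vs -> Bd a (fun xi => xi i).
Proof. intros H. exists (wout a i). apply LCw_var; [assumption|lia]. Qed.

Lemma Bd_bsum {T : Type} a (F : T -> (nat -> C) -> C) l : (forall v, In v l -> Bd a (F v)) ->
  Bd a (fun xi => bsum (fun v => F v xi) l).
Proof.
  induction l as [|v l IH]; intros H; [apply (Bd_const a 0)|].
  apply (Bd_plus a (F v) (fun xi => bsum (fun v => F v xi) l)); [apply H; now left|].
  apply IH. intros; apply H; now right.
Qed.

Lemma Bd_bprod {T : Type} a (F : T -> (nat -> C) -> C) l : (forall v, In v l -> Bd a (F v)) ->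
  Bd a (fun xi => bprod (fun v => F v xi) l).
Proof.
  induction l as [|v l IH]; intros H; [apply (Bd_const a 1)|].
  apply (Bd_mult a (F v) (fun xi => bprod (fun v => F v xi) l)); [apply H; now left|].
  apply IH. intros; apply H; now right.
Qed.

Lemma Bd_pprod a (F : nat -> nat -> (nat -> C) -> C) l : (forall u v, In u l -> In v l -> Bd a (F u v)) ->
  Bd a (fun xi => pprod (fun u v => F u v xi) l).
Proof.
  intros H. unfold pprod. apply (Bd_bprod a (fun ab xi => F (fst ab) (snd ab) xi)).
  intros ab Hab. apply in_pairs in Hab as [H1 H2]. now apply H.
Qed.

Lemma Bd_fA a i j : In i Vs -> In j Vs -> Bd a (fun xi => fA p (xi i) (xi j)).
Proof.
  intros Hi Hj. unfold fA.
  apply (Bd_minus a (fun xi => RtoC p + RtoC (1 - p) * xi i * xi j) (fun xi => xi i)); [|now apply Bd_var].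
  apply (Bd_plus a (fun _ => RtoC p) (fun xi => RtoC (1 - p) * xi i * xi j)); [apply Bd_const|].
  apply (Bd_mult a (fun xi => RtoC (1 - p) * xi i) (fun xi => xi j)); [|now apply Bd_var].
  apply (Bd_mult a (fun _ => RtoC (1 - p)) (fun xi => xi i)); [apply Bd_const|now apply Bd_var].
Qed.

Lemma Bd_finv a j : In a Vs -> In j Vs -> j <> a -> Bd a (fun xi => / fA p (xi a) (xi j)).
Proof.
  intros Ha Hj H. exists 0%Z. unfold wout.
  apply LCw_finv; auto; rewrite ?Nat.eqb_refl; destruct (Nat.eqb_spec j a); try contradiction; lia.
Qed.

Lemma Bd_oneinv a j : In j Vs -> j <> a -> Bd a (fun xi => / (1 - xi j)).
Proof.
  intros Hj H. exists 0%Z. unfold wout.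
  apply LCw_oneinv; auto; destruct (Nat.eqb_spec j a); try contradiction; lia.
Qed.

(** At xi_a = 1 the denominator becomes a multiple of 1 - xi_j. The factor q is the origin of the
    powers of 1/q in [Gint_bracket_vanish]. *)
Lemma fA_1_l (xi : nat -> C) j : fA p 1 (xi j) = - RtoC (1 - p) * (1 - xi j).
Proof. unfold fA. rewrite RtoC_minus. ring. Qed.

Lemma fA_1_neq_0 xi j : onT xi -> fA p 1 (xi j) <> 0.
Proof.
  intros H. rewrite fA_1_l. apply Cmult_neq_0; [|now apply one_minus_neq_0].
  intros E. apply RtoC_q_neq_0. transitivity (- - RtoC (1 - p)); [ring|]. rewrite E. ring.
Qed.

Lemma finv_1 (xi : nat -> C) j : onT xi -> / fA p 1 (xi j) = - / RtoC (1 - p) * / (1 - xi j).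
Proof.
  intros H. rewrite fA_1_l. pose proof RtoC_q_neq_0. pose proof (one_minus_neq_0 xi j H).
  set (q := RtoC (1 - p)) in *. field. auto.
Qed.

Lemma Bd_finv_1 a j : In j Vs -> j <> a -> Bd a (fun xi => / fA p 1 (xi j)).
Proof.
  intros Hj H. apply (Bd_ext a (fun xi => - / RtoC (1 - p) * / (1 - xi j))).
  - intros xi Hxi. symmetry. now apply finv_1.
  - apply (Bd_mult a (fun _ => - / RtoC (1 - p)) (fun xi => / (1 - xi j))); [apply Bd_const|now apply Bd_oneinv].
Qed.

(** [Dq a F F1]: [F1] is the value of [F] at [xi_a = 1], in the sense that the difference
    quotient belongs to the class [Bd]. *)
Definition Dq (a : nat) (F F1 : (nat -> C) -> C) : Prop :=
  Bd a F1 /\ exists Q, Bd a Q /\ forall xi, onT xi -> F xi = F1 xi + (1 - xi a) * Q xi.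

Lemma Dq_ext a F G F1 G1 : (forall xi, onT xi -> F xi = G xi) -> (forall xi, onT xi -> F1 xi = G1 xi) ->
  Dq a F F1 -> Dq a G G1.
Proof.
  intros H H1 [HB (Q & HQ & E)]. split; [now apply (Bd_ext a F1)|]. exists Q. split; [exact HQ|].
  intros xi Hxi. rewrite <- H, <- H1 by assumption. now apply E.
Qed.

Lemma Dq_indep a F : Bd a F -> Dq a F F.
Proof.
  intros H. split; [exact H|]. exists (fun _ => 0). split; [apply Bd_const|]. intros; ring.
Qed.

Lemma Dq_zero a F : Bd a F -> Dq a (fun xi => (1 - xi a) * F xi) (fun _ => 0).
Proof.
  intros H. split; [apply Bd_const|]. exists F. split; [exact H|]. intros; ring.
Qed.

Lemma Dq_plus a F F1 G G1 : Dq a F F1 -> Dq a G G1 -> Dq a (fun xi => F xi + G xi) (fun xi => F1 xi + G1 xi).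
Proof.
  intros [HF (Q & HQ & EF)] [HG (Q' & HQ' & EG)]. split; [now apply Bd_plus|].
  exists (fun xi => Q xi + Q' xi). split; [now apply Bd_plus|]. intros xi Hxi. rewrite EF, EG by assumption. ring.
Qed.

Lemma Dq_mult a F F1 G G1 : In a Vs -> Dq a F F1 -> Dq a G G1 ->
  Dq a (fun xi => F xi * G xi) (fun xi => F1 xi * G1 xi).
Proof.
  intros Ha [HF (Q & HQ & EF)] [HG (Q' & HQ' & EG)]. split; [now apply Bd_mult|].
  exists (fun xi => F1 xi * Q' xi + Q xi * (G1 xi + (1 - xi a) * Q' xi)). split.
  - apply (Bd_plus a (fun xi => F1 xi * Q' xi) (fun xi => Q xi * (G1 xi + (1 - xi a) * Q' xi))); [now apply Bd_mult|].
    apply (Bd_mult a Q (fun xi => G1 xi + (1 - xi a) * Q' xi)); [assumption|].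
    apply (Bd_plus a G1 (fun xi => (1 - xi a) * Q' xi)); [assumption|].
    apply (Bd_mult a (fun xi => 1 - xi a) Q'); [|assumption].
    apply (Bd_minus a (fun _ => 1) (fun xi => xi a)); [apply Bd_const|now apply Bd_var].
  - intros xi Hxi. rewrite EF, EG by assumption. ring.
Qed.

Lemma Dq_bsum {T : Type} a (F F1 : T -> (nat -> C) -> C) l : (forall v, In v l -> Dq a (F v) (F1 v)) ->
  Dq a (fun xi => bsum (fun v => F v xi) l) (fun xi => bsum (fun v => F1 v xi) l).
Proof.
  induction l as [|v l IH]; intros H; [apply (Dq_indep a (fun _ => 0)), Bd_const|].
  apply (Dq_plus a (F v) (F1 v) (fun xi => bsum (fun v => F v xi) l) (fun xi => bsum (fun v => F1 v xi) l));
    [apply H; now left|]. apply IH. intros; apply H; now right.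
Qed.

Lemma Dq_bprod {T : Type} a (F F1 : T -> (nat -> C) -> C) l : In a Vs -> (forall v, In v l -> Dq a (F v) (F1 v)) ->
  Dq a (fun xi => bprod (fun v => F v xi) l) (fun xi => bprod (fun v => F1 v xi) l).
Proof.
  intros Ha. induction l as [|v l IH]; intros H; [apply (Dq_indep a (fun _ => 1)), Bd_const|].
  apply (Dq_mult a (F v) (F1 v) (fun xi => bprod (fun v => F v xi) l) (fun xi => bprod (fun v => F1 v xi) l));
    [assumption|apply H; now left|]. apply IH. intros; apply H; now right.
Qed.

Lemma Dq_var a : In a Vs -> Dq a (fun xi => xi a) (fun _ => 1).
Proof.
  intros Ha. split; [apply Bd_const|]. exists (fun _ => - (1)). split; [apply Bd_const|]. intros; ring.
Qed.

Lemma Dq_powz a z : In a Vs -> Dq a (fun xi => Cpowz (xi a) z) (fun _ => 1).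
Proof.
  intros Ha.
  assert (Hm : forall n, Dq a (fun xi => Cpowz (xi a) (Z.of_nat n)) (fun _ => 1) /\
                         Dq a (fun xi => Cpowz (xi a) (- Z.of_nat n)) (fun _ => 1)).
  { induction n as [|n [IH1 IH2]].
    - split; apply (Dq_indep a (fun _ => 1)), Bd_const.
    - split.
      + apply (Dq_ext a (fun xi => Cpowz (xi a) (Z.of_nat n) * xi a) _ (fun xi => 1 * 1)).
        * intros xi Hxi. replace (Z.of_nat (S n)) with (Z.of_nat n + 1)%Z by lia.
          rewrite Cpowz_add, Cpowz_1_r by (now apply (onT_neq_0 R0 HR)). reflexivity.
        * intros; ring.
        * apply (Dq_mult a (fun xi => Cpowz (xi a) (Z.of_nat n)) (fun _ => 1) (fun xi => xi a) (fun _ => 1)); auto using Dq_var.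
      + apply (Dq_ext a (fun xi => Cpowz (xi a) (- Z.of_nat n) * Cpowz (xi a) (-1)) _ (fun xi => 1 * 1)).
        * intros xi Hxi. replace (- Z.of_nat (S n))%Z with (- Z.of_nat n + -1)%Z by lia.
          rewrite Cpowz_add by (now apply (onT_neq_0 R0 HR)). reflexivity.
        * intros; ring.
        * apply (Dq_mult a (fun xi => Cpowz (xi a) (- Z.of_nat n)) (fun _ => 1) (fun xi => Cpowz (xi a) (-1)) (fun _ => 1)); auto.
          split; [apply Bd_const|]. exists (fun xi => Cpowz (xi a) (-1)). split; [now apply Bd_powz|].
          intros xi Hxi. rewrite Cpowz_m1_r. field. now apply (onT_neq_0 R0 HR). }
  destruct (Z_le_gt_dec 0 z).
  - destruct (Hm (Z.to_nat z)) as [H _]. now rewrite Z2Nat.id in H.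
  - destruct (Hm (Z.to_nat (- z))) as [_ H]. rewrite Z2Nat.id in H by lia. now rewrite Z.opp_involutive in H.
Qed.

Lemma Dq_finv a j : In a Vs -> In j Vs -> j <> a ->
  Dq a (fun xi => / fA p (xi a) (xi j)) (fun xi => / fA p 1 (xi j)).
Proof.
  intros Ha Hj Hja. split; [now apply Bd_finv_1|].
  exists (fun xi => (RtoC (1 - p) * xi j - 1) * (/ fA p (xi a) (xi j) * / fA p 1 (xi j))). split.
  - apply (Bd_mult a (fun xi => RtoC (1 - p) * xi j - 1) (fun xi => / fA p (xi a) (xi j) * / fA p 1 (xi j))).
    + apply (Bd_minus a (fun xi => RtoC (1 - p) * xi j) (fun _ => 1)); [|apply Bd_const].
      apply (Bd_mult a (fun _ => RtoC (1 - p)) (fun xi => xi j)); [apply Bd_const|now apply Bd_var].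
    + apply (Bd_mult a (fun xi => / fA p (xi a) (xi j)) (fun xi => / fA p 1 (xi j))); [now apply Bd_finv|now apply Bd_finv_1].
  - intros xi Hxi. pose proof (fA_neq_0 xi a j Hxi) as H1. pose proof (fA_1_neq_0 xi j Hxi) as H2.
    (* f is affine in its first argument, which gives the difference quotient of 1/f explicitly. *)
    assert (E : fA p 1 (xi j) - fA p (xi a) (xi j) = (1 - xi a) * (RtoC (1 - p) * xi j - 1))
      by (unfold fA; ring).
    set (u := fA p (xi a) (xi j)) in *. set (v := fA p 1 (xi j)) in *.
    transitivity (/ v + (v - u) * (/ u * / v)); [field; tauto|]. rewrite E. ring.
Qed.

Ltac bd_step :=
  cbv beta;
  match goal with
  | |- Bd ?a (fun xi => ?c) => apply (Bd_const a c)
  | |- Bd ?a (fun xi => @?F xi * @?G xi) => apply (Bd_mult a F G)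
  | |- Bd ?a (fun xi => @?F xi + @?G xi) => apply (Bd_plus a F G)
  | |- Bd ?a (fun xi => @?F xi - @?G xi) => apply (Bd_minus a F G)
  | |- Bd ?a (fun xi => @?F xi / @?G xi) => apply (Bd_mult a F (fun xi => / G xi))
  | |- Bd ?a (fun xi => fA p (xi ?i) (xi ?j)) => apply (Bd_fA a i j)
  | |- Bd ?a (fun xi => / fA p (xi ?a) (xi ?j)) => apply (Bd_finv a j)
  | |- Bd ?a (fun xi => / (RtoC 1 - xi ?i)) => apply (Bd_oneinv a i)
  | |- Bd ?a (fun xi => Cpowz (xi ?i) ?z) => apply (Bd_powz a i z)
  | |- Bd ?a (fun xi => xi ?i) => apply (Bd_var a i)
  | |- Bd ?a (fun xi => bprod xi ?l) => apply (Bd_bprod a (fun v xi => xi v) l); intros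
  | |- Bd ?a (fun xi => bprod (fun v => @?F v xi) ?l) => apply (Bd_bprod a F l); intros
  | |- Bd ?a (fun xi => pprod (fun u v => @?F u v xi) ?l) => apply (Bd_pprod a F l); intros
  | |- Bd ?a (fun xi => bsum (fun v => @?F v xi) ?l) => apply (Bd_bsum a F l); intros
  end.

Lemma Bd_amp a xs z : forall U, incl U Vs -> ~ In a U -> Bd a (amp p sg xs z U).
Proof.
  induction xs as [|x xs IH]; intros U HU Ha;
    assert (Hne : forall v, In v U -> v <> a) by (intros v Hv ->; contradiction).
  - apply (Bd_ext a (fun xi => pprod (fun u v => sg u v * (xi v - xi u)) U *
      ((1 - bprod xi U) * bprod (fun v => / (1 - xi v)) U) * bprod (fun v => Cpowz (xi v) z) U)).
    + intros xi Hxi. cbn [amp]. unfold amp0. rewrite bprod_inv by (intros; now apply one_minus_neq_0). reflexivity.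
    + repeat bd_step; auto.
  - change (Bd a (fun xi => bsum (fun l => bprod (fun v => sg l v * fA p (xi l) (xi v)) (rem1 l U) *
                     Cpowz (xi l) x * amp p sg xs z (rem1 l U) xi) U)).
    apply (Bd_bsum a (fun l xi => bprod (fun v => sg l v * fA p (xi l) (xi v)) (rem1 l U) *
                     Cpowz (xi l) x * amp p sg xs z (rem1 l U) xi)). intros l Hl.
    apply (Bd_mult a (fun xi => bprod (fun v => sg l v * fA p (xi l) (xi v)) (rem1 l U) * Cpowz (xi l) x)
      (amp p sg xs z (rem1 l U))).
    + repeat bd_step; auto; apply in_rem1 in H as [H _]; auto.
    + apply IH; [now apply incl_rem1|]. rewrite in_rem1. tauto.
Qed.

(* The residue of [amp (a :: U)] at [xi_a = 1] is, up to a product of simple factors, [amp U]: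
   this pairs the index sets containing [a] in [S] with those not containing [a]. *)
Lemma Dq_amp a xs z : In a Vs -> forall U, incl U Vs -> NoDup (a :: U) -> (forall v, In v U -> (a < v)%nat) ->
  Dq a (fun xi => (1 - xi a) * amp p sg xs z (a :: U) xi)
       (fun xi => RtoC p ^ length xs * bprod (fun v => xi v - 1) U * amp p sg xs z U xi).
Proof.
  intros HaV. induction xs as [|x xs IH]; intros U HU Hnd Hlt;
    apply NoDup_cons_inv in Hnd as Hnd'; destruct Hnd' as [Ha HndU];
    assert (Hne : forall v, In v U -> v <> a) by (intros v Hv ->; contradiction);
    assert (Hsg : forall v, In v U -> sg a v = 1)
      by (intros v Hv; unfold sg; specialize (Hlt v Hv); destruct (Nat.ltb_spec a v); [reflexivity|lia]);
    assert (Hsg' : forall v, In v U -> sg v a = - (1))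
      by (intros v Hv; unfold sg; specialize (Hlt v Hv); destruct (Nat.ltb_spec v a); [lia|reflexivity]).
  - apply (Dq_ext a (fun xi => bprod (fun v => xi v - xi a) U *
       ((1 - xi a * bprod xi U) * Cpowz (xi a) z) *
       (pprod (fun u v => sg u v * (xi v - xi u)) U * bprod (fun v => / (1 - xi v)) U * bprod (fun v => Cpowz (xi v) z) U))
      _ (fun xi => bprod (fun v => xi v - 1) U * ((1 - 1 * bprod xi U) * 1) *
       (pprod (fun u v => sg u v * (xi v - xi u)) U * bprod (fun v => / (1 - xi v)) U * bprod (fun v => Cpowz (xi v) z) U))).
    + intros xi Hxi. cbn [amp]. rewrite amp0_regular by assumption.
      rewrite (bprod_ext (fun v => sg a v * (xi v - xi a)) (fun v => xi v - xi a)); [ring|].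
      intros v Hv. rewrite Hsg by assumption. ring.
    + intros xi Hxi. cbn [amp length]. unfold amp0. rewrite bprod_inv by (intros; now apply one_minus_neq_0).
      change (RtoC p ^ 0) with (RtoC 1). unfold Cdiv. ring.
    + apply (Dq_mult a (fun xi => bprod (fun v => xi v - xi a) U * ((1 - xi a * bprod xi U) * Cpowz (xi a) z))
        (fun xi => bprod (fun v => xi v - 1) U * ((1 - 1 * bprod xi U) * 1))); [assumption| |apply Dq_indep; repeat bd_step; auto].
      apply (Dq_mult a (fun xi => bprod (fun v => xi v - xi a) U) (fun xi => bprod (fun v => xi v - 1) U)
        (fun xi => (1 - xi a * bprod xi U) * Cpowz (xi a) z) (fun xi => (1 - 1 * bprod xi U) * 1)); [assumption| |].
      * apply (Dq_bprod a (fun v xi => xi v - xi a) (fun v xi => xi v - 1)); [assumption|]. intros v Hv.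
        split; [repeat bd_step; auto|]. exists (fun _ => 1). split; [apply Bd_const|]. intros; ring.
      * apply (Dq_mult a (fun xi => 1 - xi a * bprod xi U) (fun xi => 1 - 1 * bprod xi U)); [assumption| |now apply Dq_powz].
        split; [repeat bd_step; auto|]. exists (fun xi => bprod xi U). split; [repeat bd_step; auto|]. intros; ring.
  - apply (Dq_ext a (fun xi => (1 - xi a) * (bprod (fun v => sg a v * fA p (xi a) (xi v)) U * Cpowz (xi a) x * amp p sg xs z U xi) +
      bsum (fun l => (sg l a * fA p (xi l) (xi a)) *
      (bprod (fun v => sg l v * fA p (xi l) (xi v)) (rem1 l U) * Cpowz (xi l) x) *
      ((1 - xi a) * amp p sg xs z (a :: rem1 l U) xi)) U)
      _ (fun xi => 0 + bsum (fun l => (RtoC p * (xi l - 1)) *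
      (bprod (fun v => sg l v * fA p (xi l) (xi v)) (rem1 l U) * Cpowz (xi l) x) *
      (RtoC p ^ length xs * bprod (fun v => xi v - 1) (rem1 l U) * amp p sg xs z (rem1 l U) xi)) U)).
    + intros xi Hxi. rewrite amp_cons_split, Cmult_plus_distr_l, <- bsum_scal by assumption.
      f_equal. apply bsum_ext. intros l Hl. ring.
    + intros xi Hxi. cbn [amp length]. rewrite Cplus_0_l, <- bsum_scal. apply bsum_ext. intros l Hl.
      rewrite (bprod_perm _ _ _ (rem1_perm l U HndU Hl)), bprod_cons, Cpow_S. ring.
    + apply (Dq_plus a (fun xi => (1 - xi a) * (bprod (fun v => sg a v * fA p (xi a) (xi v)) U * Cpowz (xi a) x * amp p sg xs z U xi))
        (fun _ => 0) (fun xi => bsum (fun l => (sg l a * fA p (xi l) (xi a)) *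
          (bprod (fun v => sg l v * fA p (xi l) (xi v)) (rem1 l U) * Cpowz (xi l) x) *
          ((1 - xi a) * amp p sg xs z (a :: rem1 l U) xi)) U)
        (fun xi => bsum (fun l => (RtoC p * (xi l - 1)) *
          (bprod (fun v => sg l v * fA p (xi l) (xi v)) (rem1 l U) * Cpowz (xi l) x) *
          (RtoC p ^ length xs * bprod (fun v => xi v - 1) (rem1 l U) * amp p sg xs z (rem1 l U) xi)) U)).
      (* The choice ell_1 = a leaves no pole at 1, so after multiplication by 1 - xi_a its value
         there is 0. *)
      * apply (Dq_zero a (fun xi => bprod (fun v => sg a v * fA p (xi a) (xi v)) U * Cpowz (xi a) x * amp p sg xs z U xi)).
        apply (Bd_mult a (fun xi => bprod (fun v => sg a v * fA p (xi a) (xi v)) U * Cpowz (xi a) x) (amp p sg xs z U));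
          [repeat bd_step; auto | now apply Bd_amp].
      * apply (Dq_bsum a (fun l xi => (sg l a * fA p (xi l) (xi a)) *
          (bprod (fun v => sg l v * fA p (xi l) (xi v)) (rem1 l U) * Cpowz (xi l) x) *
          ((1 - xi a) * amp p sg xs z (a :: rem1 l U) xi))
         (fun l xi => (RtoC p * (xi l - 1)) *
          (bprod (fun v => sg l v * fA p (xi l) (xi v)) (rem1 l U) * Cpowz (xi l) x) *
          (RtoC p ^ length xs * bprod (fun v => xi v - 1) (rem1 l U) * amp p sg xs z (rem1 l U) xi))).
        intros l Hl.
        apply (Dq_mult a (fun xi => (sg l a * fA p (xi l) (xi a)) *
          (bprod (fun v => sg l v * fA p (xi l) (xi v)) (rem1 l U) * Cpowz (xi l) x))
          (fun xi => (RtoC p * (xi l - 1)) *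
          (bprod (fun v => sg l v * fA p (xi l) (xi v)) (rem1 l U) * Cpowz (xi l) x))
          (fun xi => (1 - xi a) * amp p sg xs z (a :: rem1 l U) xi)
          (fun xi => RtoC p ^ length xs * bprod (fun v => xi v - 1) (rem1 l U) * amp p sg xs z (rem1 l U) xi)); [assumption| |].
        -- apply (Dq_mult a (fun xi => sg l a * fA p (xi l) (xi a)) (fun xi => RtoC p * (xi l - 1))
             (fun xi => bprod (fun v => sg l v * fA p (xi l) (xi v)) (rem1 l U) * Cpowz (xi l) x)
             (fun xi => bprod (fun v => sg l v * fA p (xi l) (xi v)) (rem1 l U) * Cpowz (xi l) x)); [assumption| |].
           (* f(xi_l, 1) = p (1 - xi_l), and [sg l a] is -1 because a is the smallest index. Each of
              the m - 1 choices thus contributes a factor p. *)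
           ++ split; [repeat bd_step; auto|]. exists (fun xi => RtoC (1 - p) * xi l). split; [repeat bd_step; auto|].
              intros xi _. rewrite Hsg' by assumption. unfold fA. rewrite RtoC_minus. ring.
           ++ apply Dq_indep. repeat bd_step; auto; apply in_rem1 in H as [H _]; auto.
        -- apply IH; [now apply incl_rem1|now apply NoDup_cons_rem1|].
           intros v Hv. apply in_rem1 in Hv as [Hv _]. auto.
Qed.

Notation EE := (EE R0 Vs).

Lemma monoU_dec U y a xi : onT xi -> NoDup U -> In a U -> monoU U (dec a y) xi = monoU U y xi * xi a.
Proof.
  intros Hxi Hnd Ha. unfold monoU. rewrite !(bprod_perm _ _ _ (rem1_perm a U Hnd Ha)), !bprod_cons.
  rewrite (bprod_ext (fun v => Cpowz (xi v) (- dec a y v)) (fun v => Cpowz (xi v) (- y v))).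
  - rewrite dec_same. replace (- (y a - 1))%Z with (- y a + 1)%Z by lia.
    rewrite Cpowz_add, Cpowz_1_r by now apply (onT_neq_0 R0 HR). ring.
  - intros v Hv. apply in_rem1 in Hv as [_ Hv]. now rewrite dec_other.
Qed.

Lemma monoU_ext U y y' xi : (forall v, In v U -> y v = y' v) -> monoU U y xi = monoU U y' xi.
Proof. intros H. apply bprod_ext. intros v Hv. now rewrite H. Qed.

Lemma monoU_dec_notin U y a xi : ~ In a U -> monoU U (dec a y) xi = monoU U y xi.
Proof. intros H. apply monoU_ext. intros v Hv. apply dec_other. intros ->; contradiction. Qed.

Lemma EE_minus A B F G : LC A F -> LC B G -> EE (fun xi => F xi - G xi) = EE F - EE G.
Proof.
  intros HF HG. rewrite (EE_ext R0 Vs HR _ (fun xi => F xi + - (1) * G xi)) by (intros; ring).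
  rewrite (EE_plus R0 Vs HR HVs A B F (fun xi => - (1) * G xi)), (EE_scal R0 Vs HR HVs B) by (try apply LC_scal; assumption). ring.
Qed.

Lemma EE_antisym F i j : In i Vs -> In j Vs -> LC (fun _ => True) F ->
  (forall xi, onT xi -> F (fun v => xi (sw i j v)) = - F xi) -> EE F = 0.
Proof.
  intros Hi Hj HF H.
  assert (E : EE F = - (1) * EE F).
  { rewrite <- (EE_scal R0 Vs HR HVs _ _ F HF). rewrite <- (EE_sw R0 Vs HR HVs F i j Hi Hj HF) at 1.
    apply EE_ext; [assumption|]. intros xi Hxi. rewrite H by assumption. ring. }
  assert (H2 : RtoC 2 <> 0) by (intros H2; apply RtoC_inj in H2; lra).
  assert (E2 : RtoC 2 * EE F = 0).
  { transitivity (EE F - (- (1) * EE F)); [|rewrite <- E; ring].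
    replace (RtoC 2) with (1 + 1) by (rewrite <- RtoC_plus; f_equal; ring). ring. }
  transitivity (/ RtoC 2 * (RtoC 2 * EE F)); [field; exact H2|]. rewrite E2. ring.
Qed.

(** * Cancellation of the index sets with and without the first index *)

Section Bracket.
Variables (xs : list Z) (z : Z) (X : Z) (a : nat) (U : list nat).
Hypothesis HX : incr X xs z.
Hypothesis Hnd : NoDup (a :: U).
Hypothesis Hincl : incl (a :: U) Vs.
Hypothesis Hlt : forall v, In v U -> (a < v)%nat.

Let Ha : ~ In a U.
Proof. now apply NoDup_cons_inv in Hnd. Qed.
Let HndU : NoDup U.
Proof. now apply NoDup_cons_inv in Hnd. Qed.
Let HaV : In a Vs.
Proof. apply Hincl; now left. Qed.
Let HUV : incl U Vs.
Proof. intros v Hv; apply Hincl; now right. Qed.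
Let Hne : forall v, In v U -> v <> a.
Proof. intros v Hv ->; contradiction. Qed.

(** Normalises the |U| - 1 denominators between xi_j and the rest of [U]: what remains is the
    product of the xi_u xi_v / f, which expands in non-positive powers and is put back in
    [Gint_bracket_vanish]. *)
Definition nrm (xi : nat -> C) : C := bprod (fun j => Cpowz (xi j) (1 - Z.of_nat (length U))) U.

(** [K] is the set of j whose denominator f(xi_a, xi_j) is kept; the integrand of the theorem
    corresponds to K = U. *)
Definition F_in (K : list nat) (xi : nat -> C) : C :=
  amp p sg xs z (a :: U) xi * nrm xi * bprod (fun j => / fA p (xi a) (xi j)) K.

(** The value of (1 - xi_a) [F_in K] at xi_a = 1, no longer containing xi_a. *)
Definition F_out (K : list nat) (xi : nat -> C) : C :=
  RtoC p ^ length xs * bprod (fun v => xi v - 1) U * amp p sg xs z U xi * nrm xi *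
  bprod (fun j => / fA p 1 (xi j)) K.

Definition bracket (K : list nat) (y : nat -> Z) : C :=
  EE (fun xi => F_in K xi * monoU (a :: U) y xi) + EE (fun xi => F_out K xi * monoU U y xi).

Lemma LCw_F_in w K y : (forall v, In v (a :: U) -> w v = 0%Z) -> incl K U ->
  LCw w 0 (fun xi => F_in K xi * monoU (a :: U) y xi).
Proof.
  intros Hw HK. unfold F_in, nrm, monoU.
  assert (Hwa : w a = 0%Z) by (apply Hw; now left).
  assert (Hw0 : forall v, In v U -> w v = 0%Z) by (intros; apply Hw; now right).
  apply (LCw_ext _ _ (fun xi => amp p sg xs z (a :: U) xi * (bprod (fun j => Cpowz (xi j) (1 - Z.of_nat (length U))) U
    * bprod (fun j => / fA p (xi a) (xi j)) K * bprod (fun v => Cpowz (xi v) (- y v)) (a :: U)))); [intros; ring|].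
  lcw_mult 0%Z 0%Z; [lia|now apply LCw_amp_wt0|].
  repeat lc_step; auto; rewrite ?Hw by auto; rewrite ?Hwa, ?Hw0 by auto; lia.
Qed.

Lemma LCw_F_out w K y : (forall v, In v U -> w v = 0%Z) -> incl K U ->
  LCw w 0 (fun xi => F_out K xi * monoU U y xi).
Proof.
  intros Hw HK. unfold F_out, nrm, monoU.
  apply (LCw_ext _ _ (fun xi => amp p sg xs z U xi * (RtoC p ^ length xs * bprod (fun v => xi v - 1) U *
    bprod (fun j => Cpowz (xi j) (1 - Z.of_nat (length U))) U
    * bprod (fun j => - / RtoC (1 - p) * / (1 - xi j)) K * bprod (fun v => Cpowz (xi v) (- y v)) U))).
  { intros xi Hxi. rewrite (bprod_ext (fun j => / fA p 1 (xi j)) (fun j => - / RtoC (1 - p) * / (1 - xi j)))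
      by (intros; now apply finv_1). ring. }
  lcw_mult 0%Z 0%Z; [lia|now apply LCw_amp_wt0|].
  repeat lc_step; auto; rewrite ?Hw by auto; lia.
Qed.

Lemma LC_F_in K y : incl K U -> LC (fun _ => True) (fun xi => F_in K xi * monoU (a :: U) y xi).
Proof. intros H. apply (LCw_LC (fun _ => 0%Z) 0). now apply LCw_F_in. Qed.

Lemma LC_F_out K y : incl K U -> LC (fun _ => True) (fun xi => F_out K xi * monoU U y xi).
Proof. intros H. apply (LCw_LC (fun _ => 0%Z) 0). now apply LCw_F_out. Qed.

(** Multiplication by f(xi_a, xi_j) = p - xi_a + q xi_a xi_j cancels the denominator of j, and the
    factors xi_a and xi_a xi_j are decrements of y. The same holds at xi_a = 1 for [F_out], on which
    decrementing y_a has no effect. *)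
Lemma bracket_rec j K y : NoDup (j :: K) -> incl (j :: K) U ->
  RtoC p * bracket (j :: K) y - bracket (j :: K) (dec a y) + RtoC (1 - p) * bracket (j :: K) (dec a (dec j y)) = bracket K y.
Proof.
  intros _ HK. assert (HKU : incl K U) by (intros v Hv; apply HK; now right).
  assert (Hj : In j U) by (apply HK; now left).
  unfold bracket.
  assert (E1 : EE (fun xi => F_in K xi * monoU (a :: U) y xi) =
     RtoC p * EE (fun xi => F_in (j :: K) xi * monoU (a :: U) y xi)
     - EE (fun xi => F_in (j :: K) xi * monoU (a :: U) (dec a y) xi)
     + RtoC (1 - p) * EE (fun xi => F_in (j :: K) xi * monoU (a :: U) (dec a (dec j y)) xi)).
  { rewrite <- !(EE_scal R0 Vs HR HVs (fun _ => True)) by now apply LC_F_in.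
    rewrite <- (EE_minus (fun _ => True) (fun _ => True)) by (try apply LC_scal; auto; now apply LC_F_in).
    rewrite <- (EE_plus R0 Vs HR HVs (fun _ => True) (fun _ => True)
      (fun xi => RtoC p * (F_in (j :: K) xi * monoU (a :: U) y xi) - F_in (j :: K) xi * monoU (a :: U) (dec a y) xi)
      (fun xi => RtoC (1 - p) * (F_in (j :: K) xi * monoU (a :: U) (dec a (dec j y)) xi))).
    - apply EE_ext; [assumption|]. intros xi Hxi.
      rewrite !monoU_dec by (auto; (now left) || (now right)). unfold F_in. rewrite bprod_cons.
      pose proof (fA_neq_0 xi a j Hxi) as Hf.
      transitivity (amp p sg xs z (a :: U) xi * nrm xi * bprod (fun j0 => / fA p (xi a) (xi j0)) K * monoU (a :: U) y xi *
         (fA p (xi a) (xi j) * / fA p (xi a) (xi j))); [field; exact Hf|].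
      unfold fA at 2. ring.
    - apply (LC_ext _ _ _ (fun xi => RtoC p * (F_in (j :: K) xi * monoU (a :: U) y xi) +
         - (1) * (F_in (j :: K) xi * monoU (a :: U) (dec a y) xi))); [intros; ring|].
      apply LC_plus; apply LC_scal; auto; now apply LC_F_in.
    - apply LC_scal; auto; now apply LC_F_in. }
  assert (E2 : EE (fun xi => F_out K xi * monoU U y xi) =
     RtoC p * EE (fun xi => F_out (j :: K) xi * monoU U y xi)
     - EE (fun xi => F_out (j :: K) xi * monoU U (dec a y) xi)
     + RtoC (1 - p) * EE (fun xi => F_out (j :: K) xi * monoU U (dec a (dec j y)) xi)).
  { rewrite <- !(EE_scal R0 Vs HR HVs (fun _ => True)) by now apply LC_F_out.
    rewrite <- (EE_minus (fun _ => True) (fun _ => True)) by (try apply LC_scal; auto; now apply LC_F_out).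
    rewrite <- (EE_plus R0 Vs HR HVs (fun _ => True) (fun _ => True)
      (fun xi => RtoC p * (F_out (j :: K) xi * monoU U y xi) - F_out (j :: K) xi * monoU U (dec a y) xi)
      (fun xi => RtoC (1 - p) * (F_out (j :: K) xi * monoU U (dec a (dec j y)) xi))).
    - apply EE_ext; [assumption|]. intros xi Hxi.
      rewrite !monoU_dec_notin by assumption. rewrite monoU_dec by auto. unfold F_out. rewrite bprod_cons.
      pose proof (fA_1_neq_0 xi j Hxi) as Hf.
      set (B := RtoC p ^ length xs * bprod (fun v => xi v - 1) U * amp p sg xs z U xi * nrm xi).
      transitivity (B * bprod (fun j0 => / fA p 1 (xi j0)) K * monoU U y xi *
         (fA p 1 (xi j) * / fA p 1 (xi j))); [field; exact Hf|].
      unfold fA at 2. ring.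
    - apply (LC_ext _ _ _ (fun xi => RtoC p * (F_out (j :: K) xi * monoU U y xi) +
         - (1) * (F_out (j :: K) xi * monoU U (dec a y) xi))); [intros; ring|].
      apply LC_plus; apply LC_scal; auto; now apply LC_F_out.
    - apply LC_scal; auto; now apply LC_F_out. }
  rewrite E1, E2. ring.
Qed.

Lemma bprod_sw (G : nat -> C) L i j : NoDup L -> (In i L <-> In j L) ->
  bprod (fun v => G (sw i j v)) L = bprod G L.
Proof.
  intros HL Hij. rewrite <- bprod_map. now apply bprod_perm, sw_perm.
Qed.

(** Both indices lie in [K], so the kept denominators are symmetric in xi_i and xi_j, and the powers
    are symmetric as [y i = y j]. The factor [amp] alone changes sign. *)
Lemma bracket_antisym K i j y : NoDup K -> incl K U -> In i K -> In j K -> i <> j -> y i = y j -> bracket K y = 0.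
Proof.
  intros HK HKU Hi Hj Hij Hy. unfold bracket.
  assert (Hiu : In i U) by auto. assert (Hju : In j U) by auto.
  assert (Hy' : forall v, y (sw i j v) = y v).
  { intros v. destruct (Nat.eq_dec v i) as [->|H1]; [now rewrite sw_l|].
    destruct (Nat.eq_dec v j) as [->|H2]; [now rewrite sw_r|]. now rewrite sw_other. }
  assert (Hsa : sw i j a = a) by (apply sw_other; intros ->; contradiction).
  assert (Hmon : forall L xi, NoDup L -> In i L -> In j L -> monoU L y (fun v => xi (sw i j v)) = monoU L y xi).
  { intros L xi HL HiL HjL. unfold monoU.
    rewrite <- (bprod_sw (fun v => Cpowz (xi v) (- y v)) L i j HL) by tauto.
    apply bprod_ext. intros v _. now rewrite Hy'. }
  assert (Hnrm : forall xi, nrm (fun v => xi (sw i j v)) = nrm xi).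
  { intros xi. unfold nrm. apply (bprod_sw (fun v => Cpowz (xi v) (1 - Z.of_nat (length U)))); tauto. }
  rewrite (EE_antisym (fun xi => F_in K xi * monoU (a :: U) y xi) i j), (EE_antisym (fun xi => F_out K xi * monoU U y xi) i j); auto.
  - ring.
  - now apply LC_F_out.
  - intros xi Hxi. unfold F_out. rewrite Hmon, Hnrm, amp_antisym by auto.
    rewrite (bprod_sw (fun v => xi v - 1) U i j) by tauto.
    rewrite (bprod_sw (fun v => / fA p 1 (xi v)) K i j) by tauto. ring.
  - now apply LC_F_in.
  - intros xi Hxi. unfold F_in. rewrite Hmon, Hnrm, amp_antisym by (auto; now right).
    rewrite Hsa, (bprod_sw (fun v => / fA p (xi a) (xi v)) K i j) by tauto. ring.
Qed.

(** [H] has degree 0 for every weight supported at a, that is, it does not involve xi_a. Expanded at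
    infinity, 1/(1 - xi_a) has only negative powers, hence mean 0; multiplying by xi_a again and
    again subtracts the powers 1, xi_a, xi_a^2, ..., of which only the first has a non-zero mean. *)
Lemma EE_geom_tail H k : (forall w, (forall v, v <> a -> w v = 0%Z) -> LCw w 0 H) ->
  EE (fun xi => H xi * (Cpowz (xi a) (Z.of_nat (S k)) * / (1 - xi a))) = - EE H.
Proof.
  intros contour_sum.
  assert (HL : LC (fun _ => True) H) by (apply (LCw_LC (fun _ => 0%Z) 0); now apply contour_sum).
  assert (Hsupp : forall z' v, v <> a -> dl a z' v = 0%Z) by (intros; now apply dl_other).
  assert (H1 : forall m, LC (fun _ => True) (fun xi => H xi * (Cpowz (xi a) m * / (1 - xi a)))).
  { intros m. apply (LCw_LC (fun _ => 0%Z) 0).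
    lcw_mult 0%Z 0%Z; [lia|now apply contour_sum|]. repeat lc_step; auto; lia. }
  induction k as [|k IH].
  - rewrite (EE_ext R0 Vs HR _ (fun xi => H xi * (Cpowz (xi a) 0 * / (1 - xi a)) - H xi)).
    + rewrite (EE_minus (fun _ => True) (fun _ => True)) by auto.
      rewrite (EE_neg (dl a 1) (-1) (fun xi => H xi * (Cpowz (xi a) 0 * / (1 - xi a)))); [ring|lia|].
      lcw_mult 0%Z (-1)%Z; [lia|apply contour_sum; auto|].
      lcw_mult 0%Z (-1)%Z; [lia| |].
      * apply LCw_powz; [assumption|lia].
      * apply LCw_oneinv; rewrite ?dl_same; auto; lia.
    + intros xi Hxi. pose proof (one_minus_neq_0 xi a Hxi). simpl Z.of_nat.
      rewrite Cpowz_1_r, Cpowz_0_r. field. assumption.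
  - rewrite (EE_ext R0 Vs HR _ (fun xi => H xi * (Cpowz (xi a) (Z.of_nat (S k)) * / (1 - xi a)) - H xi * Cpowz (xi a) (Z.of_nat (S k)))).
    + assert (H2 : LCw (dl a (-1)) (- Z.of_nat (S k)) (fun xi => H xi * Cpowz (xi a) (Z.of_nat (S k)))).
      { lcw_mult 0%Z (- Z.of_nat (S k))%Z; [lia|apply contour_sum; auto|].
        apply LCw_powz; rewrite ?dl_same; auto; lia. }
      rewrite (EE_minus (fun _ => True) (fun _ => True)), IH by (auto; now apply LCw_LC in H2).
      rewrite (EE_neg (dl a (-1)) (- Z.of_nat (S k)) (fun xi => H xi * Cpowz (xi a) (Z.of_nat (S k)))); [ring|lia|assumption].
    + intros xi Hxi. pose proof (one_minus_neq_0 xi a Hxi).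
      replace (Z.of_nat (S (S k))) with (Z.of_nat (S k) + 1)%Z by lia.
      rewrite Cpowz_add, Cpowz_1_r by (now apply (onT_neq_0 R0 HR)). field. assumption.
Qed.

(** [F_in] is split into its value at the pole over 1 - xi_a and a remainder [Q]. By [EE_geom_tail]
    the first part has minus the mean of [F_out]; for y_a far to the left the second carries too
    high a power of xi_a. *)
Lemma bracket_low K y : NoDup K -> incl K U ->
  exists B, forall y', (forall v, v <> a -> y' v = y v) -> (y' a < B)%Z -> bracket K y' = 0.
Proof.
  intros HK HKU.
  pose (Psi := fun xi : nat -> C => (1 - xi a) * amp p sg xs z (a :: U) xi * (nrm xi * (bprod (fun j => / fA p (xi a) (xi j)) K * monoU U y xi))).
  pose (Psi1 := fun xi : nat -> C => F_out K xi * monoU U y xi).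
  assert (HD : Dq a Psi Psi1).
  { apply (Dq_ext a Psi _ (fun xi => RtoC p ^ length xs * bprod (fun v => xi v - 1) U * amp p sg xs z U xi *
       (nrm xi * (bprod (fun j => / fA p 1 (xi j)) K * monoU U y xi)))).
    - reflexivity.
    - intros xi _. unfold Psi1, F_out. ring.
    - unfold Psi.
      apply (Dq_mult a (fun xi => (1 - xi a) * amp p sg xs z (a :: U) xi)
        (fun xi => RtoC p ^ length xs * bprod (fun v => xi v - 1) U * amp p sg xs z U xi)
        (fun xi => nrm xi * (bprod (fun j => / fA p (xi a) (xi j)) K * monoU U y xi))
        (fun xi => nrm xi * (bprod (fun j => / fA p 1 (xi j)) K * monoU U y xi))); [assumption|now apply Dq_amp|].
      apply (Dq_mult a nrm nrm (fun xi => bprod (fun j => / fA p (xi a) (xi j)) K * monoU U y xi)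
        (fun xi => bprod (fun j => / fA p 1 (xi j)) K * monoU U y xi)); [assumption|apply Dq_indep; unfold nrm; repeat bd_step; auto|].
      apply (Dq_mult a (fun xi => bprod (fun j => / fA p (xi a) (xi j)) K)
        (fun xi => bprod (fun j => / fA p 1 (xi j)) K) (fun xi => monoU U y xi) (fun xi => monoU U y xi)); [assumption| |].
      + apply (Dq_bprod a (fun j xi => / fA p (xi a) (xi j)) (fun j xi => / fA p 1 (xi j))); [assumption|].
        intros j Hj. apply Dq_finv; auto.
      + apply Dq_indep. unfold monoU. repeat bd_step; auto. }
  destruct HD as [_ (Q & [d HQ] & E)].
  (* Below 0 the exponent - y_a is positive, as [EE_geom_tail] needs; below - d the remainder has
     negative weight. *)
  exists (Z.min 0 (- d)). intros y' Hy' Hya. unfold bracket.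
  assert (HyU : forall xi, monoU U y' xi = monoU U y xi).
  { intros xi. apply monoU_ext. auto. }
  rewrite (EE_ext R0 Vs HR (fun xi => F_out K xi * monoU U y' xi) Psi1) by (intros; now rewrite HyU).
  set (k := Z.to_nat (- y' a - 1)).
  assert (Hk : (- y' a)%Z = Z.of_nat (S k)) by lia.
  rewrite (EE_ext R0 Vs HR _ (fun xi => Psi1 xi * (Cpowz (xi a) (Z.of_nat (S k)) * / (1 - xi a)) + Q xi * Cpowz (xi a) (- y' a))).
  - assert (HP1 : forall w, (forall v, v <> a -> w v = 0%Z) -> LCw w 0 Psi1)
      by (intros w Hw; apply LCw_F_out; auto).
    assert (HL : LC (fun _ => True) Psi1) by now apply LC_F_out.
    assert (HQ2 : LCw (wout a) (d + y' a) (fun xi => Q xi * Cpowz (xi a) (- y' a))).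
    { lcw_mult d%Z (y' a)%Z; [lia|assumption|].
      apply LCw_powz; [assumption|]. unfold wout. rewrite Nat.eqb_refl. lia. }
    rewrite (EE_plus R0 Vs HR HVs (fun _ => True) (fun _ => True)
      (fun xi => Psi1 xi * (Cpowz (xi a) (Z.of_nat (S k)) * / (1 - xi a))) (fun xi => Q xi * Cpowz (xi a) (- y' a))).
    + rewrite EE_geom_tail by assumption.
      rewrite (EE_neg (wout a) (d + y' a) (fun xi => Q xi * Cpowz (xi a) (- y' a))); [ring|lia|assumption].
    + apply (LCw_LC (fun _ => 0%Z) 0).
      lcw_mult 0%Z 0%Z; [lia|now apply HP1|]. repeat lc_step; auto; lia.
    + now apply LCw_LC in HQ2.
  - intros xi Hxi. specialize (E xi Hxi). pose proof (one_minus_neq_0 xi a Hxi) as H1.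
    unfold monoU. rewrite bprod_cons. fold (monoU U y' xi). rewrite HyU, Hk.
    transitivity (Psi xi * (Cpowz (xi a) (Z.of_nat (S k)) * / (1 - xi a))).
    + unfold Psi, F_in. field. assumption.
    + rewrite E. field. assumption.
Qed.

(** While y_a < X and y_a < y_i, a step of y_a to the left does not change the bracket: the
    difference contains 1 - xi_a, which clears the pole at 1, and [amp_single_pole] controls the
    rest. Far to the left [bracket_low] applies. *)
Lemma bracket_single i y : In i U -> (y a < X)%Z -> (y a < y i)%Z -> bracket [i] y = 0.
Proof.
  intros Hi HyX Hyi.
  assert (HiU : incl [i] U) by (intros v [<-|[]]; assumption).
  set (W := rem1 i U).
  assert (HP : Permutation U (i :: W)) by now apply rem1_perm.
  assert (Hia : i <> a) by auto.
  assert (HW : forall v, In v W -> In v U /\ v <> i) by (intros v Hv; now apply in_rem1).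
  assert (Hlen : length U = S (length W)) by now apply length_rem1.
  assert (HndW : NoDup (a :: i :: W)).
  { apply (Permutation_NoDup (l := a :: U)); [now constructor|assumption]. }
  assert (HinclW : incl (a :: i :: W) Vs).
  { intros v [<-|Hv]; [assumption|]. apply HUV. now apply (Permutation_in _ (Permutation_sym HP)). }
  destruct (amp_single_pole xs z a i W X HndW HinclW HX) as (G1 & G2 & EG & HG1 & HG2).
  assert (Hstep : forall y', (forall v, v <> a -> y' v = y v) -> (y' a <= y a)%Z -> bracket [i] y' = bracket [i] (dec a y')).
  { intros y' Hy' Hya. unfold bracket.
    assert (Hyi' : y' i = y i) by auto.
    rewrite (EE_ext R0 Vs HR (fun xi => F_out [i] xi * monoU U (dec a y') xi) (fun xi => F_out [i] xi * monoU U y' xi))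
      by (intros; now rewrite monoU_dec_notin).
    f_equal.
    assert (E0 : EE (fun xi => F_in [i] xi * monoU (a :: U) y' xi) - EE (fun xi => F_in [i] xi * monoU (a :: U) (dec a y') xi) = 0).
    { rewrite <- (EE_minus (fun _ => True) (fun _ => True)) by now apply LC_F_in.
      pose (M := fun xi : nat -> C => nrm xi * monoU U y' xi * Cpowz (xi a) (- y' a)).
      assert (HM1 : LCw (dl a (-1)) (y' a) M).
      { apply (LCw_mult _ 0 (y' a) _ (fun xi => nrm xi * monoU U y' xi) (fun xi => Cpowz (xi a) (- y' a))); [lia| |].
        - unfold nrm, monoU. repeat lc_step; auto; rewrite dl_other by auto; lia.
        - apply LCw_powz; rewrite ?dl_same; auto; lia. }
      (* [nrm] contributes 1 - |U| = -|W| to the exponent of xi_i and so absorbs the degree |W| of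
         [G2]. *)
      assert (HM2 : LCw (wdiff i a) (- Z.of_nat (length W) - y i + y' a) M).
      { apply (LCw_ext _ _ (fun xi => (bprod (fun j => Cpowz (xi j) (1 - Z.of_nat (length U))) W * monoU W y' xi) *
           (Cpowz (xi i) (1 - Z.of_nat (length U)) * (Cpowz (xi i) (- y' i) * Cpowz (xi a) (- y' a))))).
        { intros xi _. unfold M, nrm, monoU. rewrite !(bprod_perm _ _ _ HP), !bprod_cons. ring. }
        lcw_mult 0%Z (- Z.of_nat (length W) - y i + y' a)%Z; [lia| |].
        - unfold monoU. repeat lc_step; try (apply HUV; now apply HW);
            match goal with H : In ?v W |- _ => destruct (HW v H); rewrite wdiff_other by auto; lia end.
        - lcw_mult (- Z.of_nat (length W))%Z (- y i + y' a)%Z; [lia| |].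
          + apply LCw_powz; [auto|]. rewrite wdiff_l by assumption. lia.
          + lcw_mult (- y i)%Z (y' a)%Z; [lia| |];
              apply LCw_powz; auto; rewrite ?wdiff_l, ?wdiff_r by assumption; lia. }
      assert (H1 : LCw (dl a (-1)) (- X + y' a) (fun xi => G1 xi * M xi)) by (apply (LCw_mult _ (- X) (y' a)); auto; lia).
      assert (H2 : LCw (wdiff i a) (- y i + y' a) (fun xi => G2 xi * M xi))
        by (apply (LCw_mult _ (Z.of_nat (length W)) (- Z.of_nat (length W) - y i + y' a)); auto; lia).
      rewrite (EE_ext R0 Vs HR _ (fun xi => G1 xi * M xi + G2 xi * M xi)).
      - rewrite (EE_plus R0 Vs HR HVs _ _ _ _ H1 H2).
        rewrite (EE_neg (dl a (-1)) (- X + y' a) (fun xi => G1 xi * M xi)),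
          (EE_neg (wdiff i a) (- y i + y' a) (fun xi => G2 xi * M xi)) by (assumption || lia). ring.
      - intros xi Hxi. rewrite monoU_dec by (auto; now left).
        rewrite <- Cmult_plus_distr_r, <- EG by assumption. unfold F_in, M.
        rewrite (amp_perm p sg xs z sg_antisym (a :: U) (a :: i :: W)) by (auto; now constructor).
        rewrite bprod_cons, bprod_nil. unfold monoU at 1 2. rewrite !bprod_cons. fold (monoU U y' xi).
        unfold Cdiv. ring. }
    set (A := EE (fun xi => F_in [i] xi * monoU (a :: U) y' xi)) in *.
    set (B := EE (fun xi => F_in [i] xi * monoU (a :: U) (dec a y') xi)) in *.
    transitivity (A - B + B); [ring|]. rewrite E0. ring. }
  destruct (bracket_low [i] y (NoDup_cons i (@in_nil nat i) (NoDup_nil nat)) HiU) as (B & HB).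
  assert (Down : forall n y', (forall v, v <> a -> y' v = y v) -> (y' a <= y a)%Z ->
    (y' a < B + Z.of_nat n)%Z -> bracket [i] y' = 0).
  { induction n as [|n IHn]; intros y' Hy' Hya Hn; [apply HB; auto; lia|].
    rewrite Hstep by assumption. apply IHn.
    - intros v Hv. rewrite dec_other by assumption. auto.
    - rewrite dec_same; lia.
    - rewrite dec_same; lia. }
  apply (Down (Z.to_nat (y a - B + 1))); auto; lia.
Qed.

Lemma bracket_perm K K' y : Permutation K K' -> bracket K y = bracket K' y.
Proof.
  intros HP. unfold bracket. f_equal; apply EE_ext; auto; intros xi _; unfold F_in, F_out; now rewrite (bprod_perm _ _ _ HP).
Qed.

Lemma bracket_vanish y : (0 < p)%R -> U <> [] -> (y a < X)%Z -> (forall v, In v U -> (y a < y v)%Z) -> bracket U y = 0.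
Proof.
  intros Hp0 HU0 HyX Hy.
  apply (array_vanish p bracket a U X Hp0 Ha bracket_rec bracket_antisym bracket_low bracket_single bracket_perm); auto using incl_refl.
Qed.

End Bracket.

(** * The initial condition *)

(** The integrand at time 0, summed over all (Lambda, S) with union [U], without the coefficient.
    The powers are - y instead of - y - 1 because the factor xi from d xi is included. *)
Definition Gint (xs : list Z) (z : Z) (U : list nat) (y : nat -> Z) (xi : nat -> C) : C :=
  amp p sg xs z U xi / pprod (fo p xi) U * monoU U y xi.

Lemma LC_bprod {T : Type} (A : (nat -> Z) -> Prop) (F : T -> (nat -> C) -> C) l :
  A (fun _ => 0%Z) -> (forall a b, A a -> A b -> A (eadd a b)) ->
  (forall v, In v l -> LC A (F v)) -> LC A (fun xi => bprod (fun v => F v xi) l).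
Proof.
  intros H0 HA. induction l as [|v l IH]; intros H; [now apply (LC_const R0 Vs A 1)|].
  apply (LC_mult R0 Vs HR A A A (F v) (fun xi => bprod (fun v => F v xi) l)); [assumption|apply H; now left|].
  apply IH. intros; apply H; now right.
Qed.

Lemma LCw_foinv w d l v : In l Vs -> In v Vs -> (0 <= w l)%Z -> (0 <= w v)%Z -> (- (w l + w v) <= d)%Z ->
  LCw w d (fun xi => / fo p xi l v).
Proof.
  intros Hl Hv H1 H2 H3. unfold fo. destruct (Nat.ltb l v); apply LCw_finv; auto; lia.
Qed.

Lemma LCw_dens_inv w U : incl U Vs -> (forall v, In v U -> w v = 0%Z) -> LCw w 0 (fun xi => / pprod (fo p xi) U).
Proof.
  intros HU Hw. apply (LCw_ext _ _ (fun xi => pprod (fun u v => / fo p xi u v) U)).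
  - intros xi Hxi. apply pprod_inv. intros; now apply fo_neq_0.
  - apply (LCw_pprod0 w 0 (fun u v xi => / fo p xi u v)); [lia|]. intros u v Hu Hv.
    apply LCw_foinv; auto; rewrite ?(Hw u), ?(Hw v) by assumption; lia.
Qed.

Lemma LCw_monoU w U y : incl U Vs -> (forall v, In v U -> w v = 0%Z) -> LCw w 0 (monoU U y).
Proof.
  intros HU Hw. apply (LCw_bprod0 w 0 (fun v xi => Cpowz (xi v) (- y v))); [lia|]. intros v Hv.
  apply LCw_powz; auto. rewrite Hw by assumption; lia.
Qed.

Lemma LCw_Gint w xs z U y : incl U Vs -> (forall v, In v U -> w v = 0%Z) -> LCw w 0 (Gint xs z U y).
Proof.
  intros HU Hw. unfold Gint.
  lcw_mult 0%Z 0%Z; [lia| |now apply LCw_monoU].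
  apply (LCw_mult w 0 0 0 (amp p sg xs z U) (fun xi => / pprod (fo p xi) U)); [lia|now apply LCw_amp_wt0|now apply LCw_dens_inv].
Qed.

Lemma LC_Gint xs z U y : incl U Vs -> LC (fun _ => True) (Gint xs z U y).
Proof. intros HU. apply (LCw_LC (fun _ => 0%Z) 0). now apply LCw_Gint. Qed.

Definition Gterm (x : Z) (xs : list Z) (z : Z) (U : list nat) (y : nat -> Z) (l : nat) (xi : nat -> C) : C :=
  bprod (fun v => sg l v * (fA p (xi l) (xi v) * / fo p xi l v)) (rem1 l U) * Gint xs z (rem1 l U) y xi *
  Cpowz (xi l) (x - y l).

(** Each f(xi_l, xi_v) of the numerator is matched by an f in the denominator, so only the explicit
    power contributes to the highest exponent of xi_l. Hence a particle to the right of x cannot be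
    chosen for x. *)
Lemma LCw_Gterm x xs z U y l : incl U Vs -> In l U -> LCw (dl l 1) (x - y l) (Gterm x xs z U y l).
Proof.
  intros HU Hl. unfold Gterm.
  lcw_mult 0%Z (x - y l)%Z; [lia| |apply LCw_powz; rewrite ?dl_same; auto; lia].
  lcw_mult 0%Z 0%Z; [lia| |].
  - apply (LCw_bprod0 _ 0 (fun v xi => sg l v * (fA p (xi l) (xi v) * / fo p xi l v))); [lia|]. intros v Hv.
    apply in_rem1 in Hv as [Hv Hvl]. apply LCw_scal.
    lcw_mult 1%Z (-1)%Z; [lia| |].
    + apply LCw_fA; try assumption; auto; rewrite ?dl_same, ?(dl_other l 1 v) by assumption; lia.
    + apply LCw_foinv; try assumption; auto; rewrite ?dl_same, ?(dl_other l 1 v) by assumption; lia.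
  - apply LCw_Gint; [now apply incl_rem1|]. intros v Hv. apply in_rem1 in Hv as [_ Hv]. now apply dl_other.
Qed.

Lemma Gint_cons x xs z U y xi : NoDup U -> onT xi ->
  Gint (x :: xs) z U y xi = bsum (fun l => Gterm x xs z U y l xi) U.
Proof.
  intros HU Hxi. unfold Gint at 1, Cdiv. cbn [amp].
  set (K := / pprod (fo p xi) U * monoU U y xi).
  transitivity (K * bsum (fun l => bprod (fun v => sg l v * fA p (xi l) (xi v)) (rem1 l U) * Cpowz (xi l) x *
     amp p sg xs z (rem1 l U) xi) U); [unfold K; ring|].
  rewrite <- bsum_scal. apply bsum_ext. intros l Hl. unfold K, Gterm, Gint, Cdiv.
  pose proof (rem1_perm l U HU Hl) as HP.
  rewrite (pprod_perm _ _ _ (fo_sym p xi) HP), pprod_cons.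
  unfold monoU. rewrite (bprod_perm _ _ _ HP), bprod_cons.
  assert (H1 : bprod (fo p xi l) (rem1 l U) <> 0) by (apply bprod_neq_0; intros; now apply fo_neq_0).
  assert (H2 : pprod (fo p xi) (rem1 l U) <> 0) by (apply pprod_neq_0; intros; now apply fo_neq_0).
  rewrite (bprod_ext (fun v => sg l v * (fA p (xi l) (xi v) * / fo p xi l v))
    (fun v => sg l v * fA p (xi l) (xi v) * / fo p xi l v)) by (intros; ring).
  rewrite (bprod_mult (fun v => sg l v * fA p (xi l) (xi v))), bprod_inv by (intros; now apply fo_neq_0).
  unfold Z.sub. rewrite Cpowz_add by now apply (onT_neq_0 R0 HR).
  field. tauto.
Qed.

Lemma EE_Gint_cons x xs z U y : incl U Vs -> NoDup U ->
  EE (Gint (x :: xs) z U y) = bsum (fun l => EE (Gterm x xs z U y l)) U.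
Proof.
  intros HU HndU. rewrite (EE_ext R0 Vs HR _ (fun xi => bsum (fun l => Gterm x xs z U y l xi) U))
    by (intros; now apply Gint_cons).
  apply (EE_bsum R0 Vs HR HVs (fun _ => True)). intros l Hl. now apply (LCw_LC _ _ _ (LCw_Gterm x xs z U y l HU Hl)).
Qed.

(** Degree count in xi_v: each difference is matched by an f, and the factor 1 minus the product by
    1 - xi_v, so the exponent is at most z - y_v. *)
Lemma EE_Gint_nil_decay z U y v : incl U Vs -> NoDup U -> In v U -> (z < y v)%Z -> EE (Gint [] z U y) = 0.
Proof.
  intros HU HndU Hv Hz. set (W := rem1 v U).
  pose proof (rem1_perm v U HndU Hv) as HP. fold W in HP.
  assert (HW : forall u, In u W -> In u Vs /\ u <> v) by (intros u Hu; apply in_rem1 in Hu as [H1 H2]; auto).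
  assert (HvV : In v Vs) by auto.
  assert (Hd : forall u, In u W -> dl v 1 u = 0%Z) by (intros u Hu; apply dl_other; now apply HW).
  apply (EE_neg (dl v 1) (z - y v)); [lia|].
  apply (LCw_ext _ _ (fun xi =>
    (pprod (fun u w => sg u w * (xi w - xi u)) W * bprod (fun u => / (1 - xi u)) W *
      bprod (fun u => Cpowz (xi u) z) W) * (/ pprod (fo p xi) W * monoU W y xi) *
    (bprod (fun u => sg v u * ((xi u - xi v) * / fo p xi v u)) W * ((1 - xi v * bprod xi W) * / (1 - xi v)) *
      Cpowz (xi v) (z - y v)))).
  { intros xi Hxi. unfold Gint. cbn [amp].
    rewrite (amp0_perm sg z U (v :: W) xi sg_antisym HP), (pprod_perm _ _ _ (fo_sym p xi) HP), pprod_cons.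
    unfold amp0, monoU. rewrite (bprod_perm _ _ _ HP), pprod_cons, !bprod_cons.
    assert (H1 : bprod (fo p xi v) W <> 0) by (apply bprod_neq_0; intros; now apply fo_neq_0).
    assert (H2 : pprod (fo p xi) W <> 0) by (apply pprod_neq_0; intros; now apply fo_neq_0).
    assert (H3 : bprod (fun u => 1 - xi u) W <> 0) by (apply bprod_neq_0; intros; now apply one_minus_neq_0).
    pose proof (one_minus_neq_0 xi v Hxi) as H4.
    rewrite (bprod_ext (fun u => sg v u * ((xi u - xi v) * / fo p xi v u))
      (fun u => sg v u * (xi u - xi v) * / fo p xi v u)) by (intros; ring).
    rewrite (bprod_mult (fun u => sg v u * (xi u - xi v))), !bprod_inv
      by (intros; (now apply fo_neq_0) || now apply one_minus_neq_0).
    unfold Z.sub. rewrite Cpowz_add by now apply (onT_neq_0 R0 HR).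
    field. tauto. }
  lcw_mult 0%Z (z - y v)%Z; [lia| |].
  - lcw_mult 0%Z 0%Z; [lia| |].
    + repeat lc_step; try (now apply HW); rewrite Hd by assumption; lia.
    + lcw_mult 0%Z 0%Z; [lia| |].
      * apply LCw_dens_inv; [intros u Hu; now apply HW|assumption].
      * apply LCw_monoU; [intros u Hu; now apply HW|assumption].
  - lcw_mult 0%Z (z - y v)%Z; [lia| |apply LCw_powz; rewrite ?dl_same; auto; lia].
    lcw_mult 0%Z 0%Z; [lia| |].
    + apply (LCw_bprod0 _ 0 (fun u xi => sg v u * ((xi u - xi v) * / fo p xi v u))); [lia|]. intros u Hu. apply LCw_scal.
      destruct (HW u Hu) as [HuV Huv].
      lcw_mult 1%Z (-1)%Z; [lia| |].
      * apply (LCw_minus _ 1 (fun xi => xi u) (fun xi => xi v)); apply LCw_var; rewrite ?dl_same, ?(Hd u) by assumption; auto; lia.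
      * apply LCw_foinv; rewrite ?dl_same, ?(Hd u) by assumption; auto; lia.
    + lcw_mult 1%Z (-1)%Z; [lia| |].
      * apply (LCw_minus _ 1 (fun _ => 1) (fun xi => xi v * bprod xi W)); [apply LCw_const; lia|].
        lcw_mult 1%Z 0%Z; [lia|apply LCw_var; rewrite ?dl_same; auto; lia|].
        repeat lc_step; try (now apply HW); rewrite Hd by assumption; lia.
      * apply LCw_oneinv; rewrite ?dl_same; auto; lia.
Qed.

Lemma EE_Gterm_decay x xs z U y l : incl U Vs -> In l U -> (x < y l)%Z -> EE (Gterm x xs z U y l) = 0.
Proof.
  intros HU Hl Hx. apply (EE_neg (dl l 1) (x - y l)); [lia|]. now apply LCw_Gterm.
Qed.

Lemma EE_Gint_small xs z U y : NoDup U -> (length U <= length xs)%nat -> EE (Gint xs z U y) = 0.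
Proof.
  intros HU H. rewrite (EE_ext R0 Vs HR _ (fun _ => 0)); [now apply EE_const|].
  intros xi _. unfold Gint. rewrite amp_small by assumption. unfold Cdiv. ring.
Qed.

Lemma EE_Gint_decay xs z U y : incl U Vs -> NoDup U ->
  (forall v, In v U -> (hd z xs < y v)%Z) -> EE (Gint xs z U y) = 0.
Proof.
  intros HU HndU H. destruct xs as [|x xs].
  - destruct U as [|v U]; [now apply EE_Gint_small|].
    apply (EE_Gint_nil_decay z (v :: U) y v); auto; [now left|]. apply H; now left.
  - rewrite EE_Gint_cons by assumption. apply bsum_0. intros l Hl. apply EE_Gterm_decay; auto.
Qed.

Lemma EE_powz a k : In a Vs -> EE (fun xi => Cpowz (xi a) k) = if Z.eqb k 0 then 1 else 0.
Proof.
  intros Ha. destruct (Z.eqb_spec k 0) as [->|Hk].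
  - rewrite (EE_ext R0 Vs HR _ (fun _ => 1)) by reflexivity. now apply EE_const.
  - destruct (Z_lt_ge_dec k 0).
    + apply (EE_neg (dl a 1) k); [assumption|]. apply LCw_powz; rewrite ?dl_same; auto; lia.
    + apply (EE_neg (dl a (-1)) (- k)); [lia|]. apply LCw_powz; rewrite ?dl_same; auto; lia.
Qed.

Lemma Gint_single z a y xi : onT xi -> Gint [] z [a] y xi = Cpowz (xi a) (z - y a).
Proof.
  intros Hxi. unfold Gint, monoU. cbn [amp]. unfold amp0. rewrite !pprod_cons, !pprod_nil, !bprod_cons, !bprod_nil.
  unfold Z.sub. rewrite Cpowz_add by now apply (onT_neq_0 R0 HR).
  pose proof (one_minus_neq_0 xi a Hxi) as H. field. exact H.
Qed.

(** As a is the smallest index, each f(xi_a, xi_v) equals its partner in the denominator and all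
    signs are 1; with y_a = x nothing of xi_a is left. *)
Lemma EE_Gterm_first x xs z a U y : NoDup (a :: U) -> incl (a :: U) Vs -> (forall v, In v U -> (a < v)%nat) ->
  y a = x -> EE (Gterm x xs z (a :: U) y a) = EE (Gint xs z U y).
Proof.
  intros Hnd Hincl Hlt Hy. apply NoDup_cons_inv in Hnd as [Ha HU].
  apply EE_ext; [assumption|]. intros xi Hxi. unfold Gterm. rewrite rem1_cons_eq by assumption.
  rewrite Hy, Z.sub_diag, Cpowz_0_r. rewrite bprod_1; [ring|].
  intros v Hv. specialize (Hlt v Hv). unfold sg, fo. destruct (Nat.ltb_spec a v); [|lia].
  pose proof (fA_neq_0 xi a v Hxi). field. assumption.
Qed.

(** Compared with the bracket for K = U only the denominators inside U are missing. They expand in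
    non-positive powers, which move the y_v to the right and so preserve y_a < y_v. *)
Lemma Gint_bracket_vanish xs z X a U y : (0 < p)%R -> incr X xs z -> NoDup (a :: U) -> incl (a :: U) Vs ->
  (forall v, In v U -> (a < v)%nat) -> (y a < X)%Z -> (forall v, In v U -> (y a < y v)%Z) ->
  EE (Gint xs z (a :: U) y) + RtoC p ^ length xs * (/ RtoC (1 - p)) ^ length U * EE (Gint xs z U y) = 0.
Proof.
  intros Hp0 HX Hnd Hincl Hlt HyX Hy.
  pose proof Hnd as Hnd'. apply NoDup_cons_inv in Hnd' as [Ha HU].
  assert (HaV : In a Vs) by (apply Hincl; now left).
  assert (HUV : incl U Vs) by (intros v Hv; apply Hincl; now right).
  destruct (list_eq_dec Nat.eq_dec U []) as [->|HU0].
  (* The empty set: for m = 1 the mean of xi_a^(z - y_a) is 0 because z >= X > y_a; for m > 1 both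
     integrands vanish. *)
  { rewrite (EE_Gint_small xs z []) by (auto; simpl; lia).
    destruct xs as [|x xs].
    - rewrite (EE_ext R0 Vs HR _ (fun xi => Cpowz (xi a) (z - y a))) by (intros; now apply Gint_single).
      rewrite EE_powz by assumption. simpl in HX. destruct (Z.eqb_spec (z - y a) 0); [lia|ring].
    - rewrite EE_Gint_small by (auto; simpl; lia). ring. }
  assert (Hlen : (1 <= length U)%nat) by (destruct U; [contradiction|simpl; lia]).
  pose (A := fun e : nat -> Z => (forall v, (e v <= 0)%Z) /\ forall v, ~ In v U -> e v = 0%Z).
  pose (F := fun xi => F_in xs z a U U xi * monoU (a :: U) y xi + F_out xs z U U xi * monoU U y xi).
  pose (G := fun xi => pprod (fun u v => xi u * xi v / fo p xi u v) U).
  assert (L1 : forall y', LC (fun _ => True) (fun xi => F_in xs z a U U xi * monoU (a :: U) y' xi))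
    by (intros; apply LC_F_in; auto using incl_refl).
  assert (L2 : forall y', LC (fun _ => True) (fun xi => F_out xs z U U xi * monoU U y' xi))
    by (intros; apply (LC_F_out xs z a U Hincl); auto using incl_refl).
  assert (HG : LC A G).
  { unfold G, pprod. assert (A0 : A (fun _ => 0%Z)) by (split; intros; lia).
    assert (Aa : forall e e', A e -> A e' -> A (eadd e e')).
    { intros e e' [H1 H2] [H3 H4]. unfold eadd. split; intros v; [specialize (H1 v); specialize (H3 v); lia|].
      intros Hv. rewrite H2, H4 by assumption. reflexivity. }
    apply (LC_bprod A (fun ab xi => xi (fst ab) * xi (snd ab) / fo p xi (fst ab) (snd ab))); [assumption..|].
    intros [u v] Huv. apply in_pairs in Huv as [Hu Hv]. simpl in Hu, Hv |- *.
    assert (Ad : forall w, In w U -> A (dl w (-1))).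
    { intros w Hw. unfold dl. split; intros t; destruct (Nat.eqb_spec t w); subst; try lia; intros; contradiction. }
    unfold fo. destruct (Nat.ltb u v).
    - apply LC_fnorm; auto.
    - apply (LC_ext _ _ _ (fun xi => xi v * xi u / fA p (xi v) (xi u))); [intros; unfold Cdiv; ring|].
      apply LC_fnorm; auto. }
  assert (E : EE (fun xi => F xi * G xi) = 0).
  { apply (EE_mult_zero R0 Vs HR HVs A (fun _ => True)); [now apply LC_plus|assumption|].
    intros e [He1 He2]. pose (y' := fun v => (y v - e v)%Z).
    assert (Hm : forall xi, mono Vs e xi = bprod (fun i => Cpowz (xi i) (e i)) U).
    { intros xi. apply mono_supp; auto. }
    rewrite (EE_ext R0 Vs HR _ (fun xi => F_in xs z a U U xi * monoU (a :: U) y' xi + F_out xs z U U xi * monoU U y' xi)).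
    - rewrite (EE_plus R0 Vs HR HVs _ _ _ _ (L1 y') (L2 y')).
      apply (bracket_vanish xs z X a U HX Hnd Hincl Hlt y' Hp0 HU0).
      + unfold y'. rewrite He2 by assumption. lia.
      + intros v Hv. unfold y'. rewrite (He2 a) by assumption. specialize (He1 v). specialize (Hy v Hv). lia.
    - intros xi Hxi. unfold F. rewrite Hm.
      assert (Hmu : monoU U y' xi = monoU U y xi * bprod (fun i => Cpowz (xi i) (e i)) U).
      { unfold monoU. rewrite <- bprod_mult. apply bprod_ext. intros v Hv. unfold y'.
        rewrite <- Cpowz_add by (now apply (onT_neq_0 R0 HR)). f_equal. lia. }
      assert (Hmau : monoU (a :: U) y' xi = monoU (a :: U) y xi * bprod (fun i => Cpowz (xi i) (e i)) U).
      { unfold monoU in *. rewrite !bprod_cons, Hmu. unfold y' at 1. rewrite (He2 a), Z.sub_0_r by assumption. ring. }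
      rewrite Hmu, Hmau. ring. }
  rewrite <- E.
  set (kap := RtoC p ^ length xs * (/ RtoC (1 - p)) ^ length U).
  rewrite <- (EE_scal R0 Vs HR HVs (fun _ => True)) by now apply LC_Gint.
  rewrite <- (EE_plus R0 Vs HR HVs (fun _ => True) (fun _ => True) (Gint xs z (a :: U) y) (fun xi => kap * Gint xs z U y xi))
    by (try (apply LC_scal; [assumption|]); now apply LC_Gint).
  apply EE_ext; [assumption|]. intros xi Hxi.
  assert (HN : nrm U xi * G xi = / pprod (fo p xi) U).
  { unfold nrm, G. rewrite (pprod_ext _ (fun u v => (xi u * xi v) * / fo p xi u v)) by reflexivity.
    rewrite pprod_mult, pprod_separate, pprod_inv by (intros; now apply fo_neq_0).
    rewrite Cmult_assoc, <- bprod_mult. rewrite bprod_1; [ring|]. intros v Hv.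
    rewrite <- Cpowz_nat, <- Cpowz_add by (now apply (onT_neq_0 R0 HR)).
    replace (1 - Z.of_nat (length U) + Z.of_nat (length U - 1))%Z with 0%Z by lia. reflexivity. }
  (* Each v contributes (xi_v - 1) / f(1, xi_v) = 1/q. *)
  assert (HU1 : bprod (fun v => xi v - 1) U * bprod (fun j => / fA p 1 (xi j)) U = (/ RtoC (1 - p)) ^ length U).
  { rewrite <- bprod_mult, <- bprod_const. apply bprod_ext. intros v Hv.
    pose proof (one_minus_neq_0 xi v Hxi). rewrite finv_1 by assumption.
    pose proof RtoC_q_neq_0. set (q := RtoC (1 - p)) in *. field. tauto. }
  assert (HF1 : bprod (fun j => / fA p (xi a) (xi j)) U * bprod (fo p xi a) U = 1).
  { rewrite <- bprod_mult. apply bprod_1. intros v Hv. unfold fo. specialize (Hlt v Hv).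
    destruct (Nat.ltb_spec a v); [|lia]. pose proof (fA_neq_0 xi a v Hxi). field. assumption. }
  assert (H1 : bprod (fo p xi a) U <> 0) by (apply bprod_neq_0; intros; now apply fo_neq_0).
  assert (H2 : pprod (fo p xi) U <> 0) by (apply pprod_neq_0; intros; now apply fo_neq_0).
  unfold F, Gint, F_in, F_out, kap, Cdiv. rewrite pprod_cons.
  replace (/ (bprod (fo p xi a) U * pprod (fo p xi) U)) with (bprod (fun j => / fA p (xi a) (xi j)) U * (nrm U xi * G xi)).
  - rewrite <- HN, <- HU1. ring.
  - rewrite HN. transitivity (bprod (fun j => / fA p (xi a) (xi j)) U * bprod (fo p xi a) U * / (bprod (fo p xi a) U * pprod (fo p xi) U));
      [field; tauto|]. rewrite HF1. ring.
Qed.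

(** * Totally asymmetric case p = 0 *)

Lemma finv_p0 xi a v : p = 0%R -> onT xi -> / fA p (xi a) (xi v) = - Cpowz (xi a) (-1) * / (1 - xi v).
Proof.
  intros Hp0 Hxi. unfold fA. rewrite Hp0, Rminus_0_r, Cpowz_m1_r.
  pose proof (one_minus_neq_0 xi v Hxi) as H1. pose proof (onT_neq_0 R0 HR xi a Hxi) as H2.
  assert (H3 : xi v - 1 <> 0) by (intros H; apply H1; transitivity (- (xi v - 1)); [ring|rewrite H; ring]).
  replace (RtoC 0 + 1 * xi a * xi v - xi a) with (xi a * (xi v - 1)) by ring.
  field. tauto.
Qed.

(** Here f(xi_a, xi_v) = xi_a (xi_v - 1), so each denominator lowers the exponent of xi_a by one. A
    choice other than a uses up one denominator and raises the lower bound for the later positions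
    to x + 1, which pays for it; the choice a cancels all denominators left. *)
Lemma LCw_amp_p0 xs z : p = 0%R -> forall a U X, NoDup (a :: U) -> incl (a :: U) Vs -> incr X xs z ->
  length U = length xs ->
  LCw (dl a (-1)) (- X) (fun xi => amp p sg xs z (a :: U) xi * bprod (fun v => / fA p (xi a) (xi v)) U).
Proof.
  intros Hp0. induction xs as [|x xs IH]; intros a U X Hnd Hincl HX Hlen;
    apply NoDup_cons_inv in Hnd as Hnd'; destruct Hnd' as [Ha HU];
    assert (HaV : In a Vs) by (apply Hincl; now left);
    assert (HUV : incl U Vs) by (intros v Hv; apply Hincl; now right);
    assert (Hne : forall v, In v U -> dl a (-1) v = 0%Z) by (intros v Hv; apply dl_other; intros ->; contradiction).
  - destruct U; [|discriminate]. simpl in HX.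
    apply (LCw_ext _ _ (fun xi => Cpowz (xi a) z)); [|apply LCw_powz; rewrite ?dl_same; auto; lia].
    intros xi Hxi. pose proof (one_minus_neq_0 xi a Hxi) as H. cbn [amp]. unfold amp0.
    rewrite !pprod_cons, !pprod_nil, !bprod_cons, !bprod_nil. field. exact H.
  - destruct HX as [HX1 HX2].
    apply (LCw_ext _ _ (fun xi => bprod (fun v => sg a v) U * Cpowz (xi a) x * amp p sg xs z U xi +
      bsum (fun l => (sg l a * (fA p (xi l) (xi a) * bprod (fun v => sg l v * fA p (xi l) (xi v)) (rem1 l U) * Cpowz (xi l) x)
         * / fA p (xi a) (xi l)) *
        (amp p sg xs z (a :: rem1 l U) xi * bprod (fun v => / fA p (xi a) (xi v)) (rem1 l U))) U)).
    { intros xi Hxi. rewrite amp_cons_split, Cmult_plus_distr_r by assumption. f_equal.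
      - transitivity (Cpowz (xi a) x * amp p sg xs z U xi *
          (bprod (fun v => sg a v * fA p (xi a) (xi v)) U * bprod (fun v => / fA p (xi a) (xi v)) U)); [|ring].
        rewrite <- bprod_mult. rewrite (bprod_ext (fun v => _ * / _) (fun v => sg a v)); [ring|].
        intros v Hv. pose proof (fA_neq_0 xi a v Hxi). field. assumption.
      - rewrite (Cmult_comm (bsum _ U)), <- bsum_scal. apply bsum_ext. intros l Hl.
        rewrite (bprod_perm _ _ _ (rem1_perm l U HU Hl)), bprod_cons. ring. }
    apply (LCw_plus _ _ (fun xi => bprod (fun v => sg a v) U * Cpowz (xi a) x * amp p sg xs z U xi)
      (fun xi => bsum (fun l => (sg l a * (fA p (xi l) (xi a) * bprod (fun v => sg l v * fA p (xi l) (xi v)) (rem1 l U) * Cpowz (xi l) x)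
         * / fA p (xi a) (xi l)) *
        (amp p sg xs z (a :: rem1 l U) xi * bprod (fun v => / fA p (xi a) (xi v)) (rem1 l U))) U)).
    + lcw_mult (- x)%Z 0%Z;
        [lia| |now apply LCw_amp_wt0]. apply LCw_scal. apply LCw_powz; rewrite ?dl_same; auto; lia.
    + apply (LCw_bsum _ _ (fun l xi => (sg l a * (fA p (xi l) (xi a) * bprod (fun v => sg l v * fA p (xi l) (xi v)) (rem1 l U) * Cpowz (xi l) x)
         * / fA p (xi a) (xi l)) *
        (amp p sg xs z (a :: rem1 l U) xi * bprod (fun v => / fA p (xi a) (xi v)) (rem1 l U)))). intros l Hl.
      lcw_mult 1%Z (- (x + 1))%Z; [lia| |].
      * lcw_mult 0%Z 1%Z; [lia| |].
        -- repeat lc_step; auto; try (apply in_rem1 in H as [H _]); auto; rewrite ?(Hne l Hl), ?dl_same; try lia.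
           rewrite (Hne a0 H). lia.
        -- apply (LCw_ext _ _ (fun xi => - (1) * (Cpowz (xi a) (-1) * / (1 - xi l)))).
           { intros xi Hxi. rewrite finv_p0 by assumption. ring. }
           apply LCw_scal. lcw_mult 1%Z 0%Z; [lia| |].
           ++ apply LCw_powz; rewrite ?dl_same; auto; lia.
           ++ apply LCw_oneinv; auto; rewrite (Hne l Hl); lia.
      * apply IH; [now apply NoDup_cons_rem1| |assumption|].
        -- intros v [<-|Hv]; [assumption|]. apply in_rem1 in Hv as [Hv _]; auto.
        -- rewrite (length_rem1 l U) in Hlen by assumption. simpl in Hlen. lia.
Qed.

Lemma EE_Gint_p0 xs z X a U y : p = 0%R -> incr X xs z -> NoDup (a :: U) -> incl (a :: U) Vs ->
  (forall v, In v U -> (a < v)%nat) -> length U = length xs -> (y a < X)%Z -> EE (Gint xs z (a :: U) y) = 0.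
Proof.
  intros Hp0 HX Hnd Hincl Hlt Hlen HyX.
  pose proof Hnd as Hnd'. apply NoDup_cons_inv in Hnd' as [Ha HU].
  assert (HaV : In a Vs) by (apply Hincl; now left).
  assert (HUV : incl U Vs) by (intros v Hv; apply Hincl; now right).
  assert (Hne : forall v, In v U -> dl a (-1) v = 0%Z) by (intros v Hv; apply dl_other; intros ->; contradiction).
  apply (EE_neg (dl a (-1)) (- X + y a)); [lia|].
  apply (LCw_ext _ _ (fun xi => (amp p sg xs z (a :: U) xi * bprod (fun v => / fA p (xi a) (xi v)) U) *
    ((/ pprod (fo p xi) U * monoU U y xi) * Cpowz (xi a) (- y a)))).
  { intros xi Hxi. unfold Gint, monoU. rewrite pprod_cons, bprod_cons.
    rewrite (bprod_ext (fo p xi a) (fun v => fA p (xi a) (xi v))).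
    - rewrite bprod_inv by (intros; now apply fA_neq_0).
      assert (bprod (fun v => fA p (xi a) (xi v)) U <> 0) by (apply bprod_neq_0; intros; now apply fA_neq_0).
      assert (pprod (fo p xi) U <> 0) by (apply pprod_neq_0; intros; now apply fo_neq_0).
      field. tauto.
    - intros v Hv. unfold fo. specialize (Hlt v Hv). destruct (Nat.ltb_spec a v); [reflexivity|lia]. }
  lcw_mult (- X)%Z (y a)%Z; [lia|now apply LCw_amp_p0|].
  lcw_mult 0%Z (y a)%Z; [lia| |].
  - lcw_mult 0%Z 0%Z; [lia|now apply LCw_dens_inv|now apply LCw_monoU].
  - apply LCw_powz; rewrite ?dl_same; auto; lia.
Qed.

(* The part of the exponent of [tau] in the theorem that depends on [m] and [k] only, once the
   sums of the [ell_i] and of the elements of [S] are collected into [rank_sum 1 (S ++ Lambda)]. *)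
Definition tau_shift (mm n : nat) : Z := Z.of_nat (mm * (mm - 1) / 2 + mm * (n - mm)).

Definition rank_sum (s0 : nat) (U : list nat) : Z := sumZ (map (fun i => Z.of_nat i - Z.of_nat s0)%Z U).

(** Apart from signs the coefficient of (Lambda, S) depends only on the union [U]. Here [mm] is m -
    1, and ranks are counted from the index [s0] of the first particle still considered. *)
Definition coefU (s0 mm : nat) (U : list nat) : C :=
  RtoC (powerRZ (p / (1 - p)) (rank_sum s0 U - tau_shift mm (length U)) *
        (1 - p) ^ ((length U - mm) * (length U - mm - 1) / 2))%R.

Definition contour0 (s0 : nat) (I : list nat) (xs : list Z) (z : Z) (y : nat -> Z) : C :=
  bsum (fun U => coefU s0 (length xs) U * EE (Gint xs z U y)) (subsets I).

Fixpoint hits (s0 : nat) (xs : list Z) (z : Z) (y : nat -> Z) : bool :=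
  match xs with
  | [] => Z.eqb (y s0) z
  | x :: xs' => andb (Z.eqb (y s0) x) (hits (S s0) xs' z y)
  end.

Lemma rank_sum_cons s0 a U : rank_sum s0 (a :: U) = (Z.of_nat a - Z.of_nat s0 + rank_sum s0 U)%Z.
Proof. reflexivity. Qed.

Lemma rank_sum_shift s0 U : rank_sum s0 U = (rank_sum (S s0) U + Z.of_nat (length U))%Z.
Proof.
  induction U as [|a U IH]; [reflexivity|]. rewrite !rank_sum_cons, IH. simpl length. lia.
Qed.

(** Distinct ranks sum to at least 0 + 1 + ... + (n - 1). Hence the exponent of tau in [coefU] is
    never negative for sets with at least [mm] elements, which matters when tau = 0. *)
Lemma rank_sum_bound n : forall s0 U, In U (subsets (seq s0 n)) ->
  (Z.of_nat (length U) * (Z.of_nat (length U) - 1) <= 2 * rank_sum s0 U)%Z.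
Proof.
  induction n as [|n IH]; intros s0 U; cbn [seq subsets].
  - intros [<-|[]]. unfold rank_sum; simpl. lia.
  - rewrite in_app_iff, in_map_iff. intros [(V & <- & HV)|HU].
    + specialize (IH _ _ HV). rewrite rank_sum_cons, rank_sum_shift. cbn [length]. nia.
    + specialize (IH _ _ HU). rewrite rank_sum_shift. nia.
Qed.

Lemma half_even m : (2 * (m * (m - 1) / 2) = m * (m - 1))%nat.
Proof.
  assert (H : Nat.even (m * (m - 1)) = true).
  { rewrite Nat.even_mul. destruct m as [|m]; [reflexivity|].
    replace (S m - 1)%nat with m by lia. rewrite Nat.even_succ, <- Nat.negb_even. now destruct (Nat.even m). }
  apply Nat.even_spec in H as [k Hk]. rewrite Hk.
  rewrite (Nat.mul_comm 2 k), Nat.div_mul by lia. lia.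
Qed.

(** With k = n - mm, [tau_shift] is n(n - 1)/2 - k(k - 1)/2. Doubling frees later arithmetic from
    the truncated operations on naturals. *)
Lemma tau_shift_2 mm n : (mm <= n)%nat ->
  (2 * tau_shift mm n = Z.of_nat n * (Z.of_nat n - 1) - (Z.of_nat n - Z.of_nat mm) * (Z.of_nat n - Z.of_nat mm - 1))%Z.
Proof.
  intros H. unfold tau_shift. pose proof (half_even mm) as E. set (k := (mm * (mm - 1) / 2)%nat) in *.
  assert (E' : (2 * Z.of_nat k = Z.of_nat mm * (Z.of_nat mm - 1))%Z).
  { destruct mm as [|mm]; [simpl in *; lia|]. replace (S mm - 1)%nat with mm in E by lia. nia. }
  set (r := (n - mm)%nat). replace n with (mm + r)%nat by lia. clearbody k r.
  rewrite !Nat2Z.inj_add, Nat2Z.inj_mul. nia.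
Qed.

(** Taking the first index as ell_1 leaves k unchanged, and the drop of all other ranks by one is
    compensated by [tau_shift]. *)
Lemma coefU_cons_shift s0 mm U : (mm <= length U)%nat -> coefU s0 (S mm) (s0 :: U) = coefU (S s0) mm U.
Proof.
  intros H. unfold coefU. simpl length. rewrite Nat.sub_succ.
  replace (rank_sum s0 (s0 :: U) - tau_shift (S mm) (S (length U)))%Z with (rank_sum (S s0) U - tau_shift mm (length U))%Z; [reflexivity|].
  rewrite rank_sum_cons, (rank_sum_shift s0 U).
  pose proof (tau_shift_2 mm (length U) H). pose proof (tau_shift_2 (S mm) (S (length U)) ltac:(lia)). nia.
Qed.

(** The ratio of the two coefficients is exactly the factor in front of [U] in
    [Gint_bracket_vanish]. This explains the powers of tau and q in the theorem. *)
Lemma coefU_drop_first s0 mm U : (0 < p)%R -> (mm <= length U)%nat ->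
  coefU s0 mm U = coefU s0 mm (s0 :: U) * (RtoC p ^ mm * (/ RtoC (1 - p)) ^ length U).
Proof.
  intros Hp0 H. unfold coefU. simpl length. rewrite rank_sum_cons, Z.sub_diag, Z.add_0_l.
  rewrite <- RtoC_inv, <- !RtoC_pow, <- !RtoC_mult by lra. f_equal.
  assert (E1 : (rank_sum s0 U - tau_shift mm (length U) = (rank_sum s0 U - tau_shift mm (S (length U))) + Z.of_nat mm)%Z).
  { pose proof (tau_shift_2 mm (length U) H). pose proof (tau_shift_2 mm (S (length U)) ltac:(lia)). nia. }
  assert (Ht : (p / (1 - p) <> 0)%R) by (apply Rgt_not_eq, Rdiv_lt_0_compat; lra).
  rewrite E1, powerRZ_add, <- pow_powerRZ by assumption.
  set (k := (length U - mm)%nat).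
  replace (S (length U) - mm)%nat with (S k) by lia.
  assert (E2 : (S k * (S k - 1) / 2 = k * (k - 1) / 2 + k)%nat).
  { pose proof (half_even k). pose proof (half_even (S k)). replace (S k - 1)%nat with k in * by lia.
    destruct k as [|k']; [reflexivity|]. replace (S k' - 1)%nat with k' in * by lia. nia. }
  rewrite E2, pow_add. replace (length U) with (mm + k)%nat by lia. rewrite pow_add.
  unfold Rdiv. rewrite Rpow_mult_distr, !pow_inv.
  assert ((1 - p) ^ k <> 0)%R by (apply pow_nonzero; lra).
  assert ((1 - p) ^ mm <> 0)%R by (apply pow_nonzero; lra).
  field. tauto.
Qed.

Lemma powerRZ_0_pos e : (0 < e)%Z -> powerRZ 0 e = 0%R.
Proof. intros H. destruct e; try lia. simpl. apply pow_i. lia. Qed.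

Lemma coefU_p0 s0 mm U : p = 0%R -> (0 < rank_sum s0 U - tau_shift mm (length U))%Z -> coefU s0 mm U = 0.
Proof.
  intros Hp0 H. unfold coefU. rewrite Hp0. unfold Rdiv at 1. rewrite Rmult_0_l, powerRZ_0_pos, Rmult_0_l by assumption.
  reflexivity.
Qed.

Lemma contour0_zero s0 n xs z y : incl (seq s0 (S n)) Vs -> incr (hd z xs) xs z ->
  (y s0 < hd z xs)%Z -> (forall v, In v (seq (S s0) n) -> (y s0 < y v)%Z) ->
  contour0 s0 (seq s0 (S n)) xs z y = 0.
Proof.
  intros Hincl HX Hy0 Hy. unfold contour0. cbn [seq subsets]. rewrite bsum_app, bsum_map.
  rewrite <- bsum_plus. apply bsum_0. intros U HU.
  assert (HndI : NoDup (seq (S s0) n)) by apply seq_NoDup.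
  assert (HndU : NoDup U) by now apply (subsets_NoDup _ _ HndI).
  pose proof (subsets_incl _ _ HU) as HUI.
  assert (Hlt : forall v, In v U -> (s0 < v)%nat) by (intros v Hv; apply HUI, in_seq in Hv; lia).
  assert (Hnd : NoDup (s0 :: U)) by (constructor; [intros H; specialize (Hlt _ H); lia|assumption]).
  assert (HsV : incl (s0 :: U) Vs).
  { intros v [<-|Hv]; apply Hincl; simpl; [now left|right; auto]. }
  assert (HUV : incl U Vs) by (intros v Hv; apply HsV; now right).
  set (mm := length xs) in *.
  destruct (Nat.lt_ge_cases (length U) mm) as [Hsm|Hge].
  { rewrite !EE_Gint_small by (auto; simpl; lia). ring. }
  destruct (Rle_lt_or_eq_dec 0 p (proj1 Hp)) as [Hp0|Hp0].
  - rewrite (coefU_drop_first s0 mm U Hp0 Hge).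
    transitivity (coefU s0 mm (s0 :: U) * (EE (Gint xs z (s0 :: U) y) + RtoC p ^ mm * (/ RtoC (1 - p)) ^ length U * EE (Gint xs z U y))); [ring|].
    rewrite (Gint_bracket_vanish xs z (hd z xs)); auto. ring.
  (* tau = 0 kills every set with positive exponent. By the rank bound only |U| = m - 1 is left,
     where the set without [s0] is too small and the one with [s0] falls under [EE_Gint_p0]. *)
  - symmetry in Hp0.
    pose proof (rank_sum_bound _ _ _ HU) as B. pose proof (rank_sum_shift s0 U) as Sh.
    pose proof (tau_shift_2 mm (length U) Hge) as D1. pose proof (tau_shift_2 mm (S (length U)) ltac:(lia)) as D2.
    assert (E1 : coefU s0 mm U * EE (Gint xs z U y) = 0).
    { destruct (Nat.eq_dec (length U) mm) as [He|He].
      - rewrite EE_Gint_small by (auto; lia). ring.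
      - rewrite coefU_p0; [ring|assumption|]. nia. }
    assert (E2 : coefU s0 mm (s0 :: U) * EE (Gint xs z (s0 :: U) y) = 0).
    { destruct (Nat.eq_dec (length U) mm) as [He|He].
      - rewrite (EE_Gint_p0 xs z (hd z xs)); auto. ring.
      - rewrite coefU_p0; [ring|assumption|]. simpl length. rewrite rank_sum_cons. nia. }
    rewrite E1, E2. ring.
Qed.

Lemma contour0_initial xs z : forall s0 n y, (length xs < n)%nat -> incl (seq s0 n) Vs ->
  incr (hd z xs) xs z -> (forall i j, (s0 <= i < j)%nat -> (j < s0 + n)%nat -> (y i < y j)%Z) ->
  contour0 s0 (seq s0 n) xs z y = if hits s0 xs z y then 1 else 0.
Proof.
  induction xs as [|x xs IH]; intros s0 n y Hlen Hincl HX Hy;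
    (destruct n as [|n]; [simpl in Hlen; lia|]);
    assert (Hmin : forall v, In v (seq (S s0) n) -> (y s0 < y v)%Z)
      by (intros v Hv; apply in_seq in Hv; apply Hy; lia);
    assert (HndI : NoDup (seq (S s0) n)) by apply seq_NoDup;
    assert (HsV : In s0 Vs) by (apply Hincl; now left);
    assert (HIV : incl (seq (S s0) n) Vs) by (intros v Hv; apply Hincl; now right);
    assert (Hsub : forall U, In U (subsets (seq (S s0) n)) ->
      NoDup U /\ incl U Vs /\ (forall v, In v U -> (s0 < v)%nat /\ (y s0 < y v)%Z) /\ NoDup (s0 :: U) /\ incl (s0 :: U) Vs)
     by (intros U HU; pose proof (subsets_incl _ _ HU) as HUI; pose proof (subsets_NoDup _ _ HndI HU) as HndU;
         assert (Hlt : forall v, In v U -> (s0 < v)%nat /\ (y s0 < y v)%Z)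
          by (intros v Hv; pose proof (HUI v Hv) as H; split; [apply in_seq in H; lia|auto]);
         repeat split; try (apply Hlt; assumption); auto;
         [intros v Hv; auto | constructor; [intros H; apply Hlt in H; lia|assumption] | intros v [<-|Hv]; auto]).
  - simpl hits. destruct (Z.eqb_spec (y s0) z) as [E|E].
    + unfold contour0. cbn [seq subsets]. rewrite bsum_app, bsum_map.
      assert (E2 : bsum (fun U => coefU s0 (length (@nil Z)) U * EE (Gint [] z U y)) (subsets (seq (S s0) n)) = 0).
      { apply bsum_0. intros U HU. destruct (Hsub U HU) as (H1 & H2 & H3 & H4 & H5).
        rewrite EE_Gint_decay; [ring|assumption..|]. intros v Hv. simpl. specialize (H3 v Hv). lia. }
      rewrite E2, Cplus_0_r.
      (* Every index b other than [s0] has y_b > z and is excluded by decay, so only the set {s0}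
         contributes. [I] is general to allow an induction on the list. *)
      assert (E3 : forall I, (forall U, In U (subsets I) -> In U (subsets (seq (S s0) n))) ->
         bsum (fun U => coefU s0 (length (@nil Z)) (s0 :: U) * EE (Gint [] z (s0 :: U) y)) (subsets I) = 1).
      { induction I as [|b I IHI]; intros HI.
        - simpl. rewrite bsum_cons, bsum_nil.
          rewrite (EE_ext R0 Vs HR _ (fun xi => Cpowz (xi s0) (z - y s0))) by (intros; now apply Gint_single).
          rewrite EE_powz by assumption. rewrite E, Z.sub_diag, Z.eqb_refl.
          unfold coefU. simpl length. rewrite rank_sum_cons, Z.sub_diag. unfold rank_sum, tau_shift; simpl.
          rewrite !Rmult_1_l. ring.
        - cbn [subsets]. rewrite bsum_app, bsum_map.
          rewrite bsum_0.
          + rewrite IHI; [ring|]. intros U HU. apply HI. simpl. apply in_or_app. now right.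
          + intros U HU.
            assert (HbU : In (b :: U) (subsets (seq (S s0) n))).
            { apply HI. simpl. apply in_or_app. left. now apply in_map. }
            destruct (Hsub _ HbU) as (H1 & H2 & H3 & H4 & H5).
            rewrite (EE_Gint_nil_decay z (s0 :: b :: U) y b); [ring|assumption..|right; now left|].
            destruct (H3 b (or_introl eq_refl)). lia. }
      apply E3. auto.
    + destruct (Z_lt_ge_dec (y s0) z) as [Hlt|Hge].
      * apply contour0_zero; auto.
      * unfold contour0. apply bsum_0. intros U HU.
        rewrite EE_Gint_decay; [ring| | |].
        -- intros v Hv. apply Hincl. now apply (subsets_incl _ _ HU).
        -- apply (subsets_NoDup (seq s0 (S n))); [apply seq_NoDup|assumption].
        -- intros v Hv. apply (subsets_incl _ _ HU) in Hv. simpl. destruct Hv as [<-|Hv]; [lia|]. specialize (Hmin v Hv). lia.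
  - simpl hits. destruct (Z.eqb_spec (y s0) x) as [E|E].
    (* The first particle sits at x: only sets containing [s0] survive, and in these only ell_1 =
       s0, which leaves the same problem for the remaining particles and positions. *)
    + simpl andb. simpl in Hlen. destruct HX as [HX1 HX2].
      rewrite <- (IH (S s0) n y); [|lia|assumption| |intros i j Hij Hj; apply Hy; lia].
      * unfold contour0. cbn [seq subsets]. rewrite bsum_app, bsum_map.
        assert (E2 : bsum (fun U => coefU s0 (length (x :: xs)) U * EE (Gint (x :: xs) z U y)) (subsets (seq (S s0) n)) = 0).
        { apply bsum_0. intros U HU. destruct (Hsub U HU) as (H1 & H2 & H3 & H4 & H5).
          rewrite EE_Gint_decay; [ring|assumption..|]. intros v Hv. simpl. specialize (H3 v Hv). lia. }
        rewrite E2, Cplus_0_r. apply bsum_ext. intros U HU.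
        destruct (Hsub U HU) as (H1 & H2 & H3 & H4 & H5).
        assert (E3 : EE (Gint (x :: xs) z (s0 :: U) y) = EE (Gint xs z U y)).
        { rewrite EE_Gint_cons, bsum_cons by assumption.
          rewrite EE_Gterm_first by (auto; intros v Hv; now apply H3).
          rewrite bsum_0; [ring|]. intros l Hl. apply EE_Gterm_decay; [assumption|now right|].
          destruct (H3 l Hl). lia. }
        rewrite E3. simpl length.
        destruct (Nat.lt_ge_cases (length U) (length xs)) as [Hs|Hs].
        -- rewrite EE_Gint_small by (auto; lia). ring.
        -- now rewrite coefU_cons_shift.
      * destruct xs as [|x' xs]; simpl in HX2 |- *; [lia|]. destruct HX2; split; [lia|assumption].
    + simpl andb. destruct (Z_lt_ge_dec (y s0) x) as [Hlt|Hge].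
      * apply contour0_zero; auto.
      * unfold contour0. apply bsum_0. intros U HU.
        rewrite EE_Gint_decay; [ring| | |].
        -- intros v Hv. apply Hincl. now apply (subsets_incl _ _ HU).
        -- apply (subsets_NoDup (seq s0 (S n))); [apply seq_NoDup|assumption].
        -- intros v Hv. apply (subsets_incl _ _ HU) in Hv. simpl. destruct Hv as [<-|Hv]; [lia|]. specialize (Hmin v Hv). lia.
Qed.

Definition move (y : nat -> Z) (i : nat) (d : Z) : nat -> Z := fun j => if Nat.eqb j i then (y i + d)%Z else y j.

Lemma move_same y i d : move y i d i = (y i + d)%Z.
Proof. unfold move. now rewrite Nat.eqb_refl. Qed.

Lemma move_other y i d j : j <> i -> move y i d j = y j.
Proof. intros H. unfold move. destruct (Nat.eqb_spec j i); [contradiction|reflexivity]. Qed.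

Lemma monoU_move_in U y i d xi : onT xi -> NoDup U -> In i U ->
  monoU U (move y i d) xi = monoU U y xi * Cpowz (xi i) (- d).
Proof.
  intros Hxi HU Hi. unfold monoU. rewrite !(bprod_perm _ _ _ (rem1_perm i U HU Hi)), !bprod_cons, move_same.
  rewrite (bprod_ext (fun v => Cpowz (xi v) (- move y i d v)) (fun v => Cpowz (xi v) (- y v))).
  - replace (- (y i + d))%Z with (- y i + - d)%Z by lia. rewrite Cpowz_add by now apply (onT_neq_0 R0 HR). ring.
  - intros v Hv. apply in_rem1 in Hv as [_ Hv]. now rewrite move_other.
Qed.

Lemma monoU_move_notin U y i d xi : ~ In i U -> monoU U (move y i d) xi = monoU U y xi.
Proof. intros H. apply monoU_ext. intros v Hv. apply move_other. intros ->; contradiction. Qed.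

Lemma fo_sw_adjacent xi i u v : ~ (u = i /\ v = S i) -> ~ (u = S i /\ v = i) -> u <> v ->
  fo p (fun w => xi (sw i (S i) w)) u v = fo p xi (sw i (S i) u) (sw i (S i) v).
Proof.
  intros H1 H2 H3. unfold fo.
  pose proof (sg_sw_adjacent i u v H1 H2 H3) as Hs. unfold sg in Hs.
  destruct (Nat.ltb u v), (Nat.ltb (sw i (S i) u) (sw i (S i) v)); try reflexivity;
    exfalso; apply RtoC_inj with (x := 1%R) (y := (-1)%R) in Hs || (symmetry in Hs; rewrite <- RtoC_opp in Hs; apply RtoC_inj in Hs); lra.
Qed.

(** * Evolution *)

Section Evolution.
Variables (N : nat) (xs : list Z) (z : Z).
Hypothesis HN : (1 <= N)%nat.
Hypothesis HNV : incl (iota1 N) Vs.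

(** The eigenvalue of the one-ring kernel of N free particles on the product of the xi_i^(-y_i) with
    i in [U]; rings of particles outside [U] do not change this product. *)
Definition lam (U : list nat) (xi : nat -> C) : C := 1 + / RtoC (INR N) * bsum (fun i => epsA p (xi i)) U.

Definition contour_sum (n : nat) (y : nat -> Z) : C :=
  bsum (fun U => coefU 1 (length xs) U * EE (fun xi => lam U xi ^ n * Gint xs z U y xi)) (subsets (iota1 N)).

Let HNR : RtoC (INR N) <> 0.
Proof. intros H. apply RtoC_inj in H. apply lt_0_INR in HN. lra. Qed.

Lemma LC_lam_Gint n U y : incl U Vs -> LC (fun _ => True) (fun xi => lam U xi ^ n * Gint xs z U y xi).
Proof.
  intros HU. apply (LC_mult R0 Vs HR (fun _ => True) (fun _ => True) _ (fun xi => lam U xi ^ n)); [auto| |now apply LC_Gint].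
  apply (LC_pow R0 Vs HR _ (fun xi => lam U xi)); auto. apply (LCw_LC (fun _ => 0%Z) 0). unfold lam, epsA.
  apply (LCw_ext _ _ (fun xi => 1 + / RtoC (INR N) * bsum (fun i => RtoC p * Cpowz (xi i) (-1) + RtoC (1 - p) * xi i - 1) U)).
  { intros xi _. do 2 f_equal. apply bsum_ext. intros i _. now rewrite Cpowz_m1_r. }
  repeat lc_step; auto; lia.
Qed.

Lemma bsum_subset (f : nat -> C) I U : NoDup I -> NoDup U -> incl U I ->
  bsum (fun i => if in_dec Nat.eq_dec i U then f i else 0) I = bsum f U.
Proof.
  intros HI. revert U. induction HI as [|a I Ha HI IH]; intros U HU HUI.
  - destruct U as [|u U]; [reflexivity|]. destruct (HUI u (or_introl eq_refl)).
  - rewrite bsum_cons. destruct (in_dec Nat.eq_dec a U) as [Hin|Hout].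
    + rewrite (bsum_perm f U _ (rem1_perm a U HU Hin)), bsum_cons. f_equal.
      rewrite <- IH; [|now apply NoDup_rem1|].
      * apply bsum_ext. intros i Hi. destruct (in_dec Nat.eq_dec i U) as [H1|H1], (in_dec Nat.eq_dec i (rem1 a U)) as [H2|H2]; auto.
        -- exfalso. apply H2, in_rem1. split; [assumption|]. intros ->; contradiction.
        -- apply in_rem1 in H2 as [H2 _]. contradiction.
      * intros v Hv. apply in_rem1 in Hv as [Hv Hva]. destruct (HUI v Hv); [congruence|assumption].
    + rewrite Cplus_0_l. apply IH; [assumption|].
      intros v Hv. destruct (HUI v Hv); [subst; contradiction|assumption].
Qed.

Lemma sub_facts U : In U (subsets (iota1 N)) -> NoDup U /\ incl U (iota1 N) /\ incl U Vs.
Proof.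
  intros HU. pose proof (subsets_incl _ _ HU) as H. split; [|split; [assumption|]].
  - apply (subsets_NoDup (iota1 N)); [apply seq_NoDup|assumption].
  - intros v Hv. auto.
Qed.

(** Valid for every y, increasing or not: exclusion enters only through [contour_sum_boundary]. *)
Lemma contour_sum_free n y :
  contour_sum (S n) y = bsum (fun i => RtoC (p / INR N) * contour_sum n (move y i 1) + RtoC ((1 - p) / INR N) * contour_sum n (move y i (-1))) (iota1 N).
Proof.
  unfold contour_sum.
  rewrite (bsum_ext (fun i => RtoC (p / INR N) * _ + _) (fun i =>
    bsum (fun U => coefU 1 (length xs) U * (RtoC (p / INR N) * EE (fun xi => lam U xi ^ n * Gint xs z U (move y i 1) xi)
      + RtoC ((1 - p) / INR N) * EE (fun xi => lam U xi ^ n * Gint xs z U (move y i (-1)) xi))) (subsets (iota1 N)))).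
  2: { intros i _. rewrite <- !bsum_scal, <- bsum_plus. apply bsum_ext. intros U _. ring. }
  assert (Exch : forall (K : nat -> list nat -> C) l L, bsum (fun i => bsum (fun U => K i U) L) l = bsum (fun U => bsum (fun i => K i U) l) L).
  { intros K l L. induction l as [|i l IH]; [rewrite bsum_nil; symmetry; now apply bsum_0|].
    rewrite bsum_cons, IH, <- bsum_plus. reflexivity. }
  rewrite Exch. apply bsum_ext. intros U HU. destruct (sub_facts U HU) as (HndU & HUI & HUV).
  rewrite bsum_scal. f_equal.
  rewrite (bsum_ext _ (fun i => EE (fun xi => RtoC (p / INR N) * (lam U xi ^ n * Gint xs z U (move y i 1) xi)
      + RtoC ((1 - p) / INR N) * (lam U xi ^ n * Gint xs z U (move y i (-1)) xi)))).
  2: { intros i _. rewrite (EE_plus R0 Vs HR HVs (fun _ => True) (fun _ => True)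
       (fun xi => RtoC (p / INR N) * (lam U xi ^ n * Gint xs z U (move y i 1) xi))
       (fun xi => RtoC ((1 - p) / INR N) * (lam U xi ^ n * Gint xs z U (move y i (-1)) xi)))
       by (apply LC_scal; [assumption|]; now apply LC_lam_Gint).
       now rewrite !(EE_scal R0 Vs HR HVs (fun _ => True)) by now apply LC_lam_Gint. }
  rewrite <- (EE_bsum R0 Vs HR HVs (fun _ => True)).
  2: { intros i _. apply LC_plus; (apply LC_scal; [assumption|]); now apply LC_lam_Gint. }
  apply EE_ext; [assumption|]. intros xi Hxi.
  set (B := lam U xi ^ n * Gint xs z U y xi).
  transitivity (B * lam U xi); [unfold B; rewrite Cpow_S; ring|].
  rewrite (bsum_ext _ (fun i => B * (/ RtoC (INR N) * 1 + / RtoC (INR N) * (if in_dec Nat.eq_dec i U then epsA p (xi i) else 0)))).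
  - rewrite bsum_scal, bsum_plus, !bsum_scal, bsum_subset by (auto; apply seq_NoDup). f_equal. unfold lam. f_equal.
    assert (E : bsum (fun _ : nat => 1) (iota1 N) = RtoC (INR N)).
    { unfold iota1. assert (G : forall m s, bsum (fun _ : nat => 1) (seq s m) = RtoC (INR m)).
      { induction m as [|m IHm]; intros s; [reflexivity|]. cbn [seq]. rewrite bsum_cons, IHm, S_INR, RtoC_plus. ring. }
      apply G. }
    rewrite E. field. exact HNR.
  - intros i Hi. unfold B, Rdiv. rewrite !RtoC_mult, RtoC_inv by (intros H; apply HNR; rewrite H; reflexivity).
    unfold Gint. pose proof (onT_neq_0 R0 HR xi i Hxi) as Hz.
    destruct (in_dec Nat.eq_dec i U) as [Hin|Hout].
    + rewrite !monoU_move_in by assumption. rewrite Cpowz_m1_r. change (- -1)%Z with 1%Z. rewrite Cpowz_1_r.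
      unfold epsA. ring.
    + rewrite !monoU_move_notin by assumption. rewrite RtoC_minus. ring.
Qed.

Lemma bsum_subsets_app (F : list nat -> C) l1 l2 :
  bsum F (subsets (l1 ++ l2)) = bsum (fun U1 => bsum (fun U2 => F (U1 ++ U2)) (subsets l2)) (subsets l1).
Proof.
  revert F. induction l1 as [|a l1 IH]; intros F.
  - cbn [subsets app]. rewrite bsum_cons, bsum_nil, Cplus_0_r. reflexivity.
  - cbn [subsets app]. rewrite !bsum_app, !bsum_map, IH, IH. reflexivity.
Qed.

Lemma in_subsets_app U1 U2 l1 l2 : In U1 (subsets l1) -> In U2 (subsets l2) -> In (U1 ++ U2) (subsets (l1 ++ l2)).
Proof.
  revert U1. induction l1 as [|a l1 IH]; intros U1 H1 H2.
  - destruct H1 as [<-|[]]. exact H2.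
  - cbn [subsets app] in *. rewrite in_app_iff, in_map_iff in *.
    destruct H1 as [(V & <- & HV)|H1]; [left; exists (V ++ U2); split; auto|right; auto].
Qed.

Lemma coefU_succ U1 U2 i : In (U1 ++ i :: U2) (subsets (iota1 N)) -> (length xs < length (U1 ++ i :: U2))%nat ->
  coefU 1 (length xs) (U1 ++ S i :: U2) = RtoC (p / (1 - p)) * coefU 1 (length xs) (U1 ++ i :: U2).
Proof.
  intros HU Hlen. unfold coefU.
  assert (Hl : length (U1 ++ S i :: U2) = length (U1 ++ i :: U2)) by (rewrite !length_app; reflexivity).
  rewrite Hl, <- RtoC_mult, <- Rmult_assoc. do 2 f_equal.
  assert (Hr : rank_sum 1 (U1 ++ S i :: U2) = (rank_sum 1 (U1 ++ i :: U2) + 1)%Z).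
  { clear HU Hlen Hl. induction U1 as [|u U1 IH]; cbn [app]; rewrite !rank_sum_cons; lia. }
  pose proof (rank_sum_bound _ _ _ HU) as B. set (n := length (U1 ++ i :: U2)) in *.
  pose proof (tau_shift_2 (length xs) n ltac:(lia)) as D.
  (* Non-negativity of [e] is needed because tau^(e + 1) = tau tau^e may fail when tau = 0 and e is
     negative. *)
  set (e := (rank_sum 1 (U1 ++ i :: U2) - tau_shift (length xs) n)%Z).
  assert (He : (0 <= e)%Z) by (unfold e; nia).
  replace (rank_sum 1 (U1 ++ S i :: U2) - tau_shift (length xs) n)%Z with (e + 1)%Z by (unfold e; lia).
  rewrite <- (Z2Nat.id e) by assumption. replace (Z.of_nat (Z.to_nat e) + 1)%Z with (Z.of_nat (S (Z.to_nat e))) by lia.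
  rewrite <- !pow_powerRZ. reflexivity.
Qed.

Lemma map_sw_id i j U : ~ In i U -> ~ In j U -> map (sw i j) U = U.
Proof.
  intros Hi Hj. rewrite <- (map_id U) at 2. apply map_ext_in. intros v Hv.
  apply sw_other; intros ->; contradiction.
Qed.

(* Interchanging [xi_i] and [xi_(i+1)] makes the integrand antisymmetric when [U] contains both
   indices, and cancels the index sets that contain only [i] against those that contain only
   [i+1], whose coefficients differ by the factor [p / q]. *)
Lemma contour_sum_boundary n y i : (1 <= i < N)%nat -> y (S i) = (y i + 1)%Z ->
  RtoC p * contour_sum n (move y i 1) + RtoC (1 - p) * contour_sum n (move y (S i) (-1)) = contour_sum n y.
Proof.
  intros Hi Hy.
  (* The defect of the boundary condition at the level of the integrand of [U]. *)
  pose (D := fun U xi => lam U xi ^ n * (RtoC p * Gint xs z U (move y i 1) xi + RtoC (1 - p) * Gint xs z U (move y (S i) (-1)) xi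
     - Gint xs z U y xi)).
  assert (HiV : In i Vs) by (apply HNV, in_seq; lia).
  assert (HSiV : In (S i) Vs) by (apply HNV, in_seq; lia).
  assert (E : RtoC p * contour_sum n (move y i 1) + RtoC (1 - p) * contour_sum n (move y (S i) (-1)) - contour_sum n y
     = bsum (fun U => coefU 1 (length xs) U * EE (D U)) (subsets (iota1 N))).
  { unfold contour_sum. rewrite <- !bsum_scal, <- bsum_plus.
    replace (bsum (fun U => RtoC p * _ + _) (subsets (iota1 N)) - _) with
     (bsum (fun U => RtoC p * (coefU 1 (length xs) U * EE (fun xi => lam U xi ^ n * Gint xs z U (move y i 1) xi)) +
        RtoC (1 - p) * (coefU 1 (length xs) U * EE (fun xi => lam U xi ^ n * Gint xs z U (move y (S i) (-1)) xi)) +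
        - (1) * (coefU 1 (length xs) U * EE (fun xi => lam U xi ^ n * Gint xs z U y xi))) (subsets (iota1 N))).
    2: { rewrite bsum_plus, bsum_scal. ring. }
    apply bsum_ext. intros U HU. destruct (sub_facts U HU) as (HndU & HUI & HUV).
    rewrite (EE_ext R0 Vs HR (D U) (fun xi => (RtoC p * (lam U xi ^ n * Gint xs z U (move y i 1) xi) +
       RtoC (1 - p) * (lam U xi ^ n * Gint xs z U (move y (S i) (-1)) xi)) - lam U xi ^ n * Gint xs z U y xi)) by (intros; unfold D; ring).
    rewrite (EE_minus (fun _ => True) (fun _ => True) (fun xi => RtoC p * (lam U xi ^ n * Gint xs z U (move y i 1) xi) +
       RtoC (1 - p) * (lam U xi ^ n * Gint xs z U (move y (S i) (-1)) xi)))
       by (try apply LC_plus; try (apply LC_scal; [assumption|]); now apply LC_lam_Gint).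
    rewrite (EE_plus R0 Vs HR HVs (fun _ => True) (fun _ => True) (fun xi => RtoC p * (lam U xi ^ n * Gint xs z U (move y i 1) xi))
       (fun xi => RtoC (1 - p) * (lam U xi ^ n * Gint xs z U (move y (S i) (-1)) xi)))
       by (apply LC_scal; [assumption|]; now apply LC_lam_Gint).
    rewrite !(EE_scal R0 Vs HR HVs (fun _ => True)) by now apply LC_lam_Gint. ring. }
  assert (E0 : bsum (fun U => coefU 1 (length xs) U * EE (D U)) (subsets (iota1 N)) = 0).
  (* Index sets are sorted by their trace on {i, i + 1}: both indices ([T1]), none ([T4]), exactly
     one ([T23]). *)
  { assert (Hsplit : iota1 N = seq 1 (i - 1) ++ [i; S i] ++ seq (i + 2) (N - i - 1)).
    { unfold iota1. replace N with ((i - 1) + (2 + (N - i - 1)))%nat at 1 by lia.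
      rewrite seq_app. f_equal. rewrite seq_app. f_equal; [|f_equal; lia].
      replace (1 + (i - 1))%nat with i by lia. reflexivity. }
    rewrite Hsplit, bsum_subsets_app. apply bsum_0. intros U1 HU1.
    rewrite bsum_subsets_app. cbn [subsets map app]. rewrite !bsum_cons, bsum_nil, Cplus_0_r.
    rewrite <- !bsum_plus. apply bsum_0. intros U2 HU2. cbn [app].
    assert (HinI : forall V, In V (subsets [i; S i]) -> In (U1 ++ V ++ U2) (subsets (iota1 N))).
    { intros V HV. rewrite Hsplit. apply in_subsets_app; [assumption|]. now apply in_subsets_app. }
    assert (HiU1 : ~ In i U1) by (intros H; apply (subsets_incl _ _ HU1), in_seq in H; lia).
    assert (HSU1 : ~ In (S i) U1) by (intros H; apply (subsets_incl _ _ HU1), in_seq in H; lia).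
    assert (HiU2 : ~ In i U2) by (intros H; apply (subsets_incl _ _ HU2), in_seq in H; lia).
    assert (HSU2 : ~ In (S i) U2) by (intros H; apply (subsets_incl _ _ HU2), in_seq in H; lia).
    assert (T1 : EE (D (U1 ++ i :: S i :: U2)) = 0).
    { set (U := U1 ++ i :: S i :: U2).
      assert (HU : In U (subsets (iota1 N))) by (apply (HinI [i; S i]); simpl; auto).
      destruct (sub_facts U HU) as (HndU & HUI & HUV).
      assert (HiU : In i U) by (apply in_or_app; right; now left).
      assert (HSiU : In (S i) U) by (apply in_or_app; right; right; now left).
      pose (W := rem1 (S i) (rem1 i U)).
      assert (HP : Permutation U (i :: S i :: W)).
      { rewrite (rem1_perm i U HndU HiU) at 1. constructor. apply rem1_perm; [now apply NoDup_rem1|].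
        apply in_rem1. split; [assumption|lia]. }
      assert (HW : forall v, In v W -> v <> i /\ v <> S i) by (intros v Hv; unfold W in Hv; rewrite !in_rem1 in Hv; tauto).
      pose (D' := fun xi : nat -> C => amp p sg xs z U xi * (lam U xi ^ n *
         (/ pprod (fo p xi) W * / bprod (fo p xi i) W * / bprod (fo p xi (S i)) W) *
         (Cpowz (xi i) (- y i - 1) * Cpowz (xi (S i)) (- y i - 1) * monoU W y xi))).
      (* As y_(i+1) = y_i + 1, the defect carries the factor f(xi_i, xi_(i+1)) / xi_i. It cancels
         the one denominator that is not symmetric in the two variables and makes their powers
         equal. *)
      assert (ED : forall xi, onT xi -> D U xi = D' xi).
      { intros xi Hxi. unfold D, D', Gint.
        rewrite !monoU_move_in by assumption.
        rewrite (pprod_perm _ _ _ (fo_sym p xi) HP), !pprod_cons, bprod_cons.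
        unfold monoU. rewrite (bprod_perm _ _ _ HP), !bprod_cons, Hy.
        replace (- (y i + 1))%Z with (- y i - 1)%Z by lia. change (- -1)%Z with 1%Z.
        rewrite Cpowz_1_r, Cpowz_m1_r.
        assert (P1 : forall k, Cpowz (xi k) (- y i - 1) = Cpowz (xi k) (- y i) * / xi k).
        { intros k. rewrite <- Cpowz_m1_r, <- Cpowz_add by now apply (onT_neq_0 R0 HR). reflexivity. }
        rewrite !P1.
        pose proof (onT_neq_0 R0 HR xi (S i) Hxi) as H7.
        assert (H1 : bprod (fo p xi i) W <> 0) by (apply bprod_neq_0; intros; now apply fo_neq_0).
        assert (H2 : pprod (fo p xi) W <> 0) by (apply pprod_neq_0; intros; now apply fo_neq_0).
        assert (H3 : bprod (fo p xi (S i)) W <> 0) by (apply bprod_neq_0; intros; now apply fo_neq_0).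
        assert (H4 : fo p xi i (S i) = RtoC p + RtoC (1 - p) * xi i * xi (S i) - xi i).
        { unfold fo. destruct (Nat.ltb_spec i (S i)); [reflexivity|lia]. }
        assert (H5 : fo p xi i (S i) <> 0) by now apply fo_neq_0.
        pose proof (onT_neq_0 R0 HR xi i Hxi) as H6.
        set (f := fo p xi i (S i)) in *.
        transitivity (amp p sg xs z U xi * (lam U xi ^ n *
         (/ pprod (fo p xi) W * / bprod (fo p xi i) W * / bprod (fo p xi (S i)) W) *
         (Cpowz (xi i) (- y i) * / xi i * (Cpowz (xi (S i)) (- y i) * / xi (S i)) * bprod (fun v => Cpowz (xi v) (- y v)) W)) *
         ((RtoC p + RtoC (1 - p) * xi i * xi (S i) - xi i) * / f)).
        - field. tauto.
        - rewrite <- H4. field. tauto. }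
      rewrite (EE_ext R0 Vs HR _ D' ED).
      assert (HL : LC (fun _ => True) D').
      { apply (LC_ext _ _ _ (D U) _ ED). unfold D.
        apply (LC_ext _ _ _ (fun xi => RtoC p * (lam U xi ^ n * Gint xs z U (move y i 1) xi) +
          (RtoC (1 - p) * (lam U xi ^ n * Gint xs z U (move y (S i) (-1)) xi) + - (1) * (lam U xi ^ n * Gint xs z U y xi)))); [intros; ring|].
        repeat apply LC_plus; (apply LC_scal; [assumption|]); now apply LC_lam_Gint. }
      apply (EE_antisym D' i (S i)); auto.
      intros xi Hxi. unfold D'. rewrite amp_antisym by (auto; lia).
      assert (S1 : lam U (fun v => xi (sw i (S i) v)) = lam U xi).
      { unfold lam. do 2 f_equal. rewrite <- (bsum_map (sw i (S i)) (fun v => epsA p (xi v))).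
        apply bsum_perm, sw_perm; tauto. }
      assert (S2 : pprod (fo p (fun v => xi (sw i (S i) v))) W = pprod (fo p xi) W).
      { apply pprod_ext. intros u v Hu Hv. destruct (HW u Hu), (HW v Hv). unfold fo. now rewrite !sw_other. }
      assert (S3 : bprod (fo p (fun v => xi (sw i (S i) v)) i) W = bprod (fo p xi (S i)) W).
      { apply bprod_ext. intros v Hv. destruct (HW v Hv). rewrite fo_sw_adjacent by (auto; lia).
        now rewrite sw_l, sw_other. }
      assert (S4 : bprod (fo p (fun v => xi (sw i (S i) v)) (S i)) W = bprod (fo p xi i) W).
      { apply bprod_ext. intros v Hv. destruct (HW v Hv). rewrite fo_sw_adjacent by (auto; lia).
        now rewrite sw_r, sw_other. }
      assert (S5 : monoU W y (fun v => xi (sw i (S i) v)) = monoU W y xi).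
      { apply bprod_ext. intros v Hv. destruct (HW v Hv). now rewrite sw_other. }
      rewrite S1, S2, S3, S4, S5, sw_l, sw_r. ring. }
    assert (T4 : EE (D (U1 ++ U2)) = 0).
    { rewrite (EE_ext R0 Vs HR _ (fun _ => 0)); [now apply EE_const|]. intros xi _. unfold D, Gint.
      rewrite !monoU_move_notin by (rewrite in_app_iff; tauto). rewrite RtoC_minus. ring. }
    assert (T23 : coefU 1 (length xs) (U1 ++ i :: U2) * EE (D (U1 ++ i :: U2)) +
                  coefU 1 (length xs) (U1 ++ S i :: U2) * EE (D (U1 ++ S i :: U2)) = 0).
    { set (Ui := U1 ++ i :: U2). set (Uj := U1 ++ S i :: U2).
      assert (HUi : In Ui (subsets (iota1 N))) by (apply (HinI [i]); simpl; auto).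
      assert (HUj : In Uj (subsets (iota1 N))) by (apply (HinI [S i]); simpl; auto).
      destruct (sub_facts Ui HUi) as (HndUi & HUiI & HUiV). destruct (sub_facts Uj HUj) as (HndUj & HUjI & HUjV).
      assert (Hl : length Uj = length Ui) by (unfold Ui, Uj; rewrite !length_app; reflexivity).
      (* [coefU_succ] needs at least m indices; for smaller sets the integrands are 0. *)
      destruct (Nat.le_gt_cases (length Ui) (length xs)) as [Hs|Hs].
      { assert (Z1 : forall V, NoDup V -> (length V <= length xs)%nat -> EE (D V) = 0).
        { intros V HV HVl. rewrite (EE_ext R0 Vs HR _ (fun _ => 0)); [now apply EE_const|]. intros xi _. unfold D, Gint.
          rewrite amp_small by assumption. unfold Cdiv. ring. }
        rewrite !Z1 by (auto; lia). ring. }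
      unfold Uj at 1. rewrite coefU_succ by assumption. fold Ui.
      assert (HiUi : In i Ui) by (apply in_or_app; right; now left).
      assert (HjUj : In (S i) Uj) by (apply in_or_app; right; now left).
      assert (HjUi : ~ In (S i) Ui) by (unfold Ui; rewrite in_app_iff; simpl; intros [H|[H|H]]; [tauto|lia|tauto]).
      assert (HiUj : ~ In i Uj) by (unfold Uj; rewrite in_app_iff; simpl; intros [H|[H|H]]; [tauto|lia|tauto]).
      assert (Hmap : map (sw i (S i)) Uj = Ui).
      { unfold Ui, Uj. rewrite map_app. cbn [map]. rewrite sw_r, !map_sw_id by assumption. reflexivity. }
      (* After exchange of the variables both defects are multiples of [Ki]: by p for the set with i
         and by -q for the set with i + 1, whose coefficient is p/q times the other. *)
      pose (Ki := fun xi : nat -> C => lam Ui xi ^ n * ((/ xi i - 1) * Gint xs z Ui y xi)).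
      assert (Ei : forall xi, onT xi -> D Ui xi = RtoC p * Ki xi).
      { intros xi Hxi. unfold D, Ki, Gint. rewrite monoU_move_in, monoU_move_notin, Cpowz_m1_r by assumption.
        rewrite RtoC_minus. ring. }
      assert (Ej : forall xi, onT xi -> D Uj (fun v => xi (sw i (S i) v)) = - RtoC (1 - p) * Ki xi).
      { intros xi Hxi. assert (Hxi' : onT (fun v => xi (sw i (S i) v))) by now apply onT_sw.
        unfold D, Ki, Gint. rewrite (monoU_move_in Uj y (S i)), (monoU_move_notin Uj y i) by assumption. change (- -1)%Z with 1%Z.
        rewrite Cpowz_1_r, sw_r.
        assert (S0 : amp p sg xs z Uj (fun v => xi (sw i (S i) v)) = amp p sg xs z Ui xi).
        { rewrite <- Hmap. symmetry. apply amp_sw_adjacent; [assumption|tauto]. }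
        assert (S1 : lam Uj (fun v => xi (sw i (S i) v)) = lam Ui xi).
        { unfold lam. do 2 f_equal. rewrite <- Hmap. symmetry. exact (bsum_map (sw i (S i)) (fun v => epsA p (xi v)) Uj). }
        assert (S2 : pprod (fo p (fun v => xi (sw i (S i) v))) Uj = pprod (fo p xi) Ui).
        { rewrite <- Hmap, pprod_map. apply pprod_ext_NoDup; [assumption|]. intros u v Hu Hv Huv.
          apply fo_sw_adjacent; [| |assumption]; intros [-> ->]; contradiction. }
        assert (S3 : monoU Uj y (fun v => xi (sw i (S i) v)) = monoU Ui y xi * / xi i).
        { unfold monoU. rewrite <- Hmap, bprod_map.
          rewrite !(bprod_perm _ _ _ (rem1_perm (S i) Uj HndUj HjUj)), !bprod_cons, sw_r, Hy.
          replace (- (y i + 1))%Z with (- y i + -1)%Z by lia.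
          rewrite Cpowz_add, Cpowz_m1_r by now apply (onT_neq_0 R0 HR).
          rewrite (bprod_ext (fun v => Cpowz (xi (sw i (S i) v)) (- y v))
             (fun v => Cpowz (xi (sw i (S i) v)) (- y (sw i (S i) v)))); [ring|].
          intros v Hv. apply in_rem1 in Hv as [Hv Hvj]. rewrite (sw_other i (S i) v); auto. intros ->; contradiction. }
        rewrite S0, S1, S2, S3. rewrite !RtoC_minus. pose proof (onT_neq_0 R0 HR xi i Hxi).
        assert (pprod (fo p xi) Ui <> 0) by (apply pprod_neq_0; intros; now apply fo_neq_0).
        field. tauto. }
      assert (HLi : LC (fun _ => True) Ki).
      { apply (LC_ext _ _ _ (fun xi => lam Ui xi ^ n * Gint xs z Ui (move y i 1) xi + - (1) * (lam Ui xi ^ n * Gint xs z Ui y xi))).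
        - intros xi Hxi. unfold Ki, Gint. rewrite monoU_move_in, Cpowz_m1_r by assumption. ring.
        - apply LC_plus; [|apply LC_scal; [assumption|]]; now apply LC_lam_Gint. }
      assert (HLj : LC (fun _ => True) (D Uj)).
      { unfold D.
        apply (LC_ext _ _ _ (fun xi => RtoC p * (lam Uj xi ^ n * Gint xs z Uj (move y i 1) xi) +
          (RtoC (1 - p) * (lam Uj xi ^ n * Gint xs z Uj (move y (S i) (-1)) xi) + - (1) * (lam Uj xi ^ n * Gint xs z Uj y xi)))); [intros; ring|].
        repeat apply LC_plus; (apply LC_scal; [assumption|]); now apply LC_lam_Gint. }
      rewrite (EE_ext R0 Vs HR (D Ui) (fun xi => RtoC p * Ki xi) Ei).
      rewrite <- (EE_sw R0 Vs HR HVs (D Uj) i (S i)) by assumption.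
      rewrite (EE_ext R0 Vs HR _ (fun xi => - RtoC (1 - p) * Ki xi) Ej).
      rewrite !(EE_scal R0 Vs HR HVs (fun _ => True) _ Ki HLi).
      unfold Rdiv. rewrite RtoC_mult, RtoC_inv by lra. pose proof RtoC_q_neq_0. set (q := RtoC (1 - p)) in *. field. assumption. }
    rewrite T1, T4.
    transitivity (coefU 1 (length xs) (U1 ++ i :: U2) * EE (D (U1 ++ i :: U2)) +
                  coefU 1 (length xs) (U1 ++ S i :: U2) * EE (D (U1 ++ S i :: U2))); [ring|exact T23]. }
  rewrite E0 in E.
  transitivity (RtoC p * contour_sum n (move y i 1) + RtoC (1 - p) * contour_sum n (move y (S i) (-1)) - contour_sum n y + contour_sum n y); [ring|].
  rewrite E. ring.
Qed.

(** * Exclusion and the one-ring kernel *)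

Definition increasing (y : nat -> Z) : Prop := forall i, (1 <= i < N)%nat -> (y i < y (S i))%Z.

Lemma increasing_lt y i j : increasing y -> (1 <= i < j)%nat -> (j <= N)%nat -> (y i < y j)%Z.
Proof.
  intros Hy. induction j as [|j IH]; intros Hij Hj; [lia|].
  destruct (Nat.eq_dec i j) as [->|H]; [apply Hy; lia|].
  assert (y i < y j)%Z by (apply IH; lia). assert (y j < y (S j))%Z by (apply Hy; lia). lia.
Qed.

Lemma occupiedb_true y w : occupiedb N y w = true <-> exists i, (1 <= i <= N)%nat /\ y i = w.
Proof.
  unfold occupiedb, iota1. rewrite existsb_exists. split; intros (i & Hi & E); exists i.
  - apply in_seq in Hi. apply Z.eqb_eq in E. split; [lia|assumption].
  - split; [apply in_seq; lia|]. now apply Z.eqb_eq.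
Qed.

Lemma occupiedb_right y i : increasing y -> (1 <= i <= N)%nat ->
  occupiedb N y (y i + 1) = true <-> (i < N)%nat /\ y (S i) = (y i + 1)%Z.
Proof.
  intros Hy Hi. rewrite occupiedb_true. split.
  - intros (j & Hj & E).
    assert (Hij : (i < j)%nat).
    { destruct (Nat.lt_trichotomy i j) as [H|[H|H]]; [assumption|subst; lia|].
      pose proof (increasing_lt y j i Hy ltac:(lia) ltac:(lia)). lia. }
    split; [lia|]. destruct (Nat.eq_dec j (S i)) as [->|Hne]; [assumption|].
    pose proof (increasing_lt y (S i) j Hy ltac:(lia) ltac:(lia)).
    pose proof (increasing_lt y i (S i) Hy ltac:(lia) ltac:(lia)). lia.
  - intros [H1 H2]. exists (S i). split; [lia|assumption].
Qed.

Lemma occupiedb_left y i : increasing y -> (1 <= i <= N)%nat ->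
  occupiedb N y (y i + -1) = true <-> (1 < i)%nat /\ y i = (y (i - 1)%nat + 1)%Z.
Proof.
  intros Hy Hi. rewrite occupiedb_true. split.
  - intros (j & Hj & E).
    assert (Hij : (j < i)%nat).
    { destruct (Nat.lt_trichotomy i j) as [H|[H|H]]; [|subst; lia|assumption].
      pose proof (increasing_lt y i j Hy ltac:(lia) ltac:(lia)). lia. }
    split; [lia|]. destruct (Nat.eq_dec j (i - 1)) as [->|Hne]; [lia|].
    pose proof (increasing_lt y j (i - 1) Hy ltac:(lia) ltac:(lia)).
    pose proof (increasing_lt y (i - 1) i Hy ltac:(lia) ltac:(lia)). lia.
  - intros [H1 H2]. exists (i - 1)%nat. split; [lia|lia].
Qed.

Lemma step_right y i : step N y (i, true) = if occupiedb N y (y i + 1) then y else move y i 1.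
Proof. reflexivity. Qed.

Lemma step_left y i : step N y (i, false) = if occupiedb N y (y i + -1) then y else move y i (-1).
Proof. reflexivity. Qed.

Lemma step_increasing y c : increasing y -> In c (choices N) -> increasing (step N y c).
Proof.
  intros Hy Hc. unfold choices, iota1 in Hc. apply in_flat_map in Hc as (i & Hi & Hc). apply in_seq in Hi.
  assert (Hi' : (1 <= i <= N)%nat) by lia.
  destruct Hc as [<-|[<-|[]]].
  - rewrite step_right. destruct (occupiedb N y (y i + 1)) eqn:E; [assumption|].
    intros j Hj. pose proof (Hy j Hj) as Hyj. unfold move.
    destruct (Nat.eqb_spec j i) as [H1|H1], (Nat.eqb_spec (S j) i) as [H2|H2]; try lia.
    + subst j. destruct (Z.eq_dec (y (S i)) (y i + 1)) as [Eq|Ne]; [|lia].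
      assert (occupiedb N y (y i + 1) = true) by (apply (proj2 (occupiedb_right y i Hy Hi')); split; [lia|assumption]). congruence.
    + rewrite <- H2. lia.
  - rewrite step_left. destruct (occupiedb N y (y i + -1)) eqn:E; [assumption|].
    intros j Hj. pose proof (Hy j Hj) as Hyj. unfold move.
    destruct (Nat.eqb_spec j i) as [H1|H1], (Nat.eqb_spec (S j) i) as [H2|H2]; try (subst; lia).
    subst i. destruct (Z.eq_dec (y (S j)) (y j + 1)) as [Eq|Ne]; [|lia].
    assert (occupiedb N y (y (S j) + -1) = true).
    { apply (proj2 (occupiedb_left y (S j) Hy Hi')). split; [lia|]. replace (S j - 1)%nat with j by lia. assumption. }
    congruence.
Qed.

(** The free and the exclusion kernel differ in blocked jumps only. These come in pairs, i to the
    right and i + 1 to the left, and by the boundary condition the two errors cancel; the first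
    particle is never blocked on its left nor the last on its right. *)
Lemma contour_sum_step n y : increasing y ->
  contour_sum (S n) y = bsum (fun c => RtoC (weight N p c) * contour_sum n (step N y c)) (choices N).
Proof.
  intros Hy. rewrite contour_sum_free. unfold choices. rewrite bsum_flat_map.
  pose (A := fun i => RtoC (p / INR N) * (contour_sum n (move y i 1) - contour_sum n (step N y (i, true)))).
  pose (B := fun i => RtoC ((1 - p) / INR N) * (contour_sum n (move y i (-1)) - contour_sum n (step N y (i, false)))).
  assert (E : bsum A (iota1 N) + bsum B (iota1 N) = 0).
  { assert (HAB : forall i, (1 <= i < N)%nat -> A i + B (S i) = 0).
    { intros i Hi. unfold A, B. rewrite step_right, step_left.
      destruct (Z.eq_dec (y (S i)) (y i + 1)) as [Eq|Ne].
      - replace (occupiedb N y (y i + 1)) with true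
          by (symmetry; apply (proj2 (occupiedb_right y i Hy ltac:(lia))); split; [lia|assumption]).
        replace (occupiedb N y (y (S i) + -1)) with true
          by (symmetry; apply (proj2 (occupiedb_left y (S i) Hy ltac:(lia))); split; [lia|replace (S i - 1)%nat with i by lia; assumption]).
        pose proof (contour_sum_boundary n y i Hi Eq) as BC.
        unfold Rdiv. rewrite !RtoC_mult, RtoC_inv by (intros H; apply HNR; rewrite H; reflexivity).
        transitivity (/ RtoC (INR N) * ((RtoC p * contour_sum n (move y i 1) + RtoC (1 - p) * contour_sum n (move y (S i) (-1))) - contour_sum n y)).
        + rewrite RtoC_minus. ring.
        + rewrite BC. ring.
      - replace (occupiedb N y (y i + 1)) with false.
        2: { symmetry. apply Bool.not_true_iff_false. rewrite occupiedb_right by (auto; lia). tauto. }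
        replace (occupiedb N y (y (S i) + -1)) with false.
        2: { symmetry. apply Bool.not_true_iff_false. rewrite occupiedb_left by (auto; lia).
             replace (S i - 1)%nat with i by lia. tauto. }
        ring. }
    assert (HA : A N = 0).
    { unfold A. rewrite step_right. replace (occupiedb N y (y N + 1)) with false; [ring|].
      symmetry. apply Bool.not_true_iff_false. rewrite occupiedb_right by (auto; lia). lia. }
    assert (HB : B 1%nat = 0).
    { unfold B. rewrite step_left. replace (occupiedb N y (y 1%nat + -1)) with false; [ring|].
      symmetry. apply Bool.not_true_iff_false. rewrite occupiedb_left by (auto; lia). lia. }
    unfold iota1. destruct N as [|M]; [lia|].
    assert (EA : bsum A (seq 1 (S M)) = bsum A (seq 1 M) + A (S M)).
    { rewrite seq_S, bsum_app, bsum_cons, bsum_nil. replace (1 + M)%nat with (S M) by lia. ring. }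
    assert (EB : bsum B (seq 1 (S M)) = B 1%nat + bsum (fun a => B (S a)) (seq 1 M)).
    { cbn [seq]. rewrite bsum_cons, <- (seq_shift M 1), bsum_map. reflexivity. }
    rewrite EA, EB, HA, HB.
    transitivity (bsum A (seq 1 M) + bsum (fun a => B (S a)) (seq 1 M)); [ring|].
    rewrite <- bsum_plus. apply bsum_0. intros i Hi. apply in_seq in Hi. apply HAB. lia. }
  rewrite (bsum_ext (fun i => bsum _ _) (fun i => (RtoC (p / INR N) * contour_sum n (move y i 1) + RtoC ((1 - p) / INR N) * contour_sum n (move y i (-1)))
    + - (1) * (A i + B i))).
  - rewrite (bsum_plus (fun i => RtoC (p / INR N) * contour_sum n (move y i 1) + RtoC ((1 - p) / INR N) * contour_sum n (move y i (-1)))), bsum_scal, (bsum_plus A B), E. ring.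
  - intros i _. rewrite !bsum_cons, bsum_nil. unfold A, B, weight. cbn [snd]. ring.
Qed.

Lemma RtoC_fold_Rplus {T : Type} (f : T -> R) l :
  RtoC (fold_right Rplus 0%R (map f l)) = bsum (fun a => RtoC (f a)) l.
Proof. induction l as [|a l IH]; [reflexivity|]. cbn [map fold_right]. now rewrite RtoC_plus, IH, bsum_cons. Qed.

(** Words of rings are split at the first letter, so that the starting configuration moves, just as
    in [contour_sum_step]. *)
Lemma Kn_succ Y m x n :
  RtoC (Kn N p Y m x (S n)) = bsum (fun c => RtoC (weight N p c) * RtoC (Kn N p (step N Y c) m x n)) (choices N).
Proof.
  unfold Kn. rewrite RtoC_fold_Rplus. cbn [words]. rewrite bsum_flat_map. apply bsum_ext. intros c _.
  rewrite bsum_map, RtoC_fold_Rplus, <- bsum_scal. apply bsum_ext. intros w _.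
  cbn [map fold_right fold_left]. rewrite <- RtoC_mult. f_equal. ring.
Qed.

Lemma Kn_contour_sum_aux m x : (forall Y, increasing Y -> RtoC (Kn N p Y m x 0) = contour_sum 0 Y) ->
  forall n Y, increasing Y -> RtoC (Kn N p Y m x n) = contour_sum n Y.
Proof.
  intros H0. induction n as [|n IH]; intros Y HY; [now apply H0|].
  rewrite Kn_succ, contour_sum_step by assumption. apply bsum_ext. intros c Hc.
  now rewrite IH by now apply step_increasing.
Qed.

End Evolution.

Lemma hits_event x y k : forall s0,
  hits s0 (map x (seq s0 k)) (x (s0 + k)%nat) y = forallb (fun i => Z.eqb (y i) (x i)) (seq s0 (S k)).
Proof.
  induction k as [|k IH]; intros s0.
  - cbn. rewrite Nat.add_0_r. now rewrite Bool.andb_true_r.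
  - replace (s0 + S k)%nat with (S s0 + k)%nat by lia. cbn [seq map hits]. rewrite IH. reflexivity.
Qed.

Lemma incr_map x k : forall s0 X, (X <= x s0)%Z ->
  (forall i, (s0 <= i < s0 + k)%nat -> (x i < x (S i))%Z) -> incr X (map x (seq s0 k)) (x (s0 + k)%nat).
Proof.
  induction k as [|k IH]; intros s0 X HX Hx.
  - simpl. now rewrite Nat.add_0_r.
  - cbn [seq map incr]. split; [assumption|]. replace (s0 + S k)%nat with (S s0 + k)%nat by lia.
    apply IH; [|intros; apply Hx; lia]. assert (x s0 < x (S s0))%Z by (apply Hx; lia). lia.
Qed.

Lemma Kn_contour_sum N m (x : nat -> Z) n Y : (1 <= N)%nat -> incl (iota1 N) Vs -> (1 <= m <= N)%nat ->
  (forall i, (1 <= i < m)%nat -> (x i < x (S i))%Z) -> increasing N Y ->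
  RtoC (Kn N p Y m x n) = contour_sum N (map x (iota1 (m - 1))) (x m) n Y.
Proof.
  intros HN HNV Hm Hx HY. apply Kn_contour_sum_aux; auto. clear n Y HY. intros Y HY.
  replace (x m) with (x (1 + (m - 1))%nat) by (f_equal; lia).
  assert (E : contour_sum N (map x (iota1 (m - 1))) (x (1 + (m - 1))%nat) 0 Y = contour0 1 (seq 1 N) (map x (iota1 (m - 1))) (x (1 + (m - 1))%nat) Y).
  { unfold contour_sum, contour0, iota1. apply bsum_ext. intros U _. f_equal. apply EE_ext; [assumption|].
    intros xi _. simpl. ring. }
  rewrite E, contour0_initial.
  - unfold iota1. rewrite hits_event. unfold Kn, event, iota1. cbn [words map fold_right fold_left].
    replace (S (m - 1)) with m by lia. destruct (forallb _ (seq 1 m)); f_equal; ring.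
  - rewrite length_map. unfold iota1. rewrite length_seq. lia.
  - assumption.
  - assert (Hh : hd (x (1 + (m - 1))%nat) (map x (iota1 (m - 1))) = x 1%nat).
    { unfold iota1. destruct (m - 1)%nat eqn:Em; reflexivity. }
    rewrite Hh. apply incr_map; [lia|]. intros i Hi. apply Hx. lia.
  - intros i j Hij Hj. apply (increasing_lt N); auto; lia.
Qed.

(** * Identification of the terms of the theorem *)

Lemma sumZ_perm U V : Permutation U V -> sumZ U = sumZ V.
Proof. induction 1; cbn; try (change (fold_right Z.add 0%Z) with sumZ); lia. Qed.

Lemma rank_sum_app s0 U V : rank_sum s0 (U ++ V) = (rank_sum s0 U + rank_sum s0 V)%Z.
Proof. induction U as [|u U IH]; [reflexivity|]. cbn [app]. rewrite !rank_sum_cons, IH. lia. Qed.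

Lemma rank_sum_1 S : rank_sum 1 S = (sumZ (map Z.of_nat S) - Z.of_nat (length S))%Z.
Proof.
  induction S as [|s S IH]; [reflexivity|]. rewrite rank_sum_cons, IH. cbn [map sumZ fold_right length].
  change (fold_right Z.add 0%Z) with sumZ. lia.
Qed.

Section Terms.
Variables (N m : nat) (t : R) (Y x : nat -> Z) (U L : list nat).
Hypothesis Hm : (1 <= m)%nat.
Hypothesis HU : NoDup U.
Hypothesis HUN : incl U (iota1 N).
Hypothesis HlenL : length L = (m - 1)%nat.
Hypothesis HL : NoDup L.
Hypothesis HLU : incl L U.

Let S := minus_list U L.

Let HP : Permutation U (L ++ S).
Proof. now apply minus_list_perm. Qed.

Let HlenU : (length U = (m - 1) + length S)%nat.
Proof. rewrite (Permutation_length HP), length_app. lia. Qed.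

(** The signs become the factors [sg] carried by [amp]. The exponents of tau agree once the sum of
    the ell_i and the sum of the elements of S are merged into the rank sum of [U]. *)
Lemma coeff_eq :
  RtoC (coeff N m p S L) = bprod (fun l => bprod (sg l) S) L * pprod sg L * coefU 1 (m - 1) U.
Proof.
  unfold coeff, coefU. rewrite <- HlenL, Rmult_assoc, RtoC_mult, RtoC_mult, sign_block, RtoC_sgnL, HlenL.
  - do 2 f_equal. replace (length U - (m - 1))%nat with (length S) by lia. do 2 f_equal.
    rewrite sigmaU_sum.
    2: { intros v Hv. apply in_minus_list in Hv. now apply HUN. }
    pose proof (sum_ell_shift L 1) as E. rewrite HlenL in E.
    change (map (fun i => (Z.of_nat (nth (i - 1) L 0%nat) - Z.of_nat i)%Z) (seq 1 (m - 1))) with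
      (map (fun i => (Z.of_nat (ell L i) - Z.of_nat i)%Z) (iota1 (m - 1))) in E.
    change (sumZ (map (fun l => (Z.of_nat l - Z.of_nat 1)%Z) L)) with (rank_sum 1 L) in E.
    assert (ER : rank_sum 1 U = (rank_sum 1 L + rank_sum 1 S)%Z).
    { rewrite <- rank_sum_app. unfold rank_sum. apply sumZ_perm. now apply Permutation_map. }
    pose proof (rank_sum_1 S) as ES. pose proof (tau_shift_2 (m - 1) (length U) ltac:(lia)) as ED.
    rewrite HlenU in ED |- *. rewrite Nat2Z.inj_add in ED.
    set (T := sumZ (map (fun i => (Z.of_nat (ell L i) - Z.of_nat i)%Z) (iota1 (m - 1)))) in *.
    set (D := tau_shift (m - 1) (m - 1 + length S)) in *. rewrite ER, ES.
    set (W := sumZ (map Z.of_nat S)) in *. set (k := length S) in *. clearbody T D W k.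
    rewrite Nat2Z.inj_mul, Nat2Z.inj_sub in * by lia. nia.
  - assumption.
  - intros v Hv H. apply in_minus_list in H. tauto.
Qed.

(** The product of all xi is the Jacobian of the circles and turns the exponents -Y_i - 1 into -Y_i.
    The list [S ++ L] may be replaced by [U] because [fo] is symmetric. *)
Lemma integrand_eq (xi : nat -> C) : (forall v, xi v <> 0) ->
  integrand N m p t Y x S L xi * bprod xi (S ++ L) =
  Cexp (bsum (fun i => epsA p (xi i) * RtoC t) U) *
  ((bprod (fun l => bprod (fun v => fA p (xi l) (xi v)) S) L * pprod (fun u v => fA p (xi u) (xi v)) L *
    bprod (fun ab => Cpowz (xi (fst ab)) (snd ab)) (combine L (map x (iota1 (m - 1))))) *
   amp0 sg (x m) S xi / pprod (fo p xi) U * monoU U Y xi).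
Proof.
  intros Hxi.
  assert (HP' : Permutation (S ++ L) U) by (rewrite HP; apply Permutation_app_comm).
  assert (HSL : NoDup (S ++ L)) by (apply (Permutation_NoDup (Permutation_sym HP')), HU).
  assert (HS : NoDup S) by now apply NoDup_filter.
  unfold integrand, Cdiv.
  assert (Hfm : forall (g : nat -> nat -> C) (h : nat -> list nat) l,
    Cprod (flat_map (fun i => map (g i) (h i)) l) = bprod (fun i => bprod (g i) (h i)) l).
  { intros g h l. transitivity (bprod (fun z => z) (flat_map (fun i => map (g i) (h i)) l)).
    - unfold bprod. now rewrite map_id.
    - rewrite bprod_flat_map. apply bprod_ext. intros i _. exact (bprod_map (g i) (fun z => z) (h i)). }
  rewrite (Hfm (fun i j => fA p (xi i) (xi j)) (fun _ => S)).
  rewrite (Hfm (fun i j => fA p (xi i) (xi j)) (fun i => filter (fun j => Nat.ltb i j) (S ++ L))).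
  rewrite (Hfm (fun i j => xi j - xi i) (fun i => filter (fun j => Nat.ltb i j) S)).
  rewrite (bprod_ordered_pairs (fun i j => fA p (xi i) (xi j))) by assumption.
  rewrite (bprod_ordered_pairs (fun i j => xi j - xi i)) by assumption.
  change (pprod (fun u v => if Nat.ltb u v then fA p (xi u) (xi v) else fA p (xi v) (xi u)) (S ++ L))
    with (pprod (fo p xi) (S ++ L)).
  rewrite (pprod_perm (fo p xi) _ _ (fo_sym p xi) HP').
  rewrite (pprod_ext (fun u v => if Nat.ltb u v then xi v - xi u else xi u - xi v) (fun u v => sg u v * (xi v - xi u))).
  2: { intros u v _ _. unfold sg. destruct (Nat.ltb u v); ring. }
  change (Cprod (map (fun ab => fA p (xi (fst ab)) (xi (snd ab))) (pairs L))) with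
    (pprod (fun u v => fA p (xi u) (xi v)) L).
  fold (bprod xi S). fold (bprod (fun j => 1 - xi j) S). fold (bprod (fun j => Cpowz (xi j) (x m)) S).
  fold (bprod (fun a => Cpowz (xi (ell L a)) (x a)) (iota1 (m - 1))).
  fold (bprod (fun i => Cpowz (xi i) (- Y i - 1)) (S ++ L)).
  fold (bsum (fun i => epsA p (xi i) * RtoC t) (S ++ L)).
  rewrite (bsum_perm _ _ _ HP').
  assert (E1 : bprod (fun a => Cpowz (xi (ell L a)) (x a)) (iota1 (m - 1)) =
     bprod (fun ab => Cpowz (xi (fst ab)) (snd ab)) (combine L (map x (iota1 (m - 1))))).
  { unfold iota1, ell. rewrite <- HlenL. apply powers_combine. }
  assert (E2 : bprod (fun i => Cpowz (xi i) (- Y i - 1)) (S ++ L) * bprod xi (S ++ L) = monoU U Y xi).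
  { rewrite <- bprod_mult. rewrite (bprod_perm _ _ _ HP'). apply bprod_ext. intros v _.
    rewrite <- (Cpowz_succ _ _ (Hxi v)). f_equal. lia. }
  rewrite E1, <- E2. unfold amp0, Cdiv. ring.
Qed.

Lemma term_eq (xi : nat -> C) : (forall v, xi v <> 0) ->
  RtoC (coeff N m p S L) * (integrand N m p t Y x S L xi * bprod xi (S ++ L)) =
  coefU 1 (m - 1) U * (Cexp (bsum (fun i => epsA p (xi i) * RtoC t) U) *
   (front p (map x (iota1 (m - 1))) L S xi * amp0 sg (x m) S xi / pprod (fo p xi) U * monoU U Y xi)).
Proof.
  intros Hxi. rewrite coeff_eq, integrand_eq by assumption.
  rewrite front_eq by (unfold iota1; now rewrite length_map, length_seq). unfold Cdiv. ring.
Qed.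

(** Needed since the mean runs over all of [Vs], while the theorem integrates only the variables of
    S and Lambda. *)
Lemma integrand_local (xi eta : nat -> C) : (forall i, In i (S ++ L) -> xi i = eta i) ->
  integrand N m p t Y x S L xi = integrand N m p t Y x S L eta.
Proof.
  intros H.
  assert (HSi : forall i, In i S -> xi i = eta i) by (intros; apply H, in_or_app; now left).
  assert (HLi : forall i, In i L -> xi i = eta i) by (intros; apply H, in_or_app; now right).
  assert (Hfm : forall (g h : nat -> nat -> C) (f : nat -> list nat) l,
    (forall i j, In i l -> In j (f i) -> g i j = h i j) ->
    flat_map (fun i => map (g i) (f i)) l = flat_map (fun i => map (h i) (f i)) l).
  { intros g h f l Hgh. induction l as [|a l IH]; [reflexivity|]. cbn [flat_map]. f_equal.
    - apply map_ext_in. intros j Hj. apply Hgh; [now left|assumption].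
    - apply IH. intros i j Hi. apply Hgh. now right. }
  unfold integrand.
  rewrite (Hfm (fun i j => fA p (xi i) (xi j)) (fun i j => fA p (eta i) (eta j)) (fun _ => S) L)
    by (intros; now rewrite HLi, HSi).
  rewrite (Hfm (fun i j => fA p (xi i) (xi j)) (fun i j => fA p (eta i) (eta j)) (fun i => filter (fun j => Nat.ltb i j) (S ++ L)))
    by (intros i j Hi Hj; apply filter_In in Hj; now rewrite !H).
  rewrite (Hfm (fun i j => xi j - xi i) (fun i j => eta j - eta i) (fun i => filter (fun j => Nat.ltb i j) S))
    by (intros i j Hi Hj; apply filter_In in Hj; now rewrite !HSi).
  rewrite (map_ext_in (fun ab => fA p (xi (fst ab)) (xi (snd ab))) (fun ab => fA p (eta (fst ab)) (eta (snd ab))))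
    by (intros ab Hab; apply in_pairs in Hab; now rewrite !HLi).
  rewrite (map_ext_in xi eta S) by assumption.
  rewrite (map_ext_in (fun j => 1 - xi j) (fun j => 1 - eta j)) by (intros; now rewrite HSi).
  rewrite (map_ext_in (fun a => Cpowz (xi (ell L a)) (x a)) (fun a => Cpowz (eta (ell L a)) (x a))).
  2: { intros a Ha. apply in_seq in Ha. rewrite HLi; [reflexivity|]. apply nth_In. lia. }
  rewrite (map_ext_in (fun j => Cpowz (xi j) (x m)) (fun j => Cpowz (eta j) (x m))) by (intros; now rewrite HSi).
  rewrite (map_ext_in (fun i => Cpowz (xi i) (- Y i - 1)) (fun i => Cpowz (eta i) (- Y i - 1))) by (intros; now rewrite H).
  rewrite (map_ext_in (fun i => epsA p (xi i) * RtoC t) (fun i => epsA p (eta i) * RtoC t)) by (intros; now rewrite H).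
  reflexivity.
Qed.

End Terms.

(** * Exponentials on the torus *)

Lemma LC_exp_part F M : LC (fun _ => True) F -> LC (fun _ => True) (fun xi => exp_part M (F xi)).
Proof.
  intros HF. unfold exp_part. apply (LC_bsum R0 Vs _ (fun n xi => F xi ^ n / RtoC (INR (fact n)))). intros n _.
  apply (LC_ext R0 Vs _ (fun xi => / RtoC (INR (fact n)) * F xi ^ n)); [intros; unfold Cdiv; ring|].
  apply LC_scal; [assumption|]. apply (LC_pow R0 Vs HR _ F); auto.
Qed.

(** The argument is bounded on the torus, and on a disc the Taylor polynomials converge
    uniformly. *)
Lemma LC_Cexp F : LC (fun _ => True) F -> LC (fun _ => True) (fun xi => Cexp (F xi)).
Proof.
  intros HF. apply (LC_lim R0 Vs). intros eps Heps.
  destruct (LC_bounded R0 Vs HR _ F HF) as (B & HB & HFB).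
  destruct (exp_part_uniform B eps ltac:(lra) Heps) as (M & HM).
  exists (fun xi => exp_part M (F xi)). split; [now apply LC_exp_part|].
  intros xi Hxi. apply HM; [lia|]. now apply HFB.
Qed.

Lemma LC_epsA_sum c U : incl U Vs -> LC (fun _ => True) (fun xi => bsum (fun i => epsA p (xi i) * c) U).
Proof.
  intros HU. apply (LCw_LC (fun _ => 0%Z) 0). unfold epsA.
  apply (LCw_ext _ _ (fun xi => bsum (fun i => (RtoC p * Cpowz (xi i) (-1) + RtoC (1 - p) * xi i - 1) * c) U)).
  { intros xi _. apply bsum_ext. intros i _. now rewrite Cpowz_m1_r. }
  repeat lc_step; auto; lia.
Qed.

Lemma LC_core (x : list Z) z U L y : incl U Vs -> incl L U ->
  LC (fun _ => True) (fun xi => (bprod (fun l => bprod (fun v => fA p (xi l) (xi v)) (minus_list U L)) L *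
     pprod (fun u v => fA p (xi u) (xi v)) L * bprod (fun ab => Cpowz (xi (fst ab)) (snd ab)) (combine L x)) *
     amp0 sg z (minus_list U L) xi / pprod (fo p xi) U * monoU U y xi).
Proof.
  intros HU HLU.
  assert (HL : incl L Vs) by (intros v Hv; auto).
  assert (HS : incl (minus_list U L) Vs) by (intros v Hv; apply in_minus_list in Hv; apply HU; tauto).
  apply (LCw_LC (fun _ => 0%Z) 0). unfold Cdiv.
  lcw_mult 0%Z 0%Z; [lia| |now apply LCw_monoU].
  lcw_mult 0%Z 0%Z; [lia| |now apply LCw_dens_inv].
  lcw_mult 0%Z 0%Z;
    [lia| |now apply LCw_amp0_wt0].
  lcw_mult 0%Z 0%Z; [lia| |].
  - repeat lc_step; auto; lia.
  - apply (LCw_bprod0 _ 0 (fun ab xi => Cpowz (xi (fst ab)) (snd ab))); [lia|]. intros [l k] Hlk.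
    apply in_combine_l in Hlk. apply LCw_powz; auto. lia.
Qed.

Lemma asep_rhs_EE N m t (Y x : nat -> Z) : (1 <= m)%nat -> incl (iota1 N) Vs ->
  asep_rhs N m p t Y x R0 =
  bsum (fun U => coefU 1 (m - 1) U * EE (fun xi => Cexp (bsum (fun i => epsA p (xi i) * RtoC t) U) *
    Gint (map x (iota1 (m - 1))) (x m) U Y xi)) (subsets (iota1 N)).
Proof.
  intros Hm HNV. unfold asep_rhs.
  pose (F := fun S L => RtoC (coeff N m p S L) * mcint R0 (S ++ L) (integrand N m p t Y x S L) (fun _ => 0)).
  transitivity (bsum (fun S => bsum (fun L => F S L) (Lambdas N m S)) (subsets (iota1 N))).
  { transitivity (bsum (fun c => c) (flat_map (fun S => map (F S) (Lambdas N m S)) (subsets (iota1 N)))).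
    - unfold bsum. now rewrite map_id.
    - rewrite bsum_flat_map. apply bsum_ext. intros S _. exact (bsum_map (F S) (fun c => c) _). }
  rewrite (pairs_reindex N m F). apply bsum_ext. intros U HUs.
  assert (HU : NoDup U) by exact (subsets_NoDup _ U (seq_NoDup N 1) HUs).
  assert (HUN : incl U (iota1 N)) by exact (subsets_incl _ U HUs).
  assert (HUV : incl U Vs) by (intros v Hv; auto).
  pose (T := fun L xi => Cexp (bsum (fun i => epsA p (xi i) * RtoC t) U) *
    (front p (map x (iota1 (m - 1))) L (minus_list U L) xi * amp0 sg (x m) (minus_list U L) xi /
     pprod (fo p xi) U * monoU U Y xi)).
  assert (Hlen : length (map x (iota1 (m - 1))) = (m - 1)%nat) by (unfold iota1; now rewrite length_map, length_seq).
  assert (HLCexp : LC (fun _ => True) (fun xi => Cexp (bsum (fun i => epsA p (xi i) * RtoC t) U)))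
    by (apply (LC_Cexp (fun xi => bsum (fun i => epsA p (xi i) * RtoC t) U)); now apply LC_epsA_sum).
  assert (HT : forall L, In L (arrangements (m - 1) U) -> LC (fun _ => True) (T L)).
  { intros L HL. apply in_arrangements in HL as (H1 & H2 & H3); [|assumption].
    apply (LC_mult R0 Vs HR (fun _ => True) (fun _ => True) _ (fun xi => Cexp (bsum (fun i => epsA p (xi i) * RtoC t) U)));
      [auto|assumption|].
    apply (LC_ext R0 Vs _ (fun xi => (bprod (fun l => bprod (sg l) (minus_list U L)) L * pprod sg L) *
      ((bprod (fun l => bprod (fun v => fA p (xi l) (xi v)) (minus_list U L)) L *
       pprod (fun u v => fA p (xi u) (xi v)) L *
       bprod (fun ab => Cpowz (xi (fst ab)) (snd ab)) (combine L (map x (iota1 (m - 1))))) *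
       amp0 sg (x m) (minus_list U L) xi / pprod (fo p xi) U * monoU U Y xi))).
    - intros xi _. rewrite front_eq by lia. unfold Cdiv. ring.
    - apply LC_scal; [assumption|]. now apply LC_core. }
  transitivity (bsum (fun L => coefU 1 (m - 1) U * EE (T L)) (arrangements (m - 1) U)).
  - apply bsum_ext. intros L HLa. pose proof (HT L HLa) as HTL.
    apply in_arrangements in HLa as (H1 & H2 & H3); [|assumption]. unfold F.
    assert (HP : Permutation (minus_list U L ++ L) U).
    { rewrite (minus_list_perm U L HU H2 H3) at 2. apply Permutation_app_comm. }
    pose (core := fun xi => Cexp (bsum (fun i => epsA p (xi i) * RtoC t) U) *
      ((bprod (fun l => bprod (fun v => fA p (xi l) (xi v)) (minus_list U L)) L *
       pprod (fun u v => fA p (xi u) (xi v)) L *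
       bprod (fun ab => Cpowz (xi (fst ab)) (snd ab)) (combine L (map x (iota1 (m - 1))))) *
       amp0 sg (x m) (minus_list U L) xi / pprod (fo p xi) U * monoU U Y xi)).
    assert (Hcore : LC (fun _ => True) core).
    { apply (LC_mult R0 Vs HR (fun _ => True) (fun _ => True) _ (fun xi => Cexp (bsum (fun i => epsA p (xi i) * RtoC t) U)));
        [auto|assumption|]. now apply LC_core. }
    assert (Hce : forall xi, onT xi -> integrand N m p t Y x (minus_list U L) L xi * bprod xi (minus_list U L ++ L) = core xi).
    { intros xi Hxi. apply integrand_eq; auto. intros v. now apply (onT_neq_0 R0 HR). }
    (* The class of [core] is known; the integrand is recovered from it by dividing by the Jacobian,
       a monomial. *)
    assert (Hint : LC (fun _ => True) (integrand N m p t Y x (minus_list U L) L)).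
    { apply (LC_ext R0 Vs _ (fun xi => core xi * bprod (fun v => Cpowz (xi v) (-1)) (minus_list U L ++ L))).
      - intros xi Hxi. rewrite <- Hce by assumption.
        assert (E : bprod xi (minus_list U L ++ L) * bprod (fun v => Cpowz (xi v) (-1)) (minus_list U L ++ L) = 1).
        { rewrite <- bprod_mult. apply bprod_1. intros v _. rewrite Cpowz_m1_r.
          apply Cinv_r. now apply (onT_neq_0 R0 HR). }
        rewrite <- Cmult_assoc, E. ring.
      - apply (LC_mult R0 Vs HR (fun _ => True) (fun _ => True) _ core); [auto|assumption|].
        apply (LCw_LC (fun _ => 0%Z) 0).
        apply (LCw_bprod0 _ 0 (fun v xi => Cpowz (xi v) (-1))); [lia|]. intros v Hv.
        apply LCw_powz; [|lia]. apply HUV. now apply (Permutation_in _ HP). }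
    rewrite (EE_mcint R0 Vs HR HVs).
    + rewrite <- (EE_scal R0 Vs HR HVs (fun _ => True)).
      2: { apply (LC_ext R0 Vs _ core); [intros; symmetry; now apply Hce|assumption]. }
      rewrite <- (EE_scal R0 Vs HR HVs (fun _ => True)) by assumption.
      apply (EE_ext R0 Vs HR). intros xi Hxi. apply term_eq; auto. intros v. now apply (onT_neq_0 R0 HR).
    + now apply (Permutation_NoDup (Permutation_sym HP)).
    + intros v Hv. apply HUV. now apply (Permutation_in _ HP).
    + assumption.
    + intros xi eta H. apply integrand_local with (U := U); auto.
  - rewrite bsum_scal. f_equal. rewrite <- (EE_bsum R0 Vs HR HVs (fun _ => True) T) by exact HT.
    apply (EE_ext R0 Vs HR). intros xi Hxi. unfold T, Gint. rewrite bsum_scal. f_equal.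
    rewrite amp_expand, Hlen by assumption. unfold Cdiv.
    set (W := bsum (fun L => front p (map x (iota1 (m - 1))) L (minus_list U L) xi * amp0 sg (x m) (minus_list U L) xi) (arrangements (m - 1) U)).
    transitivity ((/ pprod (fo p xi) U * monoU U Y xi) * W); [|ring]. unfold W. rewrite <- bsum_scal.
    apply bsum_ext. intros L _. ring.
Qed.

Lemma Cmod_EE_le F e : LC (fun _ => True) F -> (forall xi, onT xi -> (Cmod (F xi) <= e)%R) -> (Cmod (EE F) <= e)%R.
Proof.
  intros HF H. replace (EE F) with (EE F - pmean Vs []) by (unfold pmean; cbn; ring).
  apply (EE_approx R0 Vs HR HVs (fun _ => True)); [assumption|]. intros xi Hxi.
  replace (F xi - leval Vs [] xi) with (F xi); [now apply H|]. unfold leval. rewrite bsum_nil. ring.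
Qed.

(** * Summation over the number of rings *)

Section SeriesLimit.
Variables (N m : nat) (t : R) (Y x : nat -> Z).
Hypothesis HN : (1 <= N)%nat.
Hypothesis HNV : incl (iota1 N) Vs.

Let xs := map x (iota1 (m - 1)).
Let z := x m.
Let c := RtoC (exp (- (INR N * t))).
Let w U xi := RtoC (INR N * t) * lam N U xi.

(** The Poisson weight e^(-Nt) removes the summand 1 of [lam], and the factor N t turns the mean of
    the eps into t times their sum. *)
Lemma Cexp_shift U xi : c * Cexp (w U xi) = Cexp (bsum (fun i => epsA p (xi i) * RtoC t) U).
Proof.
  unfold c, w. rewrite <- Cexp_RtoC, <- Cexp_add. f_equal. unfold lam.
  rewrite RtoC_opp, RtoC_mult.
  assert (HNR : RtoC (INR N) <> 0) by (intros H; apply RtoC_inj in H; apply lt_0_INR in HN; lra).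
  rewrite (bsum_ext (fun i => epsA p (xi i) * RtoC t) (fun i => RtoC t * epsA p (xi i))) by (intros; ring).
  rewrite bsum_scal. field. exact HNR.
Qed.

Lemma LC_w U : incl U Vs -> LC (fun _ => True) (w U).
Proof.
  intros HU. unfold w, lam.
  apply (LC_ext R0 Vs _ (fun xi => RtoC (INR N * t) + RtoC (INR N * t) * / RtoC (INR N) * bsum (fun i => epsA p (xi i) * 1) U)).
  - intros xi _. rewrite (bsum_ext _ (fun i => epsA p (xi i))) by (intros; ring). ring.
  - apply (LC_plus R0 Vs _ (fun _ => RtoC (INR N * t))); [now apply LC_const|].
    apply LC_scal; [assumption|]. now apply LC_epsA_sum.
Qed.

Lemma partial_sum_eq M : (forall n, RtoC (Kn N p Y m x n) = contour_sum N xs z n Y) ->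
  RtoC (sum_n (fun n => exp (- (INR N * t)) * (INR N * t) ^ n / INR (fact n) * Kn N p Y m x n)%R M) =
  bsum (fun U => coefU 1 (length xs) U * EE (fun xi => c * exp_part M (w U xi) * Gint xs z U Y xi)) (subsets (iota1 N)).
Proof.
  intros HK. rewrite RtoC_sum_n.
  rewrite (bsum_ext _ (fun n => bsum (fun U => coefU 1 (length xs) U *
    EE (fun xi => c * (w U xi ^ n / RtoC (INR (fact n))) * Gint xs z U Y xi)) (subsets (iota1 N)))).
  2: { intros n _. rewrite RtoC_mult, HK. unfold contour_sum. rewrite <- bsum_scal. apply bsum_ext. intros U HUs.
    assert (HUV : incl U Vs) by (intros v Hv; apply HNV; exact (subsets_incl _ U HUs v Hv)).
    set (a := RtoC _). transitivity (coefU 1 (length xs) U * (a * EE (fun xi => lam N U xi ^ n * Gint xs z U Y xi))); [ring|].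
    f_equal. rewrite <- (EE_scal R0 Vs HR HVs (fun _ => True)) by now apply LC_lam_Gint.
    apply (EE_ext R0 Vs HR). intros xi _. unfold a, w, c.
    assert (Hf : INR (fact n) <> 0%R) by apply INR_fact_neq_0.
    rewrite RtoC_div, !RtoC_mult, RtoC_pow, !RtoC_mult, !Cpow_mult_l by assumption.
    unfold Cdiv. ring. }
  rewrite bsum_exchange. apply bsum_ext. intros U HUs.
  assert (HUV : incl U Vs) by (intros v Hv; apply HNV; exact (subsets_incl _ U HUs v Hv)).
  rewrite bsum_scal. f_equal.
  rewrite <- (EE_bsum R0 Vs HR HVs (fun _ => True) (fun n xi => c * (w U xi ^ n / RtoC (INR (fact n))) * Gint xs z U Y xi)).
  - apply (EE_ext R0 Vs HR). intros xi _. unfold exp_part.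
    transitivity ((c * Gint xs z U Y xi) * bsum (fun n => w U xi ^ n / RtoC (INR (fact n))) (seq 0 (S M))); [|ring].
    rewrite <- bsum_scal. apply bsum_ext. intros n _. ring.
  - intros n _. apply (LC_ext R0 Vs _ (fun xi => (c * / RtoC (INR (fact n))) * (w U xi ^ n * Gint xs z U Y xi))).
    + intros xi _. unfold Cdiv. ring.
    + apply LC_scal; [assumption|].
      apply (LC_mult R0 Vs HR (fun _ => True) (fun _ => True) _ (fun xi => w U xi ^ n)); [auto| |now apply LC_Gint].
      apply (LC_pow R0 Vs HR _ (w U)); auto. now apply LC_w.
Qed.

Lemma term_lim U : incl U Vs -> forall eps, (0 < eps)%R -> exists M0, forall M, (M0 <= M)%nat ->
  Rle (Cmod (coefU 1 (length xs) U * EE (fun xi => c * exp_part M (w U xi) * Gint xs z U Y xi) -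
         coefU 1 (length xs) U * EE (fun xi => Cexp (bsum (fun i => epsA p (xi i) * RtoC t) U) * Gint xs z U Y xi))) eps.
Proof.
  intros HUV eps Heps.
  pose proof (LC_Gint xs z U Y HUV) as HG. pose proof (LC_w U HUV) as Hw.
  destruct (LC_bounded R0 Vs HR _ _ HG) as (BG & HBG & HGb).
  destruct (LC_bounded R0 Vs HR _ _ Hw) as (B & HB & Hwb).
  (* The summand 1 keeps [K] positive even if the coefficient vanishes. *)
  set (K := (Cmod (coefU 1 (length xs) U) * (Cmod c * BG) + 1)%R).
  assert (HK : (0 < K)%R).
  { unfold K. pose proof (Cmod_ge_0 (coefU 1 (length xs) U)). pose proof (Cmod_ge_0 c).
    assert (0 <= Cmod (coefU 1 (length xs) U) * (Cmod c * BG))%R by (apply Rmult_le_pos; [|apply Rmult_le_pos]; lra). lra. }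
  destruct (exp_part_uniform B (eps / K) ltac:(lra)) as (M0 & HM0); [now apply Rdiv_lt_0_compat|].
  exists M0. intros M HM.
  assert (H1 : LC (fun _ => True) (fun xi => c * exp_part M (w U xi) * Gint xs z U Y xi)).
  { apply (LC_mult R0 Vs HR (fun _ => True) (fun _ => True) _ (fun xi => c * exp_part M (w U xi))); [auto| |assumption].
    apply LC_scal; [assumption|]. now apply LC_exp_part. }
  assert (H2 : LC (fun _ => True) (fun xi => Cexp (bsum (fun i => epsA p (xi i) * RtoC t) U) * Gint xs z U Y xi)).
  { apply (LC_mult R0 Vs HR (fun _ => True) (fun _ => True) _ (fun xi => Cexp (bsum (fun i => epsA p (xi i) * RtoC t) U))); [auto| |assumption].
    apply (LC_Cexp (fun xi => bsum (fun i => epsA p (xi i) * RtoC t) U)). now apply LC_epsA_sum. }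
  match goal with |- Rle (Cmod ?e) _ => replace e with (coefU 1 (length xs) U *
    (EE (fun xi => c * exp_part M (w U xi) * Gint xs z U Y xi) -
     EE (fun xi => Cexp (bsum (fun i => epsA p (xi i) * RtoC t) U) * Gint xs z U Y xi))) by ring end.
  rewrite <- (EE_minus (fun _ => True) (fun _ => True)) by assumption.
  rewrite Cmod_mult.
  apply Rle_trans with (Cmod (coefU 1 (length xs) U) * (Cmod c * (eps / K) * BG))%R.
  - apply Rmult_le_compat_l; [apply Cmod_ge_0|]. apply Cmod_EE_le.
    + apply (LC_ext R0 Vs _ (fun xi => c * exp_part M (w U xi) * Gint xs z U Y xi + - (1) *
        (Cexp (bsum (fun i => epsA p (xi i) * RtoC t) U) * Gint xs z U Y xi))); [intros; ring|].
      apply (LC_plus R0 Vs _ (fun xi => c * exp_part M (w U xi) * Gint xs z U Y xi)); [assumption|now apply LC_scal].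
    + intros xi Hxi. rewrite <- Cexp_shift.
      replace (c * exp_part M (w U xi) * Gint xs z U Y xi - c * Cexp (w U xi) * Gint xs z U Y xi) with
        (- (c * (Cexp (w U xi) - exp_part M (w U xi)) * Gint xs z U Y xi)) by ring.
      rewrite Cmod_opp, !Cmod_mult. apply Rmult_le_compat; auto using Cmod_ge_0.
      * apply Rmult_le_pos; apply Cmod_ge_0.
      * apply Rmult_le_compat_l; [apply Cmod_ge_0|]. apply HM0; auto.
  - replace (Cmod (coefU 1 (length xs) U) * (Cmod c * (eps / K) * BG))%R with
      ((K - 1) * (eps / K))%R by (unfold K; ring).
    assert (E : (K * (eps / K) = eps)%R) by (field; lra).
    assert (0 < eps / K)%R by now apply Rdiv_lt_0_compat. lra.
Qed.

Lemma series_limit : (1 <= m)%nat -> (forall n, RtoC (Kn N p Y m x n) = contour_sum N xs z n Y) ->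
  RtoC (asep_prob N p t Y m x) = asep_rhs N m p t Y x R0.
Proof.
  intros Hm HK. rewrite asep_rhs_EE by assumption.
  set (f := (fun n => exp (- (INR N * t)) * (INR N * t) ^ n / INR (fact n) * Kn N p Y m x n)%R).
  assert (Hlen : (m - 1)%nat = length xs) by (unfold xs, iota1; now rewrite length_map, length_seq).
  fold xs z. rewrite Hlen.
  set (r := bsum _ _).
  assert (Hlim : forall eps, (0 < eps)%R -> exists M0, forall M, (M0 <= M)%nat -> (Cmod (RtoC (sum_n f M) - r) <= eps)%R).
  { intros eps Heps.
    destruct (bsum_lim (fun U M => coefU 1 (length xs) U * EE (fun xi => c * exp_part M (w U xi) * Gint xs z U Y xi))
      (fun U => coefU 1 (length xs) U * EE (fun xi => Cexp (bsum (fun i => epsA p (xi i) * RtoC t) U) * Gint xs z U Y xi))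
      (subsets (iota1 N))) with (eps := eps) as (M0 & HM0); [|assumption|].
    - intros U HUs. apply term_lim. intros v Hv. apply HNV. exact (subsets_incl _ U HUs v Hv).
    - exists M0. intros M HM. unfold f. rewrite partial_sum_eq by assumption. now apply HM0. }
  (* The partial sums are real, hence so is their limit; convergence of the series follows from the
     same estimate on the first component. *)
  assert (Him : snd r = 0%R).
  { apply cond_eq. intros eps Heps. destruct (Hlim (eps / 2)%R ltac:(lra)) as (M0 & HM0).
    specialize (HM0 M0 (le_n _)). pose proof (Cmod_snd (RtoC (sum_n f M0) - r)) as H.
    change (snd (RtoC (sum_n f M0) - r)) with (0 + - snd r)%R in H.
    rewrite Rminus_0_r. rewrite <- Rabs_Ropp.
    replace (- snd r)%R with (0 + - snd r)%R by ring. lra. }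
  assert (Hser : is_series f (fst r)).
  { change (is_lim_seq (sum_n f) (Finite (fst r))). apply is_lim_seq_spec. intros eps.
    destruct (Hlim (eps / 2)%R) as (M0 & HM0); [destruct eps; simpl; lra|].
    exists M0. intros M HM. specialize (HM0 M HM). pose proof (Cmod_fst (RtoC (sum_n f M) - r)) as H.
    change (fst (RtoC (sum_n f M) - r)) with (sum_n f M + - fst r)%R in H.
    destruct eps as [eps He]; simpl in *. unfold Rminus. lra. }
  unfold asep_prob. fold f. rewrite (is_series_unique _ _ Hser).
  rewrite (surjective_pairing r), Him. reflexivity.
Qed.

End SeriesLimit.

End Weights.

Close Scope C_scope.
Open Scope R_scope.

Theorem theorem2 (N m : nat) (p t : R) (Y x : nat -> Z) :
  (1 <= N)%nat ->
  0 <= p < 1 ->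
  0 <= t ->
  (forall i : nat, (1 <= i < N)%nat -> (Y i < Y (S i))%Z) ->
  (1 <= m <= N)%nat ->
  (forall i : nat, (1 <= i < m)%nat -> (x i < x (S i))%Z) ->
  exists R1 : R, forall R0 : R, R1 < R0 ->
    RtoC (asep_prob N p t Y m x) = asep_rhs N m p t Y x R0.
Proof.
  (* The radius required by [Cmod_fgap]; it does not depend on t, Y, x, N or m. *)
  intros HN Hp Ht HY Hm Hx. exists (4 / (1 - p)). intros R0 HR0.
  assert (HV : NoDup (iota1 N)) by apply seq_NoDup.
  apply (series_limit R0 (iota1 N) p Hp HR0 HV); [assumption|apply incl_refl|lia|].
  intros n. apply (Kn_contour_sum R0 (iota1 N) p Hp HR0 HV); auto using incl_refl.
Qed.
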